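(* Let $X$ be a globally hyperbolic regular Lorentzian length space. If $X$ is locally concave and every pair of timelike related points $x\ll y$ in $X$ can be joined by a unique timelike geodesic $\gamma_{x,y}$, then: (i) Each timelike geodesic $\gamma_{x,y}$ is length-maximizing, i.e. $L(\gamma_{x,y})=\tau(x,y)$. (ii) $X$ is globally concave, i.e. the whole space $X$ is a comparison neighborhood.
   Context: A Lorentzian pre-length space is a tuple $(X,d,\ll,\leq,\tau)$ where $(X,d)$ is a metric space (all topological notions refer to $d$), $\leq$ is a reflexive transitive relation (causal relation), $\ll$ is a transitive relation contained in $\leq$ (timelike relation), and $\tau\colon X\times X\to[0,\infty]$ (time separation) is lower semicontinuous with $\tau(x,z)\geq\tau(x,y)+\tau(y,z)$ for $x\leq y\leq z$, and $\tau(x,y)>0$ iff $x\ll y$. Put $I^+(x)=\{y: x\ll y\}$, $I^-(x)=\{y: y\ll x\}$, $J^\pm(x)$ likewise with $\leq$, $J(x,y)=J^+(x)\cap J^-(y)$; $x<y$ means $x\le y$, $x\neq y$. Curves. A non-constant, locally Lipschitz curve $\gamma$ on an interval is future-directed causal (timelike) if $\gamma(t_1)\leq\gamma(t_2)$ (resp. $\gamma(t_1)\ll\gamma(t_2)$) whenever $t_1<t_2$; past-directed curves are defined by reversing the relations. The length $L(\gamma)$ of a future-directed causal curve is $\inf\sum_{i}\tau(\gamma(t_{i-1}),\gamma(t_i))$ over all partitions of its domain. A maximizer is a future-directed causal curve $\gamma$ from $x$ to $y$ with $L(\gamma)=\tau(x,y)$ (similarly, with time reversed, for past-directed curves). A geodesic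 is a causal curve that is locally a maximizer: every parameter has a neighborhood in the domain on which the restriction is a maximizer. Timelike maximizers and timelike geodesics are taken with constant-speed parametrization ($\tau$-length from the initial point proportional to the parameter), and uniqueness of such curves is understood up to reparametrization. $X$ is regular if every maximizer between timelike related points is timelike. $X$ is globally hyperbolic if all causal diamonds $J(x,y)$ are compact and for every compact $K\subseteq X$ there is a constant $C(K)$ bounding the $d$-arclength of all causal curves contained in $K$. $X$ is locally causally closed if every point has a neighborhood $U$ such that $p_n\leq q_n$, $p_n,q_n\in U$, $p_n\to p\in\overline U$, $q_n\to q\in\overline U$ imply $p\leq q$. $X$ is causally path-connected if any $x\ll y$ are joined by a future-directed timelike curve and any $x<y$ by a future-directed causal curve. $X$ is localizable if every $x\in X$ has an open neighborhood $\Omega$ such that: there is $C>0$ bounding the $d$-arclength of all causal curves in $\Omega$; there is a continuous $\omega\colon\Omega\times\Omega\to[0,\infty)$ making $\Omega$ (with restricted $d,\ll,\leq$ and with $\omega$ as time separation) a Lorentzian pre-length space with $I^\pm(y)\cap\Omega\neq\varnothing$ for all $y\in\Omega$; and for all $p<q$ in $\Omega$ there is a future-directed causal curve from $p$ to $q$ in $\Omega$ which is of maximal length among such curves in $\Omega$ and whose length equals $\omega(p,q)\leq\tau(p,q)$. A Lorentzian length space is a locally causally closed, causally path-connected, localizable Lorentzian pre-length space with $\tau(x,y)=\sup\{L(\gamma): \gamma$ future-directed causal from $x$ to $y\}$ (sup of the empty set being $0$). A comparison neighborhood is a set $U\subseteq X$ (a neighborhood of the point considered) such that: (1) $\tau|_{U\times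 U}$ is continuous; (2) for all $x,y\in U$ with $x\ll y$ there is a future-directed causal curve from $x$ to $y$ within $U$ of length $\tau(x,y)$; (3) for any two timelike maximizers $\alpha,\beta\colon[0,1]\to U$ with the same time orientation such that [$\alpha(0)\ll\beta(0)$ or $\alpha(0)=\beta(0)$] and [$\alpha(1)\ll\beta(1)$ or $\alpha(1)=\beta(1)$], one has $\tau(\alpha(t),\beta(t))\geq t\,\tau(\alpha(1),\beta(1))+(1-t)\,\tau(\alpha(0),\beta(0))$ for all $t\in[0,1]$. $X$ is locally concave if every point of $X$ has a comparison neighborhood. *)

(* Defs.v *)
From HB Require Import structures.
From mathcomp Require Import all_boot all_order all_algebra.
From mathcomp Require Import all_classical all_reals all_analysis.

Set Implicit Arguments.
Unset Strict Implicit.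
Unset Printing Implicit Defensive.

Import Order.TTheory GRing.Theory Num.Theory.
Import numFieldNormedType.Exports.

Local Open Scope classical_set_scope.
Local Open Scope ring_scope.

(** The axioms are relative to a subset [A], because localizability asks for
    them on a neighborhood with another time separation. Semicontinuity is kept
    apart: there it is subsumed by continuity. *)
Record causal_axioms (R : realType) (T : Type) (A : set T)
    (ll le : T -> T -> Prop) (tau : T -> T -> \bar R) : Prop := CausalAxioms {
  causal_refl : forall x, A x -> le x x ;
  causal_trans : forall x y z, A x -> A y -> A z ->
    le x y -> le y z -> le x z ;
  timelike_trans : forall x y z, A x -> A y -> A z ->
    ll x y -> ll y z -> ll x z ;
  timelike_causal : forall x y, A x -> A y -> ll x y -> le x y ;
  tau_ge0 : forall x y, A x -> A y -> (0 <= tau x y)%E ;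
  tau_reverse_triangle : forall x y z, A x -> A y -> A z ->
    le x y -> le y z -> (tau x y + tau y z <= tau x z)%E ;
  tau_gt0 : forall x y, A x -> A y -> (0 < tau x y)%E <-> ll x y
}.

Record lorentzianPreLengthSpace (R : realType) := LorentzianPreLengthSpace {
  lpls_metric :> metricType R ;
  timelike : lpls_metric -> lpls_metric -> Prop ;
  causal : lpls_metric -> lpls_metric -> Prop ;
  tau : lpls_metric -> lpls_metric -> \bar R ;
  lpls_axioms : causal_axioms [set: lpls_metric] timelike causal tau ;
  tau_lsc : lower_semicontinuous
    (fun p : (lpls_metric * lpls_metric)%type => tau p.1 p.2)
}.

Inductive time_orientation := Future | Past.

Section LorentzianPreLength.
Context {R : realType} {X : lorentzianPreLengthSpace R}.
Implicit Types (o : time_orientation) (x y : X) (U K : set X) (I : set R)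
  (gamma sigma alpha beta : R -> X) (a b c d : R).

Definition timelike_dir o x y : Prop :=
  if o is Future then timelike x y else timelike y x.

Definition causal_dir o x y : Prop :=
  if o is Future then causal x y else causal y x.

Definition tau_dir o x y : \bar R :=
  if o is Future then tau x y else tau y x.

(** A curve on the interval [I] is a function on [R]; only its values on [I]
    are ever used. *)
Definition locally_lipschitz I gamma : Prop :=
  forall t, I t -> exists k : R, exists2 V, nbhs t V &
    forall r s, (I `&` V) r -> (I `&` V) s ->
      mdist (gamma r) (gamma s) <= k * `|r - s|.

Definition curve I gamma : Prop :=
  [/\ is_interval I, locally_lipschitz I gamma &
      exists r s, [/\ I r, I s & gamma r <> gamma s]].

Definition causal_curve o I gamma : Prop :=
  curve I gamma /\
  forall r s, I r -> I s -> r < s -> causal_dir o (gamma r) (gamma s).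

Definition timelike_curve o I gamma : Prop :=
  curve I gamma /\
  forall r s, I r -> I s -> r < s -> timelike_dir o (gamma r) (gamma s).

Definition causal_curve_from_to U x y gamma a b : Prop :=
  [/\ causal_curve Future `[a, b] gamma, gamma @` `[a, b] `<=` U,
      gamma a = x & gamma b = y].

Definition timelike_curve_from_to x y gamma a b : Prop :=
  [/\ timelike_curve Future `[a, b] gamma, gamma a = x & gamma b = y].

(** A partition a = t_0 < t_1 < ... < t_n = b is encoded as [a :: s], where
    [itv_partition a b s]. *)
Definition length o gamma a b : \bar R :=
  ereal_inf [set (\sum_(0 <= i < size s)
      tau_dir o (gamma (nth b (a :: s) i)) (gamma (nth b (a :: s) i.+1)))%E
    | s in itv_partition a b].

Definition arclength I gamma : \bar R :=
  ereal_sup [set l | exists a b s, [/\ I a, I b, itv_partition a b s &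
    l = (\sum_(0 <= i < size s)
      mdist (gamma (nth b (a :: s) i)) (gamma (nth b (a :: s) i.+1)))%:E]].

Definition bounds_arclength U (C : R) : Prop :=
  forall o I gamma, causal_curve o I gamma -> gamma @` I `<=` U ->
    (arclength I gamma <= C%:E)%E.

Definition maximizer o gamma a b : Prop :=
  causal_curve o `[a, b] gamma /\
  length o gamma a b = tau_dir o (gamma a) (gamma b).

Definition geodesic o gamma a b : Prop :=
  causal_curve o `[a, b] gamma /\
  forall t, `[a, b]%classic t -> exists c d,
    [/\ `[c, d] `<=` `[a, b], within `[a, b]%classic (nbhs t) `[c, d]%classic &
        maximizer o gamma c d].

(** gamma on [a, b] is obtained from sigma on [c, d] by a monotone change of
    parameter phi; phi is onto [c, d] by continuity, and may have plateaus. *)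
Definition reparametrizes gamma a b sigma c d : Prop :=
  a <= b /\ exists phi : R -> R,
    [/\ {in `[a, b] &, {homo phi : r s / r <= s}},
        {within `[a, b], continuous phi}, phi a = c, phi b = d &
        forall t, `[a, b]%classic t -> gamma t = sigma (phi t)].

Definition constant_speed o gamma a b : Prop :=
  exists v : R, forall t, `[a, b]%classic t ->
    length o gamma a t = (v * (t - a))%:E.

(** Parametrization by tau-length can destroy local Lipschitz continuity, which
    is therefore required of some parametrization sigma only. *)
Definition timelike_maximizer o gamma a b : Prop :=
  constant_speed o gamma a b /\
  exists sigma c d, [/\ timelike_curve o `[c, d] sigma, maximizer o sigma c d &
    reparametrizes gamma a b sigma c d].

Definition timelike_geodesic o gamma a b : Prop :=
  constant_speed o gamma a b /\
  exists sigma c d, [/\ timelike_curve o `[c, d] sigma, geodesic o sigma c d &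
    reparametrizes gamma a b sigma c d].

Definition timelike_geodesic_from_to x y gamma a b : Prop :=
  [/\ timelike_geodesic Future gamma a b, gamma a = x & gamma b = y].

Definition unique_timelike_geodesic x y : Prop :=
  (exists gamma a b, timelike_geodesic_from_to x y gamma a b) /\
  forall gamma a b sigma c d,
    timelike_geodesic_from_to x y gamma a b ->
    timelike_geodesic_from_to x y sigma c d ->
    reparametrizes gamma a b sigma c d.

Definition causal_diamond x y : set X := [set z | causal x z /\ causal z y].

Definition localizing_neighborhood U : Prop :=
  open U /\
  (exists2 C : R, 0 < C & bounds_arclength U C) /\
  exists omega : X -> X -> R,
    [/\ {within U `*` U, continuous (fun p : (X * X)%type => omega p.1 p.2)},
        causal_axioms U (@timelike R X) (@causal R X)
          (fun x y => (omega x y)%:E),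
        forall y, U y -> (exists2 z, U z & timelike y z) /\
                         (exists2 z, U z & timelike z y) &
        forall p q, U p -> U q -> causal p q -> p <> q ->
          (omega p q)%:E <= tau p q /\
          exists gamma a b, [/\ causal_curve_from_to U p q gamma a b,
            length Future gamma a b = (omega p q)%:E &
            forall sigma c d, causal_curve_from_to U p q sigma c d ->
              length Future sigma c d <= length Future gamma a b]]%E.

Definition comparison_set U : Prop :=
  [/\ {within U `*` U, continuous (fun p : (X * X)%type => tau p.1 p.2)},
      forall x y, U x -> U y -> timelike x y ->
        exists gamma a b, causal_curve_from_to U x y gamma a b /\
          length Future gamma a b = tau x y &
      forall o alpha beta,
        timelike_maximizer o alpha 0 1 -> timelike_maximizer o beta 0 1 ->
        alpha @` `[0, 1] `<=` U -> beta @` `[0, 1] `<=` U ->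
        timelike (alpha 0) (beta 0) \/ alpha 0 = beta 0 ->
        timelike (alpha 1) (beta 1) \/ alpha 1 = beta 1 ->
        forall t : R, `[0, 1]%classic t ->
          (t%:E * tau (alpha 1%R) (beta 1%R) +
            (1 - t)%:E * tau (alpha 0%R) (beta 0%R)
            <= tau (alpha t) (beta t))%E].

End LorentzianPreLength.

Section Properties.
Context {R : realType} (X : lorentzianPreLengthSpace R).

(** Inserting a stop into a causal curve gives a causal curve of the same
    length, which is not timelike. Being timelike is therefore meant up to
    removal of such plateaus, i.e. up to reparametrization. *)
Definition regular : Prop :=
  forall (gamma : R -> X) a b,
    maximizer Future gamma a b -> timelike (gamma a) (gamma b) ->
    exists sigma c d, timelike_curve Future `[c, d] sigma /\
      reparametrizes gamma a b sigma c d.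

Definition globally_hyperbolic : Prop :=
  (forall x y : X, compact (causal_diamond x y)) /\
  forall K : set X, compact K -> exists C : R, bounds_arclength K C.

Definition locally_causally_closed : Prop :=
  forall x : X, exists2 U, nbhs x U &
    forall (p q : nat -> X) (p0 q0 : X),
      (forall n, [/\ U (p n), U (q n) & causal (p n) (q n)]) ->
      closure U p0 -> closure U q0 ->
      p @ \oo --> p0 -> q @ \oo --> q0 -> causal p0 q0.

Definition causally_path_connected : Prop :=
  (forall x y : X, timelike x y ->
    exists gamma a b, timelike_curve_from_to x y gamma a b) /\
  (forall x y : X, causal x y -> x <> y ->
    exists gamma a b, causal_curve_from_to setT x y gamma a b).

Definition localizable : Prop :=
  forall x : X, exists2 U, U x & localizing_neighborhood U.

(** Adding 0 to the set of lengths only matters when no causal curve joins the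
    two points. *)
Definition intrinsic : Prop :=
  forall x y : X, tau x y = ereal_sup (0%E |` [set l |
    exists gamma a b, causal_curve_from_to setT x y gamma a b /\
      l = length Future gamma a b]).

Definition lorentzian_length_space : Prop :=
  [/\ locally_causally_closed, causally_path_connected, localizable
    & intrinsic].

Definition locally_concave : Prop :=
  forall x : X, exists2 U, nbhs x U & comparison_set U.

Definition globally_concave : Prop := comparison_set [set: X].

End Properties.

(* Main.v *)
(** A causal curve in a compact set has bounded arclength, so it can be replaced
    by a chain of a bounded number of short causal steps without decreasing the
    sum of the time separations. Such chains form a compact family on which the
    sum is continuous, because [tau] is continuous on comparison neighborhoods.
    Hence [tau] is finite and continuous, the causal relation is closed, and any
    two timelike related points are joined by a maximizer. By regularity and
    uniqueness, the maximizer is the only timelike geodesic, which gives (i).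

    For (ii), let [x'] and [y'] be close to the endpoints [x], [y] of a segment
    and in their future. Among the chains from [x'] to [y'] whose nodes stay in
    the future of the nodes of the segment, with a quantitative lower bound that
    comparison neighborhoods preserve under taking midpoints, minimize
    [\sum_i (A - l_i)^2], where [l_i] is the time separation of the [i]-th step.
    Small values force the chain to be close to the segment, and each node of a
    minimal chain is the midpoint of its neighbours. The chain is thus a geodesic
    from [x'] to [y'], hence the segment between them, and concavity in small
    pieces adds up. Moving first the future and then the past endpoint along
    segments, through the diagonal of the quadrilateral, gives global concavity.
    Staying in the future is what replaces the convergence estimates of the
    Alexander-Bishop argument for metric spaces. *)

Require Import Defs.
From HB Require Import structures.
From mathcomp Require Import all_boot all_order all_algebra.
From mathcomp Require Import all_classical all_reals all_analysis.
From mathcomp Require Import ring lra.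

Set Implicit Arguments.
Unset Strict Implicit.
Unset Printing Implicit Defensive.

Import Order.TTheory GRing.Theory Num.Theory.
Import numFieldNormedType.Exports.

Local Open Scope classical_set_scope.
Local Open Scope ring_scope.

(** * Sequences in compact metric spaces *)

(** Why squares: the total of the [l_i] alone does not single out a chain, because any nodes placed
    in order on the segment give the same total. The function [(A - l)^2] is strictly convex, and
    decreasing for [l <= A], so it favours both a large total and equal steps. The obstacle:
    comparison neighborhoods only compare endpoints that are equal or timelike related, and
    closeness of a chain to the segment says nothing about the relation between corresponding nodes.
    Asking for [timelike] directly is no closed condition, so minimizers could be lost. The
    constraint is instead a lower bound on the time separation from node to node, affine in the
    index. It is closed, it is positive at inner nodes unless the claim is trivial, and the midpoint
    comparison reproduces it. Replacing a node by a midpoint thus stays admissible, and the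
    constraint never interferes with minimality. The bound is capped by what the shifted segment,
    the initial admissible chain, can offer; the uncapped bound is recovered at the end from
    concavity along the minimal chain. *)

Section MetricSequences.
Context {R : realType} {T : metricType R}.
Implicit Types (K : set T) (u : nat -> T) (l : T).

Lemma cvg_mdistP u l : u @ \oo --> l <->
  forall e : R, 0 < e -> exists n0, forall n, (n0 <= n)%N -> mdist l (u n) < e.
Proof.
split=> [/metricType_numDomainType.cvgrPdist_lt h e /h [n0 _ hn0]|h]; first by exists n0.
by apply/metricType_numDomainType.cvgrPdist_lt => e /h [n0 hn0]; exists n0.
Qed.

Lemma cvg_mdist_sub u l (f : nat -> nat) : (forall n, n <= f n)%N ->
  u @ \oo --> l -> (u \o f) @ \oo --> l.
Proof.
move=> nf /cvg_mdistP h; apply/cvg_mdistP => e /h [n0 hn0].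
by exists n0 => n nn0; apply: hn0; exact: leq_trans (nf n).
Qed.

Lemma cvg_mdist_lt_inv u l : (forall n, mdist l (u n) < n.+1%:R^-1) ->
  u @ \oo --> l.
Proof.
move=> h; apply/metricType_numDomainType.cvgrPdist_lt => e e0; near=> n.
apply: lt_trans (h n) _; near: n; exact: near_infty_natSinv_lt (PosNum e0).
Unshelve. all: by end_near. Qed.

(** A subsequence is given by any [f] with [n <= f n]; monotonicity of [f] is
    never needed to transfer limits. *)
Lemma compact_subseq K u : compact K -> (forall n, K (u n)) ->
  exists l f, [/\ K l, (forall n, n <= f n)%N & (u \o f) @ \oo --> l].
Proof.
move=> cK Ku.
have [|l [Kl cl]] := cK (u @ \oo).
  by exists 0%N => // n _; exact: Ku.
have h n : exists m, (n <= m)%N /\ mdist l (u m) < n.+1%:R^-1.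
  have [||z [[m nm <-] lz]] := cl (u @` [set m | (n <= m)%N])
    (ball l n.+1%:R^-1).
  - by exists n => // m nm; exists m.
  - by apply: nbhsx_ballx; rewrite invr_gt0.
  by exists m; move: lz; rewrite ballEmdist.
have [f hf] := choice h; exists l, f; split=> // [n|]; first by case: (hf n).
by apply: cvg_mdist_lt_inv => n; case: (hf n).
Qed.

Lemma compact_subseq_fin K (N : nat) (P : nat -> nat -> T) : compact K ->
  (forall n i, (i < N)%N -> K (P n i)) ->
  exists (p : nat -> T) f, [/\ forall n, (n <= f n)%N,
    forall i, (i < N)%N -> K (p i) &
    forall i, (i < N)%N -> (fun n => P (f n) i) @ \oo --> p i].
Proof.
move=> cK; elim: N => [|N IH] KP.
  by exists (fun=> P 0%N 0%N), id; split.
have [|p [f [nf Kp hp]]] := IH; first by move=> n i iN; apply: KP; exact: ltnW.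
have [|l [g [Kl ng hl]]] := @compact_subseq K (fun n => P (f n) N) cK.
  by move=> n; apply: KP.
exists (fun i => if i == N then l else p i), (f \o g); split.
- by move=> n /=; exact: leq_trans (ng n) (nf _).
- by move=> i; rewrite ltnS leq_eqVlt; case: eqP => //= _; exact: Kp.
- move=> i; rewrite ltnS leq_eqVlt; case: eqP => [-> _|_ /= iN]; first exact: hl.
  exact: cvg_mdist_sub ng (hp _ iN).
Qed.

(** Points violating [P] at radii tending to 0 would subconverge to a point around which [P] holds
    at a fixed radius. It serves for uniform scales on compact sets and for uniform continuity of
    segments. *)
Lemma lebesgue_number K (P : T -> R -> Prop) : compact K ->
  (forall p r s, s <= r -> P p r -> P p s) ->
  (forall x, exists2 r, 0 < r & forall p, mdist x p < r -> P p r) ->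
  exists2 r, 0 < r & forall p, K p -> P p r.
Proof.
move=> cK Pdec Ploc; apply/not_exists2P => hr.
have {hr} h (n : nat) : exists p, K p /\ ~ P p n.+1%:R^-1.
  have [|/existsNP[p /not_implyP[Kp nP]]] := hr n.+1%:R^-1; last by exists p.
  by rewrite invr_gt0.
have [u hu] := choice h.
have [|x [f [Kx nf /metricType_numDomainType.cvgrPdist_lt fx]]] := @compact_subseq K u cK.
  by move=> n; case: (hu n).
have [r r0 rP] := Ploc x.
near \oo => n; case: (hu (f n)) => _; apply.
apply: (Pdec _ r); last by apply: rP; near: n; exact: fx.
apply: (@le_trans _ _ n.+1%:R^-1).
  by rewrite lef_pV2 ?posrE// ler_nat ltnS.
by apply: ltW; near: n; exact: near_infty_natSinv_lt (PosNum r0).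
Unshelve. all: by end_near. Qed.

Lemma compact_closed_seq K u l : compact K -> (forall n, K (u n)) ->
  u @ \oo --> l -> K l.
Proof.
move=> cK Ku ul; have cl := compact_closed (@metric_hausdorff _ T) cK.
by apply: (closed_cvg K) ul => //; exact: nearW.
Qed.

Lemma mdist_cvg u v l m : u @ \oo --> l -> v @ \oo --> m ->
  (fun n => mdist (u n) (v n)) @ \oo --> mdist l m.
Proof.
move=> /metricType_numDomainType.cvgrPdist_lt hu.
move=> /metricType_numDomainType.cvgrPdist_lt hv; apply/cvgrPdist_lt => e e0 /=.
have e2 : 0 < e / 2 by rewrite divr_gt0.
near=> n.
have hun : mdist l (u n) < e / 2 by near: n; exact: hu.
have hvn : mdist m (v n) < e / 2 by near: n; exact: hv.
have := metric_triangle l (u n) m; have := metric_triangle (u n) (v n) m.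
have := metric_triangle (u n) l (v n); have := metric_triangle l m (v n).
rewrite (metric_sym (u n) l) (metric_sym (v n) m) => h1 h2 h3 h4.
by rewrite ltr_norml; apply/andP; split; lra.
Unshelve. all: by end_near. Qed.

End MetricSequences.

(** * Lengths of causal curves *)

Section CausalOrder.
Context {R : realType} {X : lorentzianPreLengthSpace R}.
Implicit Types (o : time_orientation) (x y z : X).

Lemma causal_dirxx o x : causal_dir o x x.
Proof. by case: o; exact: (causal_refl (lpls_axioms X)). Qed.

Lemma causal_dir_trans o y x z :
  causal_dir o x y -> causal_dir o y z -> causal_dir o x z.
Proof.
case: o => /= xy yz; first exact: (causal_trans (lpls_axioms X)) xy yz.
exact: (causal_trans (lpls_axioms X)) yz xy.
Qed.

Lemma timelike_dir_trans o y x z :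
  timelike_dir o x y -> timelike_dir o y z -> timelike_dir o x z.
Proof.
case: o => /= xy yz; first exact: (timelike_trans (lpls_axioms X)) xy yz.
exact: (timelike_trans (lpls_axioms X)) yz xy.
Qed.

Lemma timelike_dir_causal o x y : timelike_dir o x y -> causal_dir o x y.
Proof. by case: o; exact: (timelike_causal (lpls_axioms X)). Qed.

Lemma tau_dir_ge0 o x y : (0 <= tau_dir o x y)%E.
Proof. by case: o; exact: (tau_ge0 (lpls_axioms X)). Qed.

Lemma tau_dir_gt0 o x y : (0 < tau_dir o x y)%E <-> timelike_dir o x y.
Proof. by case: o; exact: (tau_gt0 (lpls_axioms X)). Qed.

Lemma tau_dir_triangle o y x z : causal_dir o x y -> causal_dir o y z ->
  (tau_dir o x y + tau_dir o y z <= tau_dir o x z)%E.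
Proof.
case: o => /= xy yz; first exact: (tau_reverse_triangle (lpls_axioms X)).
by rewrite addeC; exact: (tau_reverse_triangle (lpls_axioms X)).
Qed.

(** Push-up: the reverse triangle inequality gives [tau x z >= tau x y > 0]. *)
Lemma timelike_causal_trans y x z :
  timelike x y -> causal y z -> timelike x z.
Proof.
move=> xy yz; apply/(tau_dir_gt0 Future)/(lt_le_trans _ (tau_dir_triangle
  (timelike_dir_causal (o := Future) xy) yz)).
by apply: lt_le_trans (leeDl _ (tau_dir_ge0 _ _ _)); apply/tau_dir_gt0.
Qed.

Lemma causal_timelike_trans y x z :
  causal x y -> timelike y z -> timelike x z.
Proof.
move=> xy yz; apply/(tau_dir_gt0 Future)/(lt_le_trans _ (tau_dir_triangle
  (o := Future) xy (timelike_dir_causal (o := Future) yz))).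
by apply: lt_le_trans (leeDr _ (tau_dir_ge0 _ _ _)); apply/tau_dir_gt0.
Qed.

End CausalOrder.

Section Length.
Context {R : realType} {X : lorentzianPreLengthSpace R}.
Variable o : time_orientation.
Implicit Types (gamma sigma : R -> X) (a b c d t : R) (s : seq R).

Lemma itvccP a b t : `[a, b]%classic t <-> a <= t <= b.
Proof. by rewrite /= in_itv. Qed.

Fixpoint partition_sum gamma a s : \bar R := if s is t :: s' then
  (tau_dir o (gamma a) (gamma t) + partition_sum gamma t s')%E else 0%E.

Lemma partition_sumE gamma b a s :
  (\sum_(0 <= i < size s)
    tau_dir o (gamma (nth b (a :: s) i)) (gamma (nth b (a :: s) i.+1)))%E =
  partition_sum gamma a s.
Proof.
elim: s a => [|t s IH] a; first by rewrite big_nil.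
by rewrite /= big_nat_recl//= -IH.
Qed.

Lemma partition_sum_ge0 gamma a s : (0 <= partition_sum gamma a s)%E.
Proof. by elim: s a => //= t s IH a; rewrite adde_ge0// tau_dir_ge0. Qed.

Lemma partition_sum_cat gamma a s1 s2 :
  partition_sum gamma a (s1 ++ s2) =
  (partition_sum gamma a s1 + partition_sum gamma (last a s1) s2)%E.
Proof. by elim: s1 a => [|t s IH] a /=; rewrite ?add0e// IH addeA. Qed.

Lemma length_le_partition gamma a b s : itv_partition a b s ->
  (length o gamma a b <= partition_sum gamma a s)%E.
Proof.
by move=> ps; apply: ereal_inf_lbound; exists s; rewrite ?partition_sumE.
Qed.

Lemma le_length gamma a b (e : \bar R) :
  (forall s, itv_partition a b s -> e <= partition_sum gamma a s)%E ->
  (e <= length o gamma a b)%E.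
Proof.
move=> h; apply: le_ereal_inf_tmp => _ [s ps <-].
by rewrite partition_sumE; exact: h.
Qed.

Lemma length_ge0 gamma a b : (0 <= length o gamma a b)%E.
Proof. by apply: le_length => s _; exact: partition_sum_ge0. Qed.

Lemma lengthxx gamma a : length o gamma a a = 0%E.
Proof.
apply/eqP; rewrite eq_le length_ge0 andbT.
by apply: (@length_le_partition _ _ _ [::]); split=> /=.
Qed.

Lemma length_le_tau gamma a b : a <= b ->
  (length o gamma a b <= tau_dir o (gamma a) (gamma b))%E.
Proof.
rewrite le_eqVlt => /predU1P[->|ab]; first by rewrite lengthxx tau_dir_ge0.
apply: le_trans (length_le_partition _ (itv_partition1 ab)) _.
by rewrite /= adde0.
Qed.

(** Moving [e] to the other side requires it to be finite; for infinite [e] the right-hand side is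
    infinite, lengths being nonnegative. *)
Lemma le_length_add gamma a b (l e : \bar R) : (0 <= e)%E ->
  (forall s, itv_partition a b s -> l <= partition_sum gamma a s + e)%E ->
  (l <= length o gamma a b + e)%E.
Proof.
case: e => [r||] // r0 h; last first.
  by rewrite addey ?leey// -ltNye; exact: lt_le_trans (length_ge0 _ _ _).
by rewrite -leeBlDr//; apply: le_length => s /h; rewrite leeBlDr.
Qed.

Lemma length_subadd gamma a b c : (length o gamma a c <=
  length o gamma a b + length o gamma b c)%E.
Proof.
apply: le_length_add (length_ge0 _ _ _) _ => s ps; rewrite addeC.
apply: le_length_add (partition_sum_ge0 _ _ _) _ => s' ps'.
have [_ /eqP sb] := ps; rewrite addeC -sb -partition_sum_cat.
by apply: length_le_partition; exact: itv_partition_cat ps ps'.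
Qed.

Definition causal_monotone gamma a b := forall r u, a <= r -> r < u -> u <= b ->
  causal_dir o (gamma r) (gamma u).

Lemma causal_monotone_sub gamma a b c d : a <= c -> d <= b ->
  causal_monotone gamma a b -> causal_monotone gamma c d.
Proof.
move=> ac db h r s cr rs sd; apply: h rs _; last exact: le_trans db.
exact: le_trans cr.
Qed.

Lemma causal_monotone_le gamma a b r u : causal_monotone gamma a b ->
  a <= r -> r <= u -> u <= b -> causal_dir o (gamma r) (gamma u).
Proof.
move=> h ar; rewrite le_eqVlt => /predU1P[-> _|ru ub]; first exact: causal_dirxx.
exact: h ru ub.
Qed.

(** By the reverse triangle inequality, inserting the node [b] can only decrease the sum. *)
Lemma partition_refine gamma a b c s : a <= b -> b <= c ->
  causal_monotone gamma a c -> itv_partition a c s ->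
  exists s1 s2, [/\ itv_partition a b s1, itv_partition b c s2 &
    (partition_sum gamma a s1 + partition_sum gamma b s2 <=
      partition_sum gamma a s)%E].
Proof.
elim: s a => [|t s IH] a ab bc mono ps.
  have ac := itv_partition_nil ps.
  have eab : a = b by apply/le_anti; rewrite ab ac.
  by exists [::], [::]; rewrite -eab; split=> //=; rewrite adde0.
have [/= /andP[at_ pt] lt] := ps; have ps' := itv_partition_cons ps.
have tc := itv_partition_le ps'.
have [tb|bt] := leP t b.
  have [|s1 [s2 [p1 p2 h]]] := IH t tb bc _ ps'.
    by apply: causal_monotone_sub mono => //; exact: ltW.
  exists (t :: s1), s2; split=> //=.
    by have [q1 q2] := p1; split=> //=; rewrite at_.
  by rewrite -addeA leeD2l.
move: ab; rewrite le_eqVlt => /predU1P[ab|ab].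
  exists [::], (t :: s); split=> //=; first by rewrite ab; split=> /=.
    by split=> //=; rewrite -ab at_.
  by rewrite add0e ab.
exists [:: b], (t :: s); split=> //=; first exact: itv_partition1.
  by split=> //=; rewrite bt.
rewrite adde0 addeA leeD2r// tau_dir_triangle//.
  by apply: mono ab _ => //.
by apply: mono bt _ => //; exact: ltW.
Qed.

Lemma length_add gamma a b c : a <= b -> b <= c -> causal_monotone gamma a c ->
  length o gamma a c = (length o gamma a b + length o gamma b c)%E.
Proof.
move=> ab bc mono; apply/eqP; rewrite eq_le length_subadd/=.
apply: le_length => s ps.
have [s1 [s2 [p1 p2 h]]] := partition_refine ab bc mono ps.
by apply: le_trans h; apply: leeD; exact: length_le_partition.
Qed.

Lemma partition_sum_eq gamma sigma a b s : itv_partition a b s ->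
  (forall t, a <= t <= b -> gamma t = sigma t) ->
  partition_sum gamma a s = partition_sum sigma a s.
Proof.
elim: s a => //= t s IH a ps h.
have [/= /andP[at_ pt] lt] := ps; have ps' := itv_partition_cons ps.
have tb := itv_partition_le ps'.
have ab : a <= b by rewrite (le_trans (ltW at_)).
rewrite (h a) ?lexx ?ab// (h t) ?tb ?(ltW at_)//.
by congr (_ + _)%E; apply: IH => // u /andP[tu ub]; rewrite h// ub (le_trans _ tu) ?ltW.
Qed.

Lemma eq_length gamma sigma a b :
  (forall t, a <= t <= b -> gamma t = sigma t) ->
  length o gamma a b = length o sigma a b.
Proof.
move=> h; apply/eqP; rewrite eq_le; apply/andP; split;
  apply: le_length => s ps; apply: le_trans (length_le_partition _ ps) _.
  by rewrite (partition_sum_eq ps h).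
by rewrite (partition_sum_eq ps h).
Qed.

(** Surjectivity takes the place of continuity: it passes to subintervals and is what lifts the
    nodes of a partition through [phi]. *)
Definition monotone_onto (phi : R -> R) a b c d :=
  [/\ forall r u, a <= r -> r <= u -> u <= b -> phi r <= phi u,
      phi a = c, phi b = d &
      forall u, c <= u <= d -> exists2 t, a <= t <= b & phi t = u].

Lemma monotone_onto_subr phi a b c d t : monotone_onto phi a b c d ->
  a <= t <= b -> monotone_onto phi a t c (phi t).
Proof.
move=> [mono <- <- onto] /andP[at_ tb]; split=> //.
  by move=> r s ar rs st; apply: mono => //; exact: le_trans tb.
move=> u /andP[cu ut]; have [|r /andP[ar rb] pru] := onto u; last subst u.
  by rewrite cu (le_trans ut)// mono.
have [rt|tr] := leP r t; first by exists r; rewrite ?ar.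
exists t; first by rewrite at_ lexx.
by apply/le_anti; rewrite ut mono// ltW.
Qed.

Lemma monotone_onto_subl phi a b c d t : monotone_onto phi a b c d ->
  a <= t <= b -> monotone_onto phi t b (phi t) d.
Proof.
move=> [mono <- <- onto] /andP[at_ tb]; split=> //.
  by move=> r s tr rs st; apply: mono => //; exact: le_trans tr.
move=> u /andP[tu ud]; have [|r /andP[ar rb] pru] := onto u; last subst u.
  by rewrite ud andbT (le_trans _ tu)// mono.
have [tr|rt] := leP t r; first by exists r; rewrite ?tr.
exists t; first by rewrite tb lexx.
by apply/le_anti; rewrite tu mono// ltW.
Qed.

Context (chronological : forall x : X, tau x x = 0%E).

(** Nodes of [[c, d]] are lifted through [phi], nodes of [[a, b]] are pushed forward. Plateaus of
    [phi] contribute [tau x x], which is 0 by [chronological]. *)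
Lemma length_monotone_onto gamma sigma phi a b c d : a <= b ->
  monotone_onto phi a b c d -> causal_monotone sigma c d ->
  (forall t, a <= t <= b -> gamma t = sigma (phi t)) ->
  length o gamma a b = length o sigma c d.
Proof.
move=> ab mo mono gs; apply/eqP; rewrite eq_le; apply/andP; split.
  apply: le_length => s; elim: s c phi a ab mo mono gs
      => [|u s IH] c phi a ab mo mono gs ps /=.
    have cd := itv_partition_nil ps; have [phim pa pb _] := mo.
    apply: le_trans (length_le_tau _ ab) _.
    rewrite !gs ?lexx ?ab// pa pb cd.
    by case: (o) => /=; rewrite chronological.
  have [/= /andP[cu pu] lu] := ps; have ps' := itv_partition_cons ps.
  have ud := itv_partition_le ps'.
  have [phim pa pb onto] := mo.
  have [|t /andP[at_ tb] ptu] := onto u; first by rewrite ltW.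
  apply: le_trans (length_subadd _ _ t _) _; apply: leeD.
    apply: le_trans (length_le_tau _ at_) _.
    by rewrite !gs ?lexx ?ab ?at_// pa ptu.
  apply: (IH _ phi) => //.
  - by rewrite -ptu; apply: (monotone_onto_subl mo); rewrite at_.
  - by apply: causal_monotone_sub mono => //; exact: ltW.
  - by move=> r /andP[tr rb]; apply: gs; rewrite rb (le_trans at_).
apply: le_length => s; elim: s c a ab mo mono gs
    => [|t s IH] c a ab mo mono gs ps /=.
  have eab := itv_partition_nil ps; have [_ <- <- _] := mo.
  by rewrite eab lengthxx.
have [/= /andP[at_ pt] lt] := ps; have ps' := itv_partition_cons ps.
have tb := itv_partition_le ps'.
have [phim pa pb onto] := mo.
have ct : c <= phi t by rewrite -pa phim// ltW.
have td : phi t <= d by rewrite -pb phim// ltW.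
apply: le_trans (length_subadd _ _ (phi t) _) _; apply: leeD.
  apply: le_trans (length_le_tau _ ct) _.
  by rewrite !gs ?lexx ?ab ?(ltW at_)// pa.
apply: IH => //.
- by apply: (monotone_onto_subl mo); rewrite ltW.
- by apply: causal_monotone_sub mono.
- by move=> r /andP[tr rb]; apply: gs; rewrite rb (le_trans (ltW at_)).
Qed.

End Length.

(** * Pasting and rescaling of curves *)

Section Curves.
Context {R : realType} {X : lorentzianPreLengthSpace R}.
Implicit Types (gamma sigma : R -> X) (a b c d t : R) (I : set R).

Lemma locally_lipschitz_near I gamma t : locally_lipschitz I gamma -> I t ->
  exists2 k : R, 0 <= k & exists2 e : R, 0 < e & forall r u, I r -> I u ->
    `|t - r| < e -> `|t - u| < e -> mdist (gamma r) (gamma u) <= k * `|r - u|.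
Proof.
move=> lip /lip [k [V /nbhs_ballP[e /= e0 eV] h]].
exists (Num.max k 0); first by rewrite le_max lexx orbT.
exists e => // r u Ir Iu tr tu.
apply: le_trans (h r u _ _) _; [by split=> //; exact: eV..|].
by rewrite ler_wpM2r// le_max lexx.
Qed.

Lemma near_locally_lipschitz I gamma : (forall t, I t -> exists2 k : R, 0 <= k &
  exists2 e : R, 0 < e & forall r u, I r -> I u ->
    `|t - r| < e -> `|t - u| < e -> mdist (gamma r) (gamma u) <= k * `|r - u|) ->
  locally_lipschitz I gamma.
Proof.
move=> h t /h [k k0 [e e0 he]]; exists k, (ball t e); first exact: nbhsx_ballx.
by move=> r u [Ir tr] [Iu tu]; exact: he.
Qed.

Lemma locally_lipschitz_continuous I gamma :
  locally_lipschitz I gamma -> {within I, continuous gamma}.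
Proof.
move=> lip; apply/subspace_continuousP => t It.
apply/metricType_numDomainType.cvgrPdist_lt => e e0.
have [k k0 [d d0 h]] := locally_lipschitz_near lip It.
have k1 : 0 < k + 1 by rewrite ltr_wpDl.
have m0 : 0 < Num.min d (e / (k + 1)) by rewrite lt_min d0 divr_gt0.
rewrite /= near_withinE; near=> u => Iu.
have : `|t - u| < Num.min d (e / (k + 1)).
  by near: u; exact: (nbhsx_ballx _ _ m0).
rewrite lt_min ltr_pdivlMr// => /andP[tud tue].
apply: le_lt_trans (h _ _ It Iu _ tud) _; first by rewrite subrr normr0.
apply: le_lt_trans tue; rewrite mulrC.
by rewrite ler_wpM2l// lerDl ler01.
Unshelve. all: by end_near. Qed.

Definition paste b sigma1 sigma2 t : X :=
  if t <= b then sigma1 t else sigma2 t.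

Lemma pasteL b sigma1 sigma2 t : t <= b -> paste b sigma1 sigma2 t = sigma1 t.
Proof. by rewrite /paste => ->. Qed.

Lemma pasteR b sigma1 sigma2 t : sigma1 b = sigma2 b -> b <= t ->
  paste b sigma1 sigma2 t = sigma2 t.
Proof.
by rewrite /paste le_eqVlt leNgt => e; case: eqP => [<-|_ /= ->//]; rewrite ltxx.
Qed.

Lemma paste_lipschitz a b c sigma1 sigma2 : sigma1 b = sigma2 b ->
  locally_lipschitz `[a, b] sigma1 -> locally_lipschitz `[b, c] sigma2 ->
  locally_lipschitz `[a, c] (paste b sigma1 sigma2).
Proof.
move=> e12 lip1 lip2; apply: near_locally_lipschitz => t /itvccP/andP[at_ tc].
case: (ltgtP t b) => [tb|bt|tb].
- have [|k k0 [e e0 h]] := locally_lipschitz_near (t := t) lip1.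
    by apply/itvccP; rewrite at_ ltW.
  exists k => //; exists (Num.min e (b - t)); first by rewrite lt_min e0 subr_gt0.
  move=> r u /itvccP/andP[ar rc] /itvccP/andP[au uc].
  rewrite !lt_min => /andP[tr1 tr2] /andP[tu1 tu2].
  have rb : r <= b by move: tr2; rewrite ltr_norml => /andP[]; lra.
  have ub : u <= b by move: tu2; rewrite ltr_norml => /andP[]; lra.
  by rewrite !pasteL//; apply: h => //; apply/itvccP; apply/andP.
- have [|k k0 [e e0 h]] := locally_lipschitz_near (t := t) lip2.
    by apply/itvccP; rewrite tc andbT ltW.
  exists k => //; exists (Num.min e (t - b)); first by rewrite lt_min e0 subr_gt0.
  move=> r u /itvccP/andP[ar rc] /itvccP/andP[au uc].
  rewrite !lt_min => /andP[tr1 tr2] /andP[tu1 tu2].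
  have rb : b <= r by move: tr2; rewrite ltr_norml => /andP[]; lra.
  have ub : b <= u by move: tu2; rewrite ltr_norml => /andP[]; lra.
  by rewrite !pasteR//; apply: h => //; apply/itvccP; apply/andP.
subst t.
have [|k1 k10 [e1 e10 h1]] := locally_lipschitz_near (t := b) lip1.
  by apply/itvccP; rewrite at_ lexx.
have [|k2 k20 [e2 e20 h2]] := locally_lipschitz_near (t := b) lip2.
  by apply/itvccP; rewrite tc lexx.
exists (k1 + k2); first by rewrite addr_ge0.
exists (Num.min e1 e2); first by rewrite lt_min e10 e20.
(* Across the seam, the distance is estimated through the common point [sigma1 b = sigma2 b]. *)
have mixed r u : a <= r -> r <= b -> b <= u -> u <= c ->
    `|b - r| < e1 -> `|b - u| < e2 ->
    mdist (sigma1 r) (sigma2 u) <= (k1 + k2) * `|r - u|.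
  move=> ar rb bu uc r1 u2.
  apply: le_trans (metric_triangle _ (sigma1 b) _) _.
  have H1 : mdist (sigma1 r) (sigma1 b) <= k1 * `|r - b|.
    by apply: h1; rewrite ?subrr ?normr0//; apply/itvccP; rewrite ?ar ?rb ?at_ ?lexx.
  have H2 : mdist (sigma1 b) (sigma2 u) <= k2 * `|b - u|.
    by rewrite e12; apply: h2; rewrite ?subrr ?normr0//; apply/itvccP; rewrite ?tc ?lexx ?bu.
  apply: le_trans (lerD H1 H2) _.
  rewrite !ler0_norm ?subr_le0 ?(le_trans rb)// !opprB.
  have := mulr_ge0 k10 (_ : 0 <= u - b); have := mulr_ge0 k20 (_ : 0 <= b - r).
  rewrite !subr_ge0 => /(_ rb) P1 /(_ bu) P2; nra.
move=> r u /itvccP/andP[ar rc] /itvccP/andP[au uc].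
rewrite !lt_min => /andP[r1 r2] /andP[u1 u2].
have [rb|/ltW rb] := leP r b; have [ub|/ltW ub] := leP u b.
- rewrite !pasteL//; apply: le_trans (h1 _ _ _ _ _ _) _ => //;
    try by apply/itvccP; rewrite ?ar ?au.
  by rewrite ler_wpM2r// lerDl.
- by rewrite pasteL// pasteR//; exact: mixed.
- rewrite pasteR// (pasteL _ _ ub) metric_sym distrC; exact: mixed.
- rewrite !pasteR//; apply: le_trans (h2 _ _ _ _ _ _) _ => //;
    try by apply/itvccP; rewrite ?rb ?ub.
  by rewrite ler_wpM2r// lerDr.
Qed.

(** Convertible to [causal_curve o] and to [timelike_curve o] for the corresponding [rel], so that
    pasting and rescaling are proved once for both. *)
Definition directed_curve (rel : X -> X -> Prop) I gamma := curve I gamma /\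
  forall r u, I r -> I u -> r < u -> rel (gamma r) (gamma u).

Lemma paste_directed (rel : X -> X -> Prop) a b c sigma1 sigma2 :
  (forall x y z, rel x y -> rel y z -> rel x z) -> a <= b -> b <= c ->
  sigma1 b = sigma2 b ->
  directed_curve rel `[a, b] sigma1 -> directed_curve rel `[b, c] sigma2 ->
  directed_curve rel `[a, c] (paste b sigma1 sigma2).
Proof.
move=> rel_trans ab bc e12 [[_ lip1 [p [q [Ip Iq pq]]]] mono1] [[_ lip2 _] mono2].
split.
  split; [exact: interval_is_interval|exact: paste_lipschitz|].
  have sub t : `[a, b]%classic t -> `[a, c]%classic t.
    by move=> /itvccP/andP[at_ tb]; apply/itvccP; rewrite at_ (le_trans tb).
  exists p, q; split; [exact: sub|exact: sub|].
  move/itvccP/andP: Ip => [_ pb]; move/itvccP/andP: Iq => [_ qb].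
  by rewrite !pasteL.
move=> r u /itvccP/andP[ar rc] /itvccP/andP[au uc] ru.
have [rb|/ltW rb] := leP r b; have [ub|ub] := leP u b.
- by rewrite !pasteL//; apply: mono1 => //; apply/itvccP; rewrite ?ar ?au.
- rewrite pasteL// pasteR//; last exact: ltW.
  have H2 : rel (sigma2 b) (sigma2 u).
    by apply: mono2 => //; apply/itvccP; rewrite ?lexx ?bc ?uc ?(ltW ub).
  move: rb; rewrite le_eqVlt => /predU1P[->|rb]; first by rewrite e12.
  apply: rel_trans H2; rewrite -e12.
  by apply: mono1 => //; apply/itvccP; rewrite ?ar ?ab ?lexx ?(ltW rb).
- by have := lt_le_trans ru (le_trans ub rb); rewrite ltxx.
- by rewrite !pasteR ?(ltW ub)//; apply: mono2 => //; apply/itvccP;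
    rewrite ?rb ?uc ?(ltW ub).
Qed.

Definition affine_param a b c d t := c + (t - a) * ((d - c) / (b - a)).

Lemma affine_paramK a b c d t : a < b -> c < d ->
  affine_param a b c d (affine_param c d a b t) = t.
Proof.
rewrite /affine_param => ab cd.
by field; rewrite !subr_eq0 (gt_eqF ab) (gt_eqF cd).
Qed.

Lemma affine_param_le a b c d t u : a < b -> c < d ->
  (affine_param a b c d t <= affine_param a b c d u) = (t <= u).
Proof.
move=> ab cd; rewrite /affine_param lerD2l ler_pM2r ?lerD2r//.
by rewrite divr_gt0// subr_gt0.
Qed.

Lemma affine_param_l a b c d : affine_param a b c d a = c.
Proof. by rewrite /affine_param subrr mul0r addr0. Qed.

Lemma affine_param_r a b c d : a < b -> affine_param a b c d b = d.
Proof.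
by rewrite /affine_param => ab; field; rewrite subr_eq0 gt_eqF.
Qed.

Lemma affine_param_itv a b c d t : a < b -> c < d ->
  (c <= affine_param a b c d t <= d) = (a <= t <= b).
Proof.
move=> ab cd; rewrite -{1}(affine_param_l a b c d) -{4}(@affine_param_r a b c d)//.
by rewrite !affine_param_le.
Qed.

Lemma affine_param_onto a b c d : a < b -> c < d ->
  monotone_onto (affine_param a b c d) a b c d.
Proof.
move=> ab cd; split.
- by move=> r u _ ru _; rewrite affine_param_le.
- exact: affine_param_l.
- exact: affine_param_r.
move=> u ucd; exists (affine_param c d a b u); last exact: affine_paramK.
by rewrite affine_param_itv.
Qed.

Lemma affine_directed (rel : X -> X -> Prop) a b c d sigma : a < b -> c < d ->
  directed_curve rel `[c, d] sigma ->
  directed_curve rel `[a, b] (sigma \o affine_param a b c d).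
Proof.
move=> ab cd [[_ lip [p [q [Ip Iq pq]]]] mono].
have itvE t : `[a, b]%classic t <-> `[c, d]%classic (affine_param a b c d t).
  by split=> /itvccP h; apply/itvccP; rewrite affine_param_itv// in h *.
have m0 : 0 < (d - c) / (b - a) by rewrite divr_gt0// subr_gt0.
have distE r u : `|affine_param a b c d r - affine_param a b c d u| =
    `|r - u| * ((d - c) / (b - a)).
  by rewrite /affine_param opprD addrACA subrr add0r -mulrBl opprB addrA subrK
    normrM (gtr0_norm m0).
split.
  split; first exact: interval_is_interval.
    apply: near_locally_lipschitz => t /itvE It.
    have [k k0 [e e0 h]] := locally_lipschitz_near lip It.
    exists (k * ((d - c) / (b - a))); first by rewrite mulr_ge0// ltW.
    exists (e / ((d - c) / (b - a))); first by rewrite divr_gt0.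
    move=> r u /itvE Ir /itvE Iu; rewrite !(ltr_pdivlMr _ _ m0) -!distE => tr tu.
    by apply: le_trans (h _ _ Ir Iu tr tu) _; rewrite distE mulrCA mulrC mulrA.
  exists (affine_param c d a b p), (affine_param c d a b q).
  by split; [apply/itvE|apply/itvE|]; rewrite /= ?affine_paramK.
move=> r u /itvE Ir /itvE Iu ru; apply: mono => //.
by rewrite ltNge affine_param_le// -ltNge.
Qed.

Lemma directed_curve_lt (rel : X -> X -> Prop) a b gamma :
  directed_curve rel `[a, b] gamma -> a < b.
Proof.
move=> [[_ _ [p [q [/itvccP/andP[ap pb] /itvccP/andP[aq qb] pq]]]] _].
rewrite ltNge; apply/negP => ba; apply: pq; congr gamma.
by apply/le_anti/andP; split; lra.
Qed.

Lemma causal_curve_monotone o a b gamma :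
  causal_curve o `[a, b] gamma -> causal_monotone o gamma a b.
Proof.
move=> [_ mono] r u ar ru ub; apply: mono => //; apply/itvccP.
  by rewrite ar (le_trans (ltW ru)).
by rewrite ub andbT (le_trans ar)// ltW.
Qed.

Lemma timelike_curve_causal o I gamma :
  timelike_curve o I gamma -> causal_curve o I gamma.
Proof.
by move=> [cI mono]; split=> // r u Ir Iu ru; apply/timelike_dir_causal/mono.
Qed.

Lemma eq_directed_curve (rel : X -> X -> Prop) a b gamma sigma :
  (forall t, a <= t <= b -> gamma t = sigma t) ->
  directed_curve rel `[a, b] gamma -> directed_curve rel `[a, b] sigma.
Proof.
move=> e [[_ lip [p [q [Ip Iq pq]]]] mono]; split; last first.
  by move=> r u Ir Iu ru; rewrite -!e; [exact: mono|exact/itvccP..].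
split; first exact: interval_is_interval.
  apply: near_locally_lipschitz => t It.
  have [k k0 [d d0 h]] := locally_lipschitz_near lip It.
  exists k => //; exists d => // r u Ir Iu; rewrite -!e; [exact: h|exact/itvccP..].
by exists p, q; split=> //; rewrite -!e//; exact/itvccP.
Qed.

End Curves.

Lemma cvg_sum_ord (R : realType) (N : nat) (F : nat -> nat -> R) (l : nat -> R) :
  (forall i, (i < N)%N -> F i @ \oo --> l i) ->
  (fun n => \sum_(i < N) F i n) @ \oo --> \sum_(i < N) l i.
Proof.
elim: N => [|N IH] h.
  by under eq_cvg do rewrite big_ord0; rewrite big_ord0; exact: cvg_cst.
under eq_cvg do rewrite big_ord_recr; rewrite big_ord_recr.
by apply: cvgD; [apply: IH => i iN; apply: h; exact: ltnW|exact: h].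
Qed.

(** * Chains of short causal steps and their limits *)

Section Chains.
Context {R : realType} {X : lorentzianPreLengthSpace R}.
Implicit Types (x y z p q : X) (K U : set X) (r e : R) (N : nat).

(** The value is 0 where [tau] is infinite, until [tau_fin] excludes that case. *)
Definition rtau x y : R := fine (tau x y).

Lemma rtau_ge0 x y : 0 <= rtau x y.
Proof. by rewrite fine_ge0//; exact: (tau_dir_ge0 Future). Qed.

Lemma tau_lsc_near x y (v : R) : (v%:E < tau x y)%E ->
  exists2 r, 0 < r & forall x' y', mdist x x' < r -> mdist y y' < r ->
    (v%:E < tau x' y')%E.
Proof.
move=> vxy; have [V nV hV] := @tau_lsc R X (x, y) v vxy.
have [[V1 V2] /= [/nbhs_ballP[r1 /= r10 h1] /nbhs_ballP[r2 /= r20 h2]] h] := nV.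
exists (Num.min r1 r2); first by rewrite lt_min r10 r20.
move=> x' y'; rewrite !lt_min => /andP[xx' _] /andP[_ yy'].
by apply: (hV (x', y')); apply: h; split;
  [apply: h1|apply: h2]; rewrite ballEmdist.
Qed.

Lemma timelike_near x y : timelike x y ->
  exists2 r, 0 < r & forall x' y', mdist x x' < r -> mdist y y' < r ->
    timelike x' y'.
Proof.
move=> /(tau_dir_gt0 Future)/tau_lsc_near[r r0 h]; exists r => // x' y' xx' yy'.
by apply/(tau_dir_gt0 Future); exact: h.
Qed.

Lemma tau_not_timelike x y : ~ timelike x y -> tau x y = 0%E.
Proof.
move=> nxy; apply/eqP; rewrite eq_le (tau_dir_ge0 Future x y) andbT leNgt.
by apply/negP => /(tau_dir_gt0 Future).
Qed.

Definition causally_closed_set U := forall (p q : nat -> X) (p0 q0 : X),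
  (forall n, [/\ U (p n), U (q n) & causal (p n) (q n)]) ->
  closure U p0 -> closure U q0 ->
  p @ \oo --> p0 -> q @ \oo --> q0 -> causal p0 q0.

(** All local hypotheses are available on the ball of radius [r] around [p]. The bound by 1 keeps
    the steps of a chain finite, so that a chain of [N] steps has sum at most [N]. *)
Definition good_scale p r := [/\
  exists2 U, comparison_set U & forall q, mdist p q < r -> U q,
  exists2 U, causally_closed_set U & forall q, mdist p q < r -> U q &
  forall q q', mdist p q < r -> mdist p q' < r -> (tau q q' < 1)%E].

Lemma good_scale_le p r e : e <= r -> good_scale p r -> good_scale p e.
Proof.
move=> er [[U cU hU] [V cV hV] h]; split.
- by exists U => // q pq; apply: hU; exact: lt_le_trans er.
- by exists V => // q pq; apply: hV; exact: lt_le_trans er.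
- by move=> q q' pq pq'; apply: h; exact: lt_le_trans er.
Qed.

Definition step e p q := causal p q /\ mdist p q <= e.

Definition chain K e N x y (p : nat -> X) := [/\ p 0%N = x, p N = y,
  forall i, (i < N.+1)%N -> K (p i) &
  forall i, (i < N)%N -> step e (p i) (p i.+1)].

(** The limit [q0] can be at distance [e] from [p0], and [q n] approaches it from any side; the
    scale [e *+ 2] at [p0] contains the tails of both sequences. On that ball [tau] is continuous
    and the causal relation is closed. *)
Lemma step_limit K e (p q : nat -> X) p0 q0 : compact K -> 0 < e ->
  (forall p, K p -> good_scale p (e *+ 2)) ->
  (forall n, K (p n)) -> (forall n, step e (p n) (q n)) ->
  p @ \oo --> p0 -> q @ \oo --> q0 ->
  step e p0 q0 /\ (fun n => rtau (p n) (q n)) @ \oo --> rtau p0 q0.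
Proof.
move=> cK e0 gK Kp st pp0 qq0.
have Kp0 : K p0 by exact: compact_closed_seq pp0.
have [[U cU hU] [V cV hV] ht] := gK _ Kp0.
have pq0 : mdist p0 q0 <= e.
  have h := mdist_cvg pp0 qq0; rewrite -(cvg_lim _ h)//.
  apply: limr_le; first by apply/cvg_ex; exists (mdist p0 q0).
  by apply: nearW => n; case: (st n).
have e2 : e < e *+ 2 by rewrite mulr2n ltrDl.
have e20 : 0 < e *+ 2 by exact: lt_trans e2.
have p00 : mdist p0 p0 < e *+ 2 by rewrite mdistxx.
have q00 : mdist p0 q0 < e *+ 2 by exact: le_lt_trans e2.
have [n1 hn1] := (cvg_mdistP _ _).1 pp0 _ e20.
have [n2 hn2] := (cvg_mdistP _ _).1 qq0 _ e0.
have near_p n : (maxn n1 n2 <= n)%N -> mdist p0 (p n) < e *+ 2.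
  by rewrite geq_max => /andP[/hn1].
have near_q n : (maxn n1 n2 <= n)%N -> mdist p0 (q n) < e *+ 2.
  rewrite geq_max => /andP[_ /hn2 h]; rewrite mulr2n.
  by apply: le_lt_trans (metric_triangle _ q0 _) _; rewrite ler_ltD.
split.
  split=> //; apply: (cV (fun n => p (n + maxn n1 n2)%N)
      (fun n => q (n + maxn n1 n2)%N)).
  - move=> n; have le := leq_addl n (maxn n1 n2).
    by split; [exact/hV/near_p|exact/hV/near_q|case: (st (n + maxn n1 n2)%N)].
  - by apply: subset_closure; exact: hV.
  - by apply: subset_closure; exact: hV.
  - by apply: (cvg_mdist_sub _ pp0) => n; exact: leq_addr.
  - by apply: (cvg_mdist_sub _ qq0) => n; exact: leq_addr.
have [cont _ _] := cU.
have fin0 : tau p0 q0 \is a fin_num.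
  by rewrite ge0_fin_numE ?(tau_dir_ge0 Future)//; exact: lt_trans (ht _ _ p00 q00) (ltry _).
have /subspace_continuousP/(_ (p0, q0)) h := cont.
have {}h := h (conj (hU _ p00) (hU _ q00)).
suff : (fun n => tau (p n) (q n)) @ \oo --> (rtau p0 q0)%:E by exact: fine_cvg.
rewrite /rtau fineK//.
apply: cvg_trans h => A /= nA.
have hpq : (fun n => (p n, q n)) @ \oo --> (p0, q0) by exact: cvg_pair.
have := hpq _ nA; rewrite /= => -[n0 _ hn0].
exists (maxn n0 (maxn n1 n2)) => // n /=; rewrite geq_max => /andP[/hn0 h1 h2].
by apply: h1; split; [exact/hU/near_p|exact/hU/near_q].
Qed.

Definition chain_sum N (p : nat -> X) : R := \sum_(i < N) rtau (p i) (p i.+1).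

(** Endpoints and lower bounds may both vary with [n]. The same limit then yields chains attaining
    [tau], closedness of the causal relation, and upper semicontinuity of [tau]. *)
Lemma chain_limit K e N (p : nat -> nat -> X) (x y : nat -> X) (v : nat -> R)
    x0 y0 (v0 : R) :
  compact K -> 0 < e -> (forall p, K p -> good_scale p (e *+ 2)) ->
  (forall n, chain K e N (x n) (y n) (p n)) ->
  (forall n, v n <= chain_sum N (p n)) ->
  x @ \oo --> x0 -> y @ \oo --> y0 -> v @ \oo --> v0 ->
  exists2 p0, chain K e N x0 y0 p0 & v0 <= chain_sum N p0.
Proof.
move=> cK e0 gK ch vle xx0 yy0 vv0.
have [|p0 [f [nf Kp0 fp0]]] := @compact_subseq_fin R X K N.+1 p cK.
  by move=> n i iN; have [_ _ h _] := ch n; exact: h.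
have steps i : (i < N)%N -> step e (p0 i) (p0 i.+1) /\
    (fun n => rtau (p (f n) i) (p (f n) i.+1)) @ \oo --> rtau (p0 i) (p0 i.+1).
  move=> iN; apply: (@step_limit K e (fun n => p (f n) i) (fun n => p (f n) i.+1)) => //.
  - by move=> n; have [_ _ h _] := ch (f n); apply: h; exact: ltnW.
  - by move=> n; have [_ _ _ h] := ch (f n); exact: h.
  - by apply: fp0; exact: ltnW.
  - exact: fp0.
exists p0.
  split=> //; last by move=> i /steps[].
    apply: (cvg_unique (@metric_hausdorff _ X) (fp0 0%N isT)).
    have := cvg_mdist_sub nf xx0; apply: cvg_trans.
    by apply: near_eq_cvg; apply: nearW => n /=; have [-> _ _ _] := ch (f n).
  apply: (cvg_unique (@metric_hausdorff _ X) (fp0 N (ltnSn N))).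
  have := cvg_mdist_sub nf yy0; apply: cvg_trans.
  by apply: near_eq_cvg; apply: nearW => n /=; have [_ -> _ _] := ch (f n).
have sumc : (fun n => chain_sum N (p (f n))) @ \oo --> chain_sum N p0.
  rewrite /chain_sum.
  by apply: (@cvg_sum_ord _ _ (fun i n => rtau (p (f n) i) (p (f n) i.+1))
    (fun i => rtau (p0 i) (p0 i.+1))) => i /steps[].
have vf : (v \o f) @ \oo --> v0.
  apply: cvg_comp vv0; move=> A [n0 _ hA]; exists n0 => // n /= n0n; apply: hA => /=.
  exact: leq_trans (nf n).
apply: (ler_cvg_to vf sumc); apply: nearW => n; exact: vle.
Qed.

End Chains.

(** * Replacing a causal curve by a chain *)

Section CurveToChain.
Context {R : realType} {X : lorentzianPreLengthSpace R}.
Implicit Types (x y z p q : X) (K U : set X) (r e : R) (N : nat).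

Lemma arclength_sum_le (gamma : R -> X) a b N (t : nat -> R) e (C : R) :
  a <= b -> t 0%N = a -> (forall i, (i < N)%N -> t i < t i.+1) -> t N <= b ->
  (forall i, (i < N)%N -> mdist (gamma (t i)) (gamma (t i.+1)) = e) ->
  (arclength `[a, b] gamma <= C%:E)%E -> e *+ N <= C.
Proof.
move=> ab t0 tlt tb dt; rewrite -lee_fin; apply: le_trans.
apply: ereal_sup_ubound.
have tle i : (i <= N)%N -> a <= t i.
  elim: i => [|i IH] iN; first by rewrite t0.
  by apply: le_trans (IH (ltnW iN)) _; rewrite ltW// tlt.
pose s := [seq t i.+1 | i <- iota 0 N].
have sizes : size s = N by rewrite size_map size_iota.
have nths i : (i <= N)%N -> nth (t N) (a :: s) i = t i.
  case: i => [|i] iN /=; first by rewrite t0.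
  by rewrite (nth_map 0%N) ?size_iota// nth_iota.
exists a, (t N), s; split.
- by apply/itvccP; rewrite lexx.
- by apply/itvccP; rewrite tle.
- split; last by rewrite (last_nth (t N)) sizes nths.
  apply/(pathP (t N)) => i; rewrite sizes => iN.
  by have := nths i.+1 iN => /= ->; rewrite nths ?tlt// ltnW.
congr EFin; rewrite sizes; apply/esym.
rewrite big_mkord (eq_bigr (fun=> e)); first by rewrite sumr_const card_ord.
by move=> i _; rewrite !nths ?dt// ltnW.
Qed.

(** Stops are chosen greedily: the next one is at distance exactly [e], or is the endpoint [b],
    which is then repeated to fill up the [N] steps. If [b] were not reached, [N] distances equal to
    [e] would push the arclength beyond [C]. *)
Lemma curve_to_chain K e C N x y gamma a b : 0 < e -> C < e *+ N ->
  bounds_arclength K C -> causal_curve_from_to K x y gamma a b ->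
  exists2 p, chain K e N x y p &
    (length Future gamma a b <= \sum_(i < N) tau (p i) (p i.+1))%E.
Proof.
move=> e0 CN bK [cc gK ga gb].
have ab := ltW (directed_curve_lt cc).
have mono := causal_curve_monotone cc.
have cont : {within `[a, b], continuous gamma}.
  by case: cc => [[_ lip _] _]; exact: locally_lipschitz_continuous.
have next u : exists v, a <= u <= b -> [/\ u <= v, v <= b,
    mdist (gamma u) (gamma v) <= e & v = b \/ mdist (gamma u) (gamma v) = e].
  have [uab|] := boolP (a <= u <= b); last by exists 0.
  have /andP[au ub] := uab.
  have [far|far] := leP (mdist (gamma u) (gamma b)) e.
    by exists b => _; split=> //; left.
  have contd : {within `[u, b], continuous (fun t => mdist (gamma u) (gamma t))}.
    apply/subspace_continuousP => t /itvccP/andP[ut tb].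
    have /subspace_continuousP/(_ t) := cont.
    move=> /(_ ((itvccP _ _ _).2 _)); rewrite (le_trans au ut) tb => /(_ isT) ht.
    apply/cvgrPdist_lt => d d0.
    have /metricType_numDomainType.cvgrPdist_lt/(_ _ d0) := ht.
    rewrite !near_withinE; apply: filterS => s h /itvccP/andP[us sb].
    have /h hs : `[a, b]%classic s by apply/itvccP; rewrite (le_trans au us) sb.
    apply: le_lt_trans hs.
    have h1 := metric_triangle (gamma u) (gamma s) (gamma t).
    have h2 := metric_triangle (gamma u) (gamma t) (gamma s).
    rewrite (metric_sym (gamma s)) in h1.
    rewrite /from_subspace ler_norml; apply/andP; split; lra.
  have [|v /andP[]] := IVT ub contd (v := e).
    by rewrite mdistxx ge_min le_max (ltW e0) (ltW far) orbT.
  rewrite !bnd_simp => uv vb dv.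
  by exists v => _; split=> //; [rewrite dv|right].
have [nxt hnxt] := choice next.
pose t i := iter i nxt a.
have tab i : a <= t i <= b.
  elim: i => [|i IH]; first by rewrite lexx.
  have [ut tb _ _] := hnxt _ IH; have /andP[at_ _] := IH.
  by rewrite /= (le_trans at_)//= tb.
have tle i : t i <= t i.+1 by have [] := hnxt _ (tab i).
have tN : t N = b.
  case: (eqVneq (t N) b) => // tNb; exfalso.
  have tb i : (i <= N)%N -> t i != b.
    move=> iN; apply: contra_neq tNb => tib; apply/le_anti.
    have /andP[_ ->] := tab N; rewrite -tib.
    rewrite -(subnKC iN) /=; elim: (N - i)%N => [|k IH]; first by rewrite addn0.
    by rewrite addnS (le_trans IH).
  have dte i : (i < N)%N -> mdist (gamma (t i)) (gamma (t i.+1)) = e.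
    by move=> iN; have [_ _ _ [/eqP|//]] := hnxt _ (tab i); rewrite (negPf (tb i.+1 iN)).
  have : e *+ N <= C.
    apply: (@arclength_sum_le gamma a b N t e C ab) => //.
    - move=> i iN; rewrite lt_neqAle tle andbT; apply/eqP => tE.
      by have := dte i iN; rewrite -tE mdistxx => /eqP; rewrite lt_eqF.
    - by have /andP[] := tab N.
    - by apply: (bK Future).
  by rewrite leNgt CN.
exists (gamma \o t).
  split=> //=; rewrite -/(t N) ?tN//.
    by move=> i _; apply: gK; exists (t i) => //; exact/itvccP.
  move=> i iN; split; last by have [] := hnxt _ (tab i).
  have /andP[a1 b1] := tab i; have /andP[a2 b2] := tab i.+1.
  exact: (causal_monotone_le mono).
have h i : (length Future gamma a (t i) <=
    \sum_(j < i) tau (gamma (t j)) (gamma (t j.+1)))%E.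
  elim: i => [|i IH]; first by rewrite big_ord0 lengthxx.
  rewrite big_ord_recr /=; apply: le_trans (length_subadd _ _ _ (t i) _) _.
  by apply: leeD => //; exact: length_le_tau.
by have := h N; rewrite tN.
Qed.

End CurveToChain.

(** * Global hyperbolicity: finiteness and continuity of [tau], closedness of [causal] *)

Section GloballyHyperbolic.
Context {R : realType} {X : lorentzianPreLengthSpace R}.
Context (hlength : lorentzian_length_space X).
Context (hhyperbolic : globally_hyperbolic X).
Context (hconcave : locally_concave X).
Implicit Types (x y z p q : X) (K U : set X) (r e : R) (N : nat).

(** The local time separation [omega] is real-valued, so [omega x x > 0] would
    contradict [omega x x + omega x x <= omega x x]. *)
Lemma not_timelikexx x : ~ timelike x x.
Proof.
have [_ _ loc _] := hlength; have [U Ux [_ [_ [om [_ ax _ _]]]]] := loc x.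
move=> /(tau_gt0 ax Ux Ux) h.
have := tau_reverse_triangle ax Ux Ux Ux (causal_refl ax Ux) (causal_refl ax Ux).
by move: h; rewrite lte_fin -EFinD lee_fin => h; lra.
Qed.

Lemma tauxx x : tau x x = 0%E.
Proof. exact/tau_not_timelike/not_timelikexx. Qed.

Lemma timelike_past_future x :
  (exists y, timelike y x) /\ exists y, timelike x y.
Proof.
have [_ _ loc _] := hlength; have [U Ux [_ [_ [om [_ _ pf _]]]]] := loc x.
by have [[y _ xy] [z _ zx]] := pf x Ux; split; [exists z|exists y].
Qed.

(** The bound by 1 comes from [tau x x = 0] and continuity of [tau] on a comparison set. Halving the
    radius makes the scale valid at all points near [x], which is the form that [lebesgue_number]
    takes. *)
Lemma near_good_scale x :
  exists2 r, 0 < r & forall p, mdist x p < r -> good_scale p r.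
Proof.
have [lcc _ _ _] := hlength.
have [U /nbhs_ballP[r1 /= r10 h1] cU] := hconcave x.
have [V /nbhs_ballP[r2 /= r20 h2] cV] := lcc x.
have [r3 r30 h3] : exists2 r, 0 < r & forall p q, mdist x p < r ->
    mdist x q < r -> (tau p q < 1)%E.
  have [cont _ _] := cU.
  have Ux : U x by apply: h1; exact: ballxx.
  have /subspace_continuousP/(_ (x, x) (conj Ux Ux)) h := cont.
  have : nbhs (tau x x) [set a : \bar R | (a < 1)%E].
    by apply: open_nbhs_nbhs; split; [exact: open_ereal_lt_ereal|rewrite /= tauxx].
  move=> /h; rewrite /= /within /=.
  move=> [[V1 V2] /= [/nbhs_ballP[s1 /= s10 k1] /nbhs_ballP[s2 /= s20 k2]] k].
  exists (Num.min r1 (Num.min s1 s2)); first by rewrite !lt_min r10 s10 s20.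
  move=> p q; rewrite !lt_min => /and3P[p1 p2 p3] /and3P[q1 q2 q3].
  apply: (k (p, q)); first by split; [apply: k1|apply: k2]; rewrite ballEmdist.
  by split; apply: h1; rewrite ballEmdist.
exists (Num.min r1 (Num.min r2 r3) / 2).
  by rewrite divr_gt0// !lt_min r10 r20.
set r := Num.min _ _.
have [rr1 rr2 rr3] : [/\ r <= r1, r <= r2 & r <= r3].
  by rewrite /r !ge_min !lexx !orbT.
have tri p q : mdist x p < r / 2 -> mdist p q < r / 2 -> mdist x q < r.
  by move=> xp pq; apply: le_lt_trans (metric_triangle _ p _) _; lra.
move=> p xp; split.
- exists U => // q pq; apply: h1; rewrite ballEmdist; apply: lt_le_trans rr1.
  exact: tri pq.
- exists V => // q pq; apply: h2; rewrite ballEmdist; apply: lt_le_trans rr2.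
  exact: tri pq.
- move=> q q' pq pq'; apply: h3; apply: lt_le_trans rr3;
    [exact: tri pq|exact: tri pq'].
Qed.

Lemma causal_curve_in_diamond x y gamma a b : causal_curve_from_to setT x y gamma a b ->
  causal_curve_from_to (causal_diamond x y) x y gamma a b.
Proof.
move=> [cc _ ga gb]; split=> //; have mono := causal_curve_monotone cc.
move=> _ [t /itvccP/andP[at_ tb] <-].
split; rewrite -?ga -?gb; exact: (causal_monotone_le mono).
Qed.

(** A mesh [e] and a number [N] of steps for which [curve_to_chain] and [chain_limit] both apply in
    [K]. *)
Definition chain_scale K e N := [/\ compact K, 0 < e,
  forall p, K p -> good_scale p (e *+ 2) &
  exists2 C, bounds_arclength K C & C < e *+ N].

Lemma exists_chain_scale K : compact K -> exists e N, chain_scale K e N.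
Proof.
move=> cK; have [_ /(_ K cK)[C bC]] := hhyperbolic.
have [r r0 hr] := lebesgue_number cK (fun p r s h => good_scale_le h) near_good_scale.
have r20 : 0 < r / 2 by rewrite divr_gt0.
exists (r / 2), (Num.truncn (`|C| / (r / 2))).+1; split=> //.
  by move=> p Kp; rewrite mulr2n -splitr; exact: hr.
exists C => //; apply: le_lt_trans (ler_norm C) _.
by rewrite -[(r / 2) *+ _]mulr_natl -ltr_pdivrMr// truncnS_gt.
Qed.

Lemma chain_tau_fin K e N x y (p : nat -> X) : chain_scale K e N -> chain K e N x y p ->
  forall i, (i < N)%N -> tau (p i) (p i.+1) = (rtau (p i) (p i.+1))%:E /\
    rtau (p i) (p i.+1) <= 1.
Proof.
move=> [_ e0 gK _] [_ _ Kp st] i iN; have [_ _ h] := gK _ (Kp i (ltnW iN)).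
have [_ d] := st _ iN; have e2 : 0 < e *+ 2 by rewrite mulrn_wgt0.
have tlt : (tau (p i) (p i.+1) < 1)%E.
  by apply: h; rewrite ?mdistxx//; apply: le_lt_trans d _; rewrite mulr2n ltrDl.
have fin : tau (p i) (p i.+1) \is a fin_num.
  by rewrite ge0_fin_numE ?(tau_dir_ge0 Future)//; exact: lt_trans tlt (ltry _).
by split; [rewrite fineK|rewrite -lee_fin fineK// ltW].
Qed.

Lemma chain_sumE K e N x y (p : nat -> X) : chain_scale K e N -> chain K e N x y p ->
  (\sum_(i < N) tau (p i) (p i.+1))%E = (chain_sum N p)%:E /\
  chain_sum N p <= N%:R.
Proof.
move=> sc ch; split.
  rewrite -sumEFin; apply: eq_bigr => i _.
  by have [] := chain_tau_fin sc ch (ltn_ord i).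
have -> : N%:R = \sum_(i < N) (1 : R) by rewrite sumr_const card_ord.
apply: ler_sum => i _.
by have [] := chain_tau_fin sc ch (ltn_ord i).
Qed.

(** The alternative [v = 0] covers causal pairs with [tau x y = 0], for which no curve has length
    above 0. Causal path-connectedness still provides a chain, and the constant chain serves if
    [x = y]. *)
Lemma causal_chain_above K e N x y (v : R) : chain_scale K e N ->
  causal_diamond x y `<=` K -> causal x y -> v = 0 \/ (v%:E < tau x y)%E ->
  exists2 p, chain K e N x y p & v <= chain_sum N p.
Proof.
move=> sc JK xy hv; have [cK e0 gK [C bC CN]] := sc.
have [_ [_ path] _ intr] := hlength.
have from_curve l gamma a b : causal_curve_from_to setT x y gamma a b ->
    (l%:E <= length Future gamma a b)%E ->
    exists2 p, chain K e N x y p & l <= chain_sum N p.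
  move=> /causal_curve_in_diamond [cc gJ ga gb] hl.
  have [|p ch le] := @curve_to_chain R X K e C N x y gamma a b e0 CN bC.
    by split=> //; exact: subset_trans JK.
  exists p => //; rewrite -lee_fin; apply: le_trans hl _.
  by have [<- _] := chain_sumE sc ch.
have from0 : v <= 0 -> exists2 p, chain K e N x y p & v <= chain_sum N p.
  move=> v0; have [xyE|/eqP nxy] := eqVneq x y; last first.
    have [gamma [a [b hg]]] := path x y xy nxy.
    by apply: from_curve hg _; apply: le_trans (length_ge0 _ _ _ _); rewrite lee_fin.
  exists (fun=> x); last first.
    apply: le_trans v0 _; apply: sumr_ge0 => i _; exact: rtau_ge0.
  split=> // [i _|i _]; last by split=> //; [exact: (causal_dirxx Future)|rewrite mdistxx ltW].
  by apply: JK; split=> //; rewrite -?xyE; exact: (causal_dirxx Future).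
have [v0|v0] := leP v 0; first exact: from0.
case: hv => [v00|]; first by move: v0; rewrite v00 ltxx.
rewrite intr => /ereal_sup_gt[l [->|[gamma [a [b [hg ->]]]]] vl].
  by move: v0; rewrite -lte_fin => /(lt_trans vl); rewrite ltxx.
exact: (from_curve _ _ _ _ hg (ltW vl)).
Qed.

(** If [tau x y] were infinite, some chain would have sum at least [N + 1], while its [N] steps
    contribute at most 1 each. Once [tau x y] is finite, chains that nearly attain it converge to
    one that does. *)
Lemma causal_chain K e N x y : chain_scale K e N ->
  causal_diamond x y `<=` K -> causal x y -> tau x y \is a fin_num /\
  exists2 p, chain K e N x y p & rtau x y <= chain_sum N p.
Proof.
move=> sc JK xy; have [cK e0 gK _] := sc.
have fin : tau x y \is a fin_num.
  rewrite ge0_fin_numE ?(tau_dir_ge0 Future)// ltNge leye_eq; apply/negP => /eqP tinf.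
  have [|p ch] := causal_chain_above (v := N%:R + 1) sc JK xy.
    by right; rewrite tinf ltry.
  by have [_] := chain_sumE sc ch => h1 h2; lra.
split=> //.
have h n : exists2 p, chain K e N x y p & rtau x y - n.+1%:R^-1 <= chain_sum N p.
  apply: causal_chain_above => //; right.
  by rewrite -[tau x y]fineK// lte_fin -/(rtau x y) ltrBlDr ltrDl invr_gt0.
have {}h n : exists p : nat -> X, chain K e N x y p /\ rtau x y - n.+1%:R^-1 <= chain_sum N p.
  by have [q h1 h2] := h n; exists q.
have [p hp] := choice h.
apply: (@chain_limit R X K e N p (fun=> x) (fun=> y)
  (fun n => rtau x y - n.+1%:R^-1)) => //.
- by move=> n; have [] := hp n.
- by move=> n; have [] := hp n.
- exact: cvg_cst.
- exact: cvg_cst.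
- rewrite -[X in _ --> X]subr0; apply: cvgB; first exact: cvg_cst.
  exact: cvg_harmonic.
Qed.

(** Localizability provides [xm] in the timelike past of [x] and [yp] in the timelike future of [y].
    Since the timelike relation is open, the diamond of [xm] and [yp] contains those of all nearby
    pairs. *)
Lemma near_chain_scale x y : exists K e N, chain_scale K e N /\
  exists2 r, 0 < r & forall x' y', mdist x x' < r -> mdist y y' < r ->
    causal_diamond x' y' `<=` K.
Proof.
have [[xm xmx] _] := timelike_past_future x.
have [_ [yp yyp]] := timelike_past_future y.
have [cJ _] := hhyperbolic; have [e [N sc]] := exists_chain_scale (cJ xm yp).
exists (causal_diamond xm yp), e, N; split=> //.
have [r1 r10 h1] := timelike_near xmx; have [r2 r20 h2] := timelike_near yyp.
exists (Num.min r1 r2); first by rewrite lt_min r10.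
move=> x' y'; rewrite !lt_min => /andP[xx' _] /andP[_ yy'] z [x'z zy'].
have xm' : timelike xm x' by apply: h1; rewrite ?mdistxx.
have yp' : timelike y' yp by apply: h2; rewrite ?mdistxx.
split; first exact: (@causal_dir_trans _ _ Future _ _ _ (timelike_dir_causal (o := Future) xm')).
exact: (@causal_dir_trans _ _ Future _ _ _ zy' (timelike_dir_causal (o := Future) yp')).
Qed.

Lemma tau_fin x y : tau x y \is a fin_num.
Proof.
have [xy|nxy] := pselect (causal x y); last first.
  rewrite tau_not_timelike// => /(timelike_dir_causal (o := Future)) //.
have [K [e [N [sc [r r0 JK]]]]] := near_chain_scale x y.
by have [|] := causal_chain (x := x) (y := y) sc _ xy => //; apply: JK; rewrite mdistxx.
Qed.

Lemma rtauE x y : tau x y = (rtau x y)%:E.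
Proof. by rewrite /rtau fineK// tau_fin. Qed.

Lemma rtauxx x : rtau x x = 0.
Proof. by rewrite /rtau tauxx. Qed.

Lemma rtau_gt0 x y : 0 < rtau x y <-> timelike x y.
Proof. by rewrite -lte_fin -rtauE; exact: (tau_dir_gt0 Future). Qed.

Lemma rtau_triangle y x z : causal x y -> causal y z ->
  rtau x y + rtau y z <= rtau x z.
Proof.
by move=> xy yz; have := tau_dir_triangle (o := Future) xy yz;
  rewrite /= !rtauE -EFinD lee_fin.
Qed.

Lemma causal_chain_le N (p : nat -> X) :
  (forall i, (i < N)%N -> causal (p i) (p i.+1)) ->
  causal (p 0%N) (p N) /\ \sum_(i < N) rtau (p i) (p i.+1) <= rtau (p 0%N) (p N).
Proof.
elim: N => [|N IH] h.
  by rewrite big_ord0 rtauxx; split=> //; exact: (causal_dirxx Future).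
have [|c le] := IH; first by move=> i iN; apply: h; exact: ltnW.
have cN := h N (ltnSn N).
split; first exact: (@causal_dir_trans _ _ Future _ _ _ c cN).
rewrite big_ord_recr /=; apply: le_trans (rtau_triangle c cN).
by rewrite lerD2r.
Qed.

(** Closedness is assumed only locally; it is applied step by step along chains with a fixed number
    of steps. No length is asked of these chains, hence the bound 0. *)
Lemma causal_closed (x y : nat -> X) x0 y0 :
  (forall n, causal (x n) (y n)) -> x @ \oo --> x0 -> y @ \oo --> y0 ->
  causal x0 y0.
Proof.
move=> xy xx0 yy0; have [K [e [N [sc [r r0 JK]]]]] := near_chain_scale x0 y0.
have [cK e0 gK _] := sc.
have [n1 h1] := (cvg_mdistP _ _).1 xx0 _ r0.
have [n2 h2] := (cvg_mdistP _ _).1 yy0 _ r0.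
pose f n := (n + maxn n1 n2)%N.
have nf n : (n <= f n)%N by exact: leq_addr.
have h n : exists p : nat -> X, chain K e N (x (f n)) (y (f n)) p /\ 0 <= chain_sum N p.
  have [||p ch le] := @causal_chain_above K e N (x (f n)) (y (f n)) 0 sc _ (xy _).
  - have := leq_addl n (maxn n1 n2); rewrite geq_max => /andP[/h1 a1 /h2 a2].
    exact: JK.
  - by left.
  by exists p.
have [p hp] := choice h.
have [| | | | |p0 [p00 p0N _ st] _] := @chain_limit R X K e N p (x \o f) (y \o f)
    (fun=> 0) x0 y0 0 cK e0 gK.
- by move=> n; have [] := hp n.
- by move=> n; have [] := hp n.
- exact: cvg_mdist_sub xx0.
- exact: cvg_mdist_sub yy0.
- exact: cvg_cst.
have [] := @causal_chain_le N p0; first by move=> i /st[].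
by rewrite p00 p0N.
Qed.

Lemma rtau_lsc x y e : 0 < e ->
  exists2 r, 0 < r & forall x' y', mdist x x' < r -> mdist y y' < r ->
    rtau x y - e < rtau x' y'.
Proof.
move=> e0; have : ((rtau x y - e)%:E < tau x y)%E.
  by rewrite rtauE lte_fin ltrBlDr ltrDl.
move=> /tau_lsc_near[r r0 h]; exists r => // x' y' xx' yy'.
by rewrite -lte_fin -rtauE; exact: h.
Qed.

(** Pairs converging to [x], [y] with separation at least [rtau x y + e] are joined by chains of
    that sum. A limit chain would join [x] to [y] with a sum larger than [rtau x y]. *)
Lemma rtau_usc x y e : 0 < e ->
  exists2 r, 0 < r & forall x' y', mdist x x' < r -> mdist y y' < r ->
    rtau x' y' < rtau x y + e.
Proof.
move=> e0; apply/not_exists2P => hr.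
have [K [d [N [sc [r r0 JK]]]]] := near_chain_scale x y.
have [cK d0 gK _] := sc.
have h (n : nat) : exists q : X * X, [/\ mdist x q.1 < n.+1%:R^-1,
    mdist y q.2 < n.+1%:R^-1, mdist x q.1 < r, mdist y q.2 < r &
    rtau x y + e <= rtau q.1 q.2].
  have m0 : 0 < Num.min n.+1%:R^-1 r by rewrite lt_min r0 invr_gt0 ltr0n.
  have [//|] := hr (Num.min n.+1%:R^-1 r).
  move=> /existsNP[x' /existsNP[y' /not_implyP[xx' /not_implyP[yy' /negP]]]].
  rewrite -leNgt => le; exists (x', y').
  by move: xx' yy'; rewrite !lt_min => /andP[? ?] /andP[? ?].
have [q hq] := choice h.
have tl n : timelike (q n).1 (q n).2.
  apply/rtau_gt0; have [_ _ _ _] := hq n; apply: lt_le_trans.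
  by rewrite ltr_wpDl// rtau_ge0.
have {}h n : exists p : nat -> X, chain K d N (q n).1 (q n).2 p /\
    rtau x y + e <= chain_sum N p.
  have [_ _ a1 a2 le] := hq n.
  have [||_ [p ch ple]] := causal_chain (x := (q n).1) (y := (q n).2) sc.
  - exact: JK.
  - exact: (timelike_dir_causal (o := Future) (tl n)).
  by exists p; split=> //; exact: le_trans ple.
have [p hp] := choice h.
have [| | | | |p0 [p00 p0N _ st] le] := @chain_limit R X K d N p (fun n => (q n).1)
    (fun n => (q n).2) (fun=> rtau x y + e) x y (rtau x y + e) cK d0 gK.
- by move=> n; have [] := hp n.
- by move=> n; have [] := hp n.
- by apply: cvg_mdist_lt_inv => n; have [] := hq n.
- by apply: cvg_mdist_lt_inv => n; have [] := hq n.
- exact: cvg_cst.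
have [|_] := @causal_chain_le N p0; first by move=> i /st[].
by rewrite p00 p0N; move: le; rewrite /chain_sum => h1 h2; lra.
Qed.

Lemma rtau_near x y e : 0 < e ->
  exists2 r, 0 < r & forall x' y', mdist x x' < r -> mdist y y' < r ->
    `|rtau x y - rtau x' y'| < e.
Proof.
move=> e0; have [r1 r10 h1] := rtau_lsc x y e0.
have [r2 r20 h2] := rtau_usc x y e0.
exists (Num.min r1 r2); first by rewrite lt_min r10.
move=> x' y'; rewrite !lt_min => /andP[a1 a2] /andP[b1 b2].
have := h1 _ _ a1 b1; have := h2 _ _ a2 b2 => ? ?.
by rewrite ltr_norml; apply/andP; split; lra.
Qed.

Lemma rtau_cvg (T : Type) (F : set_system T) (x y : T -> X) x0 y0 : Filter F ->
  x @ F --> x0 -> y @ F --> y0 -> (fun t => rtau (x t) (y t)) @ F --> rtau x0 y0.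
Proof.
move=> FF xx0 yy0; apply/cvgrPdist_lt => e e0.
have [r r0 h] := rtau_near x0 y0 e0.
have /metricType_numDomainType.cvgrPdist_lt/(_ _ r0) hx := xx0.
have /metricType_numDomainType.cvgrPdist_lt/(_ _ r0) hy := yy0.
near=> t; apply: h; first by near: t.
by near: t.
Unshelve. all: by end_near. Qed.

End GloballyHyperbolic.

(** * Maximizers and uniqueness *)

Lemma reparametrizes_onto (R : realType) (X : lorentzianPreLengthSpace R)
    (gamma sigma : R -> X) (a b c d : R) :
  reparametrizes gamma a b sigma c d -> exists phi, monotone_onto phi a b c d /\
    forall t, a <= t <= b -> gamma t = sigma (phi t).
Proof.
move=> [ab [phi [mono cont pa pb gs]]]; exists phi.
have itv t : a <= t -> t <= b -> t \in `[a, b] by move=> *; exact/itvccP/andP.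
have monophi r u : a <= r -> r <= u -> u <= b -> phi r <= phi u.
  by move=> ar ru ub; apply: mono => //; apply: itv => //;
    [exact: le_trans ub|exact: le_trans ru].
split; last by move=> t /itvccP; exact: gs.
split=> // u ucd; have pab : phi a <= phi b by exact: monophi.
have [|t /itvccP tab ptu] := IVT ab cont (v := u).
  by rewrite min_l// max_r// pa pb.
by exists t.
Qed.

Section Maximizers.
Context {R : realType} {X : lorentzianPreLengthSpace R}.
Context (hlength : lorentzian_length_space X).
Context (hhyperbolic : globally_hyperbolic X).
Context (hconcave : locally_concave X).
Context (hregular : regular X).
Implicit Types (x y z p q m : X) (U : set X) (gamma sigma : R -> X)
  (o : time_orientation).

Let tauxx := tauxx hlength.
Let rtauE := rtauE hlength hhyperbolic hconcave.
Let rtau_gt0 := rtau_gt0 hlength hhyperbolic hconcave.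

Lemma tau_dir_fin o x y : tau_dir o x y \is a fin_num.
Proof. by case: o; exact: (tau_fin hlength hhyperbolic hconcave). Qed.

Lemma length_fin o gamma a b : a <= b -> length o gamma a b \is a fin_num.
Proof.
move=> ab; rewrite ge0_fin_numE ?length_ge0//.
by apply: le_lt_trans (length_le_tau _ _ ab) _; rewrite -ge0_fin_numE ?tau_dir_ge0// tau_dir_fin.
Qed.

Lemma concat_causal x z y gamma1 a b gamma2 c d :
  causal_curve_from_to setT x z gamma1 a b ->
  causal_curve_from_to setT z y gamma2 c d ->
  exists gamma e, causal_curve_from_to setT x y gamma a e /\
    (length Future gamma1 a b + length Future gamma2 c d <=
      length Future gamma a e)%E.
Proof.
move=> [cc1 _ g1a g1b] [cc2 _ g2c g2d].
have ab := directed_curve_lt cc1; have cd := directed_curve_lt cc2.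
have bb1 : b < b + 1 by rewrite ltrDl.
pose gamma2' := gamma2 \o affine_param b (b + 1) c d.
have e12 : gamma1 b = gamma2' b by rewrite /gamma2' /= affine_param_l g1b.
have cc2' : causal_curve Future `[b, b + 1] gamma2' := affine_directed bb1 cd cc2.
have cc : causal_curve Future `[a, b + 1] (paste b gamma1 gamma2') :=
  paste_directed (fun u v w => @causal_dir_trans _ X Future v u w)
  (ltW ab) (ltW bb1) e12 cc1 cc2'.
exists (paste b gamma1 gamma2'), (b + 1); split.
  split=> //; first by rewrite pasteL ?ltW.
  by rewrite pasteR// ?ltW// /gamma2' /= affine_param_r.
rewrite (length_add (ltW ab) (ltW bb1) (causal_curve_monotone cc)).
apply: leeD.
  rewrite (@eq_length _ _ _ (paste b gamma1 gamma2') gamma1)// => t /andP[_ tb].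
  by rewrite pasteL.
rewrite (@eq_length _ _ _ (paste b gamma1 gamma2') gamma2'); last first.
  by move=> t /andP[bt _]; rewrite pasteR.
by rewrite (length_monotone_onto tauxx (gamma := gamma2') (ltW bb1)
  (affine_param_onto bb1 cd) (causal_curve_monotone cc2)).
Qed.

(** For a step that is causal but not timelike, [tau] vanishes and any causal curve will do. *)
Lemma step_curve U p q : comparison_set U -> U p -> U q -> causal p q ->
  p <> q -> exists gamma a b, causal_curve_from_to setT p q gamma a b /\
    (tau p q <= length Future gamma a b)%E.
Proof.
move=> [_ cU _] Up Uq pq npq; have [tpq|ntpq] := pselect (timelike p q).
  have [gamma [a [b [[cc _ ga gb] len]]]] := cU p q Up Uq tpq.
  by exists gamma, a, b; rewrite len.
have [_ [_ path] _ _] := hlength; have [gamma [a [b h]]] := path p q pq npq.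
by exists gamma, a, b; split=> //; rewrite tau_not_timelike// length_ge0.
Qed.

(** Curves are non-constant, so constant steps are skipped, and a chain consisting only of such
    steps falls under the first alternative. *)
Lemma chain_to_curve K e N x y (p : nat -> X) : chain_scale K e N ->
  chain K e N x y p ->
  (y = x /\ chain_sum N p = 0) \/ exists gamma a b,
    causal_curve_from_to setT x y gamma a b /\
    ((chain_sum N p)%:E <= length Future gamma a b)%E.
Proof.
move=> [_ e0 gK _] [p0 <- Kp st].
have comp i : (i < N)%N -> exists U, [/\ comparison_set U, U (p i) & U (p i.+1)].
  move=> iN; have [[U cU hU] _ _] := gK _ (Kp i (ltnW iN)).
  have [_ d] := st i iN; have e2 : 0 < e *+ 2 by rewrite mulrn_wgt0.
  exists U; split=> //; apply: hU; rewrite ?mdistxx//.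
  by apply: le_lt_trans d _; rewrite mulr2n ltrDl.
have {Kp gK} : forall n, (n <= N)%N -> (p n = x /\ chain_sum n p = 0) \/
    exists gamma a b, causal_curve_from_to setT x (p n) gamma a b /\
    ((chain_sum n p)%:E <= length Future gamma a b)%E.
  elim=> [|n IH] nN; first by left; rewrite /chain_sum big_ord0.
  have {IH} := IH (ltnW nN); rewrite /chain_sum big_ord_recr /=.
  have [<-|npp] := pselect (p n = p n.+1).
    by rewrite (rtauxx hlength) addr0.
  have [U [cU Upn UpSn]] := comp n nN; have [cn _] := st n nN.
  have [gamma [a [b [hg lg]]]] := step_curve cU Upn UpSn cn npp.
  move=> [[pnx s0]|[gamma' [a' [b' [hg' lg']]]]]; right.
    by exists gamma, a, b; rewrite -pnx; split=> //; rewrite s0 add0r -rtauE.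
  have [gamma'' [b'' [hg'' lg'']]] := concat_causal hg' hg.
  exists gamma'', a', b''; split=> //; apply: le_trans lg''.
  by rewrite EFinD -rtauE leeD.
by apply.
Qed.

Lemma exists_maximizer x y : timelike x y -> exists gamma a b,
  [/\ maximizer Future gamma a b, gamma a = x & gamma b = y].
Proof.
move=> txy; have xy := timelike_dir_causal (o := Future) txy.
have [K [e [N [sc [r r0 JK]]]]] := near_chain_scale hlength hhyperbolic hconcave x y.
have [|_ [p ch sum]] := causal_chain hlength sc _ xy.
  by apply: JK; rewrite mdistxx.
have [[yx _]|[gamma [a [b [[cc _ ga gb] len]]]]] := chain_to_curve sc ch.
  by case: (not_timelikexx hlength (x := x)); rewrite -{2}yx.
exists gamma, a, b; split=> //; split=> //; apply/eqP; rewrite eq_le.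
rewrite length_le_tau ?(ltW (directed_curve_lt cc))//=.
by apply: le_trans len; rewrite ga gb rtauE lee_fin.
Qed.

Lemma maximizer_reparametrize gamma a b sigma c d :
  maximizer Future gamma a b -> timelike_curve Future `[c, d] sigma ->
  reparametrizes gamma a b sigma c d ->
  [/\ maximizer Future sigma c d, sigma c = gamma a & sigma d = gamma b].
Proof.
move=> [cg lg] ts rep; have cs := timelike_curve_causal ts.
have ab := ltW (directed_curve_lt cg).
have [phi [onto gs]] := reparametrizes_onto rep.
have [_ pa pb _] := onto.
have ga : sigma c = gamma a by rewrite gs ?lexx// pa.
have gb : sigma d = gamma b by rewrite gs ?lexx ?andbT// pb.
split=> //; split=> //; rewrite ga gb -lg; apply/esym.
exact: (length_monotone_onto tauxx ab onto (causal_curve_monotone cs)).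
Qed.

Lemma exists_timelike_maximizer x y a b : timelike x y -> a < b -> exists sigma,
  [/\ timelike_curve Future `[a, b] sigma, maximizer Future sigma a b,
      sigma a = x & sigma b = y].
Proof.
move=> txy ab; have [gamma [a' [b' [mg ga gb]]]] := exists_maximizer txy.
have [|sigma [c [d [ts rep]]]] := hregular mg; first by rewrite ga gb.
have [[cs ls] sc sd] := maximizer_reparametrize mg ts rep.
have cd := directed_curve_lt ts.
have ts' : timelike_curve Future `[a, b] (sigma \o affine_param a b c d) :=
  affine_directed ab cd ts.
have sa : (sigma \o affine_param a b c d) a = x.
  by rewrite /= affine_param_l sc ga.
have sb : (sigma \o affine_param a b c d) b = y.
  by rewrite /= affine_param_r// sd gb.
exists (sigma \o affine_param a b c d); split=> //.
split; first exact: timelike_curve_causal ts'.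
rewrite sa sb -ga -gb -sc -sd -ls.
apply: (length_monotone_onto tauxx (ltW ab) (affine_param_onto ab cd)) => //.
exact: causal_curve_monotone cs.
Qed.

(** Length is additive, [tau] is superadditive, and length is at most [tau] on each piece. As all
    values are finite, equality on the whole forces equality on the pieces. *)
Lemma maximizer_sub o sigma c d r u : maximizer o sigma c d ->
  c <= r -> r <= u -> u <= d ->
  length o sigma r u = tau_dir o (sigma r) (sigma u).
Proof.
move=> [cs ls] cr ru ud; have mono := causal_curve_monotone cs.
have cu := le_trans cr ru; have rd := le_trans ru ud; have cd := le_trans cr rd.
have := length_add cu ud mono.
rewrite (length_add cr ru (causal_monotone_sub (lexx _) ud mono)) ls.
have t1 := tau_dir_triangle (causal_monotone_le mono (lexx c) cu ud)
  (causal_monotone_le mono cu ud (lexx d)).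
have t2 := tau_dir_triangle (causal_monotone_le mono (lexx c) cr rd)
  (causal_monotone_le mono cr ru ud).
have l1 := length_le_tau o sigma cr; have l2 := length_le_tau o sigma ru.
have l3 := length_le_tau o sigma ud; move: t1 t2 l1 l2 l3.
have tE p q : tau_dir o p q = (fine (tau_dir o p q))%:E.
  by rewrite fineK// tau_dir_fin.
rewrite (tE (sigma c) (sigma u)) (tE (sigma u) (sigma d)) (tE (sigma c) (sigma d)).
rewrite (tE (sigma c) (sigma r)) (tE (sigma r) (sigma u)).
rewrite -(fineK (length_fin o sigma cr)) -(fineK (length_fin o sigma ru)).
rewrite -(fineK (length_fin o sigma ud)).
rewrite -!EFinD !lee_fin => t1 t2 l1 l2 l3 [e1].
by congr EFin; lra.
Qed.

Lemma maximizer_geodesic o sigma c d : maximizer o sigma c d ->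
  geodesic o sigma c d.
Proof.
move=> ms; have [cs _] := ms; split=> // t tcd; exists c, d; split=> //.
exact: withinT.
Qed.

(** The parameter change is the inverse of the normalized length function [F], which is strictly
    increasing and continuous because [sigma] is locally a maximizer between timelike related
    points. *)
Lemma constant_speed_param sigma c d : timelike_curve Future `[c, d] sigma ->
  geodesic Future sigma c d -> exists gamma, [/\ constant_speed Future gamma 0 1,
    reparametrizes gamma 0 1 sigma c d, gamma 0 = sigma c & gamma 1 = sigma d].
Proof.
move=> ts [cs loc]; have mono := causal_curve_monotone cs.
have cd := directed_curve_lt ts.
pose F t := fine (length Future sigma c t).
have FE t : c <= t -> length Future sigma c t = (F t)%:E.
  by move=> ct; rewrite /F fineK// length_fin.
have Fadd s t : c <= s -> s <= t -> t <= d ->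
    (F t)%:E = ((F s)%:E + length Future sigma s t)%E.
  move=> cs' st td; rewrite -!FE//; last exact: le_trans st.
  by apply: length_add => //; exact: causal_monotone_sub mono.
have Fc : F c = 0 by rewrite /F lengthxx.
have Flt s t : c <= s -> s < t -> t <= d -> F s < F t.
  move=> cs' st td.
  have sI : `[c, d]%classic s.
    by apply/itvccP; rewrite cs' (le_trans (ltW st)).
  have [c' [d' [sub nb mx]]] := loc s sI.
  have cds : c' <= s <= d'.
    by apply/itvccP; exact: (nbhs_singleton nb sI).
  (* A short piece [[s, m]] on which [sigma] is a maximizer has positive length, and the remainder
     has nonnegative length. *)
  have [m /andP[sm mt] md'] : exists2 m, s < m <= t & m <= d'.
    move: nb => /nbhs_ballP[e /= e0 he].
    pose m := Num.min t (s + e / 2).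
    have e20 : 0 < e / 2 by rewrite divr_gt0.
    have sm : s < m by rewrite lt_min st ltrDl.
    have mt : m <= t by rewrite ge_min lexx.
    exists m; first by rewrite sm.
    have mI : `[c, d]%classic m.
      by apply/itvccP; rewrite (le_trans cs' (ltW sm)) (le_trans mt).
    have /itvccP/andP[//] : `[c', d']%classic m.
    apply: he => //; rewrite /ball /= ltr0_norm ?subr_lt0// opprB.
    by rewrite ltrBlDr (@le_lt_trans _ _ (s + e / 2)) ?ge_min ?lexx ?orbT//; lra.
  have /andP[c's sd'] := cds.
  have h1 := Fadd _ _ cs' (ltW sm) (le_trans mt td).
  have h2 := Fadd _ _ (le_trans cs' (ltW sm)) mt td.
  move: h1; rewrite (maximizer_sub mx c's (ltW sm) md') /= rtauE => -[h1].
  have : 0 < rtau (sigma s) (sigma m).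
    apply/rtau_gt0; have [_ mts] := ts; apply: (mts s m) => //.
    by apply/itvccP; rewrite (le_trans cs' (ltW sm)) (le_trans mt).
  move: h2; rewrite -(fineK (length_fin Future sigma mt)) => -[h2].
  have : 0 <= fine (length Future sigma m t) by rewrite fine_ge0// length_ge0.
  by move=> h3 h4; lra.
have Fd0 : 0 < F d by rewrite -Fc Flt.
have Fle s t : c <= s -> s <= t -> t <= d -> F s <= F t.
  by move=> cs'; rewrite le_eqVlt => /predU1P[->//|st td]; exact/ltW/Flt.
have scont : {within `[c, d], continuous sigma}.
  by case: cs => [[_ lip _] _]; exact: locally_lipschitz_continuous.
(* Near [t], [F] is a constant plus the separation from the fixed point [sigma c'], so its
   continuity is that of [rtau]. *)
have Fcont : {within `[c, d], continuous F}.
  apply/subspace_continuousP => t tI; have [c' [d' [sub nb mx]]] := loc t tI.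
  have /itvccP/andP[c't td'] : `[c', d']%classic t by exact: (nbhs_singleton nb tI).
  have /itvccP/andP[cc' _] : `[c, d]%classic c'.
    by apply: sub; apply/itvccP; rewrite lexx (le_trans c't).
  have Floc s : c' <= s <= d' -> `[c, d]%classic s ->
      F s = F c' + rtau (sigma c') (sigma s).
    move=> /andP[c's sd'] /itvccP/andP[_ sd].
    have := Fadd _ _ cc' c's sd.
    by rewrite (maximizer_sub mx (lexx c') c's sd') /= rtauE => -[].
  have /subspace_continuousP/(_ t tI) ht := scont.
  have lim : (fun s => rtau (sigma c') (sigma s)) @ within `[c, d] (nbhs t) -->
      rtau (sigma c') (sigma t).
    apply: (rtau_cvg hlength hhyperbolic hconcave) ht; exact: cvg_cst.
  have lim2 : (fun s => F c' + rtau (sigma c') (sigma s)) @ within `[c, d] (nbhs t) -->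
      F t.
    by rewrite (Floc t)// ?c't//; apply: cvgD lim; exact: cvg_cst.
  apply: cvg_trans lim2; apply: near_eq_cvg.
  apply: filterS nb => s h; apply/esym.
  by apply: Floc; [exact/itvccP|exact: sub].
have ex t : exists u, 0 <= t <= 1 -> c <= u <= d /\ F u = t * F d.
  have [/andP[t0 t1]|_] := boolP (0 <= t <= 1); last by exists 0.
  have [|u /itvccP ucd Fu] := IVT (ltW cd) Fcont (v := t * F d).
    rewrite Fc min_l ?max_r ?(ltW Fd0)// mulr_ge0// ?(ltW Fd0)//=.
    by rewrite ler_piMl// ltW.
  by exists u.
have [phi hphi] := choice ex.
have Finj s t : c <= s <= d -> c <= t <= d -> F s = F t -> s = t.
  move=> /andP[cs' sd] /andP[ct td] e; case: (ltgtP s t) => // st.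
    by have := Flt _ _ cs' st td; rewrite e ltxx.
  by have := Flt _ _ ct st sd; rewrite e ltxx.
have phi_lt s t : 0 <= s -> s < t -> t <= 1 -> phi s < phi t.
  move=> s0 st t1.
  have [|/andP[cs' sd] Fs] := hphi s; first by rewrite s0 (le_trans (ltW st)).
  have [|/andP[ct td] Ft] := hphi t; first by rewrite t1 (le_trans s0 (ltW st)).
  rewrite ltNge; apply/negP => /(Fle _ _ ct)/(_ sd).
  by rewrite Fs Ft ler_pM2r// leNgt st.
have p01 : 0 <= (0 : R) <= 1 by rewrite lexx ler01.
have p11 : 0 <= (1 : R) <= 1 by rewrite lexx ler01.
have phi0 : phi 0 = c.
  have [h1 h2] := hphi 0 p01; apply: Finj => //; first by rewrite lexx ltW.
  by rewrite h2 mul0r Fc.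
have phi1 : phi 1 = d.
  have [h1 h2] := hphi 1 p11; apply: Finj => //; first by rewrite lexx ltW.
  by rewrite h2 mul1r.
have onto : monotone_onto phi 0 1 c d.
  split=> //.
    move=> r u r0; rewrite le_eqVlt => /predU1P[->//|ru u1].
    by rewrite ltW// phi_lt.
  move=> u ucd; have /andP[cu ud] := ucd.
  have t01 : 0 <= F u / F d <= 1.
    have Fu0 : 0 <= F u by rewrite -Fc Fle.
    by rewrite divr_ge0 ?(ltW Fd0)//= ler_pdivrMr// mul1r Fle.
  exists (F u / F d) => //; have [h1 h2] := hphi _ t01.
  by apply: Finj => //; rewrite h2 divfK// gt_eqF.
exists (sigma \o phi); split; rewrite /= ?phi0 ?phi1//.
  exists (F d) => t /itvccP t01; have /andP[t0 t1] := t01.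
  have onto' := monotone_onto_subr onto t01; have [/andP[ct td] Ft] := hphi _ t01.
  have mono' := causal_monotone_sub (lexx c) td mono.
  rewrite (length_monotone_onto tauxx (gamma := sigma \o phi) t0 onto' mono')//.
  by rewrite FE// Ft subr0 mulrC.
split=> //; exists phi; split=> //.
  move=> r u /itvccP/andP[r0 r1] /itvccP/andP[u0 u1].
  rewrite le_eqVlt => /predU1P[->//|ru].
  by rewrite ltW// phi_lt.
apply: segment_inc_surj_continuous.
  move=> r u /itvccP/andP[r0 r1] /itvccP/andP[u0 u1].
  apply/idP/idP => [|]; last first.
    rewrite le_eqVlt => /predU1P[->//|ru]; first by rewrite ltW// phi_lt.
  by apply: contraTT; rewrite -!ltNge => ur; rewrite phi_lt.
rewrite phi0 phi1 => u /itvccP ucd; have [_ _ _ /(_ u ucd)[t t01 pt]] := onto.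
by exists t => //; exact/itvccP.
Qed.

End Maximizers.

(** * Segments under the uniqueness hypothesis *)

Section UniqueGeodesics.
Context {R : realType} {X : lorentzianPreLengthSpace R}.
Context (hlength : lorentzian_length_space X).
Context (hhyperbolic : globally_hyperbolic X).
Context (hconcave : locally_concave X).
Context (hregular : regular X).
Context (hunique : forall x y : X, timelike x y -> unique_timelike_geodesic x y).
Implicit Types (x y z m : X) (U : set X) (gamma sigma : R -> X)
  (o : time_orientation).

Let tauxx := tauxx hlength.
Let rtauxx := rtauxx hlength.
Let rtauE := rtauE hlength hhyperbolic hconcave.
Let rtau_gt0 := rtau_gt0 hlength hhyperbolic hconcave.

Lemma timelike_maximizer_geodesic o gamma a b :
  timelike_maximizer o gamma a b -> timelike_geodesic o gamma a b.
Proof.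
move=> [cs [sigma [c [d [ts mx rep]]]]]; split=> //.
by exists sigma, c, d; split=> //; exact: maximizer_geodesic.
Qed.

Lemma maximizer_param sigma c d : timelike_curve Future `[c, d] sigma ->
  maximizer Future sigma c d -> exists gamma,
  [/\ timelike_maximizer Future gamma 0 1, gamma 0 = sigma c, gamma 1 = sigma d &
    reparametrizes gamma 0 1 sigma c d].
Proof.
move=> ts mx; have [gamma [cs rep g0 g1]] := constant_speed_param hlength
  hhyperbolic hconcave ts (maximizer_geodesic mx).
by exists gamma; split=> //; split=> //; exists sigma, c, d.
Qed.

Definition maximizing_segment x y gamma :=
  [/\ timelike_maximizer Future gamma 0 1, gamma 0 = x & gamma 1 = y].

Lemma exists_segments : exists geo : X -> X -> R -> X,
  forall x y, timelike x y -> maximizing_segment x y (geo x y).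
Proof.
have h (q : X * X) : exists gamma, timelike q.1 q.2 -> maximizing_segment q.1 q.2 gamma.
  have [t|nt] := pselect (timelike q.1 q.2); last by exists (fun=> q.1).
  have [sigma [ts mx s0 s1]] := exists_timelike_maximizer hlength hhyperbolic
    hconcave hregular t (@ltr01 R).
  have [gamma [tm g0 g1 _]] := maximizer_param ts mx.
  by exists gamma; split=> //; [rewrite g0|rewrite g1].
have [f hf] := choice h.
by exists (fun x y => f (x, y)) => x y; exact: (hf (x, y)).
Qed.

Definition rtau_dir o x y : R := if o is Future then rtau x y else rtau y x.

Lemma rtau_dirE o x y : tau_dir o x y = (rtau_dir o x y)%:E.
Proof. by case: o; exact: rtauE. Qed.

(** What a timelike maximizer on [[0, 1]] says about order and separation alone. Without curves and
    Lipschitz parametrizations, restriction and time reversal are mere substitutions. *)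
Definition line o gamma := timelike_dir o (gamma 0) (gamma 1) /\
  forall s t, 0 <= s -> s <= t -> t <= 1 -> causal_dir o (gamma s) (gamma t) /\
    rtau_dir o (gamma s) (gamma t) = (t - s) * rtau_dir o (gamma 0) (gamma 1).

Lemma timelike_maximizer_line o gamma : timelike_maximizer o gamma 0 1 ->
  line o gamma.
Proof.
move=> [[v cs] [sigma [c [d [ts mx rep]]]]].
have [phi [onto gs]] := reparametrizes_onto rep.
have [phim p0 p1 _] := onto; have cd := directed_curve_lt ts.
have [cc len] := mx; have mono := causal_curve_monotone cc.
have h01 (t : R) : 0 <= t -> t <= 1 -> 0 <= t <= 1 by move=> ? ?; exact/andP.
have phicd t : 0 <= t -> t <= 1 -> c <= phi t <= d.
  by move=> t0 t1; rewrite -p0 -p1 !phim.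
have tauE s t : 0 <= s -> s <= t -> t <= 1 ->
    (length o gamma s t = tau_dir o (gamma s) (gamma t)).
  move=> s0 st t1; have s1 := le_trans st t1; have t0 := le_trans s0 st.
  have /andP[cs' sd] := phicd s s0 s1; have /andP[ct td] := phicd t t0 t1.
  have pst : phi s <= phi t by exact: phim.
  rewrite !gs ?h01// -(maximizer_sub hlength hhyperbolic hconcave mx cs' pst td).
  apply: (length_monotone_onto tauxx (phi := phi)) => //.
  - have := monotone_onto_subr onto (h01 t t0 t1).
    by move=> /monotone_onto_subl; apply; rewrite s0.
  - exact: causal_monotone_sub mono.
  - by move=> u /andP[su ut]; apply: gs; rewrite h01// ?(le_trans s0)// (le_trans ut).
have gmono s t : 0 <= s -> s <= t -> t <= 1 -> causal_dir o (gamma s) (gamma t).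
  move=> s0 st t1; have s1 := le_trans st t1; have t0 := le_trans s0 st.
  have /andP[cs' sd] := phicd s s0 s1; have /andP[ct td] := phicd t t0 t1.
  by rewrite !gs ?h01//; apply: (causal_monotone_le mono) => //; exact: phim.
have speed t : 0 <= t -> t <= 1 -> rtau_dir o (gamma 0) (gamma t) = v * t.
  move=> t0 t1; have /cs : `[0, 1]%classic t by exact/itvccP/h01.
  by rewrite tauE// rtau_dirE subr0 => -[].
split.
  rewrite !gs ?h01 ?ler01// p0 p1; have [_ h] := ts.
  by apply: h => //; apply/itvccP; rewrite lexx ltW.
move=> s t s0 st t1; have s1 := le_trans st t1; have t0 := le_trans s0 st.
split; first exact: gmono.
have gm : causal_monotone o gamma 0 t.
  by move=> r u r0 ru ut; apply: gmono => //; [exact: ltW|exact: le_trans t1].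
have := length_add s0 st gm; rewrite !tauE// !rtau_dirE -EFinD => -[].
by rewrite !speed//; lra.
Qed.

Lemma timelike_geodesic_unique x y gamma sigma : timelike x y ->
  timelike_geodesic_from_to x y gamma 0 1 ->
  timelike_geodesic_from_to x y sigma 0 1 ->
  exists phi, monotone_onto phi 0 1 0 1 /\
    forall t, 0 <= t <= 1 -> gamma t = sigma (phi t).
Proof.
by move=> xy hg hs; apply: reparametrizes_onto; case: (hunique xy) => _; apply.
Qed.

Lemma line_monotone o gamma : line o gamma -> causal_monotone o gamma 0 1.
Proof. by move=> [_ h] r u r0 ru u1; case: (h r u r0 (ltW ru) u1). Qed.

Lemma line_length gamma : timelike_maximizer Future gamma 0 1 ->
  length Future gamma 0 1 = tau (gamma 0) (gamma 1).
Proof.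
move=> tm; have [[v cs] [sigma [c [d [ts [cc mx] rep]]]]] := tm.
have [phi [onto gs]] := reparametrizes_onto rep.
have [_ p0 p1 _] := onto.
rewrite (length_monotone_onto tauxx (@ler01 R) onto (causal_curve_monotone cc) gs).
by rewrite mx /= !gs ?lexx ?ler01// p0 p1.
Qed.

Lemma geodesic_length x y gamma a b : timelike x y ->
  timelike_geodesic_from_to x y gamma a b ->
  length Future gamma a b = tau x y.
Proof.
move=> xy hg; have [geo hgeo] := exists_segments; have [tm g0 g1] := hgeo x y xy.
have [_ /(_ _ _ _ _ _ _ hg) uniq] := hunique xy.
have rep : reparametrizes gamma a b (geo x y) 0 1.
  by apply: uniq; split=> //; exact: timelike_maximizer_geodesic.
have ab : a <= b by case: rep.
have [phi [onto gs]] := reparametrizes_onto rep.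
rewrite (length_monotone_onto tauxx ab onto _ gs) ?line_length ?g0 ?g1//.
exact/line_monotone/timelike_maximizer_line.
Qed.

Lemma timelike_curve_ends o sigma c d : timelike_curve o `[c, d] sigma ->
  timelike_dir o (sigma c) (sigma d).
Proof.
move=> ts; have cd := directed_curve_lt ts; have [_ h] := ts.
by apply: h => //; apply/itvccP; rewrite lexx ltW.
Qed.

(** Uniqueness concerns constant-speed geodesics. It is applied to the constant-speed
    parametrization of [sigma], which has the same length. *)
Lemma geodesic_maximizer sigma c d : timelike_curve Future `[c, d] sigma ->
  geodesic Future sigma c d -> maximizer Future sigma c d.
Proof.
move=> ts gs; have cs := timelike_curve_causal ts; split=> //.
have [gamma [csp rep g0 g1]] := constant_speed_param hlength hhyperbolic hconcave ts gs.
rewrite /= -(@geodesic_length (sigma c) (sigma d) gamma 0 1).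
- have [phi [onto ge]] := reparametrizes_onto rep.
  by rewrite (length_monotone_onto tauxx (@ler01 R) onto (causal_curve_monotone cs) ge).
- exact: timelike_curve_ends ts.
- by split=> //; split=> //; exists sigma, c, d.
Qed.

Lemma eq_maximizer o gamma sigma a b :
  (forall t, a <= t <= b -> gamma t = sigma t) ->
  maximizer o gamma a b -> maximizer o sigma a b.
Proof.
move=> e [cc len]; have ab := ltW (directed_curve_lt cc).
split; first exact: eq_directed_curve cc.
by rewrite -(eq_length _ e) len !e ?lexx ?ab.
Qed.

Lemma paste_maximizer x y z sigma1 sigma2 a b c :
  timelike x y -> timelike y z ->
  timelike_curve Future `[a, b] sigma1 -> timelike_curve Future `[b, c] sigma2 ->
  maximizer Future sigma1 a b -> maximizer Future sigma2 b c ->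
  sigma1 a = x -> sigma1 b = y -> sigma2 b = y -> sigma2 c = z ->
  timelike_curve Future `[a, c] (paste b sigma1 sigma2) /\
  length Future (paste b sigma1 sigma2) a c = (rtau x y + rtau y z)%:E.
Proof.
move=> xy yz ts1 ts2 [_ l1] [_ l2] s1a s1b s2b s2c.
have ab := directed_curve_lt ts1; have bc := directed_curve_lt ts2.
have e12 : sigma1 b = sigma2 b by rewrite s1b s2b.
have ts : timelike_curve Future `[a, c] (paste b sigma1 sigma2) :=
  paste_directed (fun u v w => @timelike_dir_trans _ X Future v u w)
  (ltW ab) (ltW bc) e12 ts1 ts2.
split=> //; rewrite (length_add (ltW ab) (ltW bc)); last first.
  exact: causal_curve_monotone (timelike_curve_causal ts).
rewrite (@eq_length _ _ _ _ sigma1 a b); last by move=> t /andP[_ ?]; rewrite pasteL.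
rewrite (@eq_length _ _ _ _ sigma2 b c); last by move=> t /andP[? _]; rewrite pasteR.
by rewrite l1 l2 /= s1a s1b s2b s2c !rtauE EFinD.
Qed.

(** Maximizers from [x] to [m] and from [m] to [y] concatenate to a curve of length [rtau x y], that
    is, to a maximizer. By uniqueness it runs along [gamma], and the separation from [x] identifies
    the parameter of [m] as [t]. *)
Lemma midpoint_unique x y m gamma (t : R) : maximizing_segment x y gamma ->
  timelike x y -> causal x m -> causal m y -> 0 < t < 1 ->
  rtau x m = t * rtau x y -> rtau m y = (1 - t) * rtau x y -> m = gamma t.
Proof.
move=> [tm g0 g1] xy xm my /andP[t0 t1] xmE myE.
have T0 : 0 < rtau x y by exact/rtau_gt0.
have txm : timelike x m by apply/rtau_gt0; rewrite xmE mulr_gt0.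
have tmy : timelike m y by apply/rtau_gt0; rewrite myE mulr_gt0// subr_gt0.
have l01 : (0 : R) < 1 by [].
have l12 : (1 : R) < 2 by rewrite ltr1n.
have [s1 [ts1 mx1 s10 s11]] := exists_timelike_maximizer hlength hhyperbolic
  hconcave hregular txm l01.
have [s2 [ts2 mx2 s21 s22]] := exists_timelike_maximizer hlength hhyperbolic
  hconcave hregular tmy l12.
have [ts len] := paste_maximizer txm tmy ts1 ts2 mx1 mx2 s10 s11 s21 s22.
set sigma := paste 1 s1 s2 in ts len.
have e12 : s1 1 = s2 1 by rewrite s11 s21.
have sg0 : sigma 0 = x by rewrite /sigma pasteL.
have sg1 : sigma 1 = m by rewrite /sigma pasteL.
have sg2 : sigma 2 = y by rewrite /sigma pasteR// ltW.
have mx : maximizer Future sigma 0 2.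
  split; first exact: timelike_curve_causal.
  by rewrite len /= sg0 sg2 rtauE xmE myE; congr EFin; ring.
have [gamma' [tm' g0' g1' rep]] := maximizer_param ts mx.
have [||psi' [onto' gp']] := @timelike_geodesic_unique x y gamma' gamma xy.
- by split; rewrite ?g0' ?g1'//; exact: timelike_maximizer_geodesic.
- by split=> //; exact: timelike_maximizer_geodesic.
have [phi [[_ _ _ onto] ge]] := reparametrizes_onto rep.
have [|u u01 pu] := onto 1; first by rewrite ler01 ler1n.
have mE : m = gamma (psi' u) by rewrite -gp'// ge// pu sg1.
have [mono p0 p1 _] := onto'; have /andP[u0 u1] := u01.
have pu0 : 0 <= psi' u by rewrite -p0 mono.
have pu1 : psi' u <= 1 by rewrite -p1 mono.
have [_ /(_ 0 (psi' u) (lexx _) pu0 pu1)[_]] := timelike_maximizer_line tm.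
by rewrite /= g0 g1 -mE xmE subr0 => /(mulIf (lt0r_neq0 T0))->.
Qed.

(** A comparison set contains some maximizer from [x] to [y]. By the intermediate value theorem it
    has a point at separation [t * rtau x y] from [x], and [midpoint_unique] identifies that point
    with [gamma t]. *)
Lemma segment_in_comparison_set U x y gamma (t : R) : comparison_set U ->
  U x -> U y -> timelike x y -> maximizing_segment x y gamma -> 0 <= t <= 1 ->
  U (gamma t).
Proof.
move=> [_ cU _] Ux Uy xy seg /andP[]; have [tm g0 g1] := seg.
rewrite le_eqVlt => /predU1P[<- _|t0]; first by rewrite g0.
rewrite le_eqVlt => /predU1P[->|t1]; first by rewrite g1.
have [sigma [a [b [[cc sU sa sb] len]]]] := cU x y Ux Uy xy.
have mx : maximizer Future sigma a b by split=> //; rewrite len /= sa sb.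
have ab := ltW (directed_curve_lt cc); have mono := causal_curve_monotone cc.
have T0 : 0 < rtau x y by exact/rtau_gt0.
have cont : {within `[a, b], continuous (fun s => rtau x (sigma s))}.
  apply/subspace_continuousP => s sI.
  have scont : {within `[a, b], continuous sigma}.
    by case: cc => [[_ lip _] _]; exact: locally_lipschitz_continuous.
  have /subspace_continuousP/(_ s sI) hs := scont.
  by apply: (rtau_cvg hlength hhyperbolic hconcave) hs; exact: cvg_cst.
have [|s /itvccP/andP[as_ sb'] xs] := IVT ab cont (v := t * rtau x y).
  rewrite sa sb rtauxx min_l ?max_r ?(ltW T0)//.
  by rewrite mulr_ge0 ?(ltW t0) ?(ltW T0)//= ler_piMl// ltW.
have xsc : causal x (sigma s) by rewrite -sa; exact: (causal_monotone_le mono).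
have syc : causal (sigma s) y by rewrite -sb; exact: (causal_monotone_le mono).
suff <- : sigma s = gamma t by apply: sU; exists s => //; apply/itvccP; rewrite as_.
apply: (midpoint_unique seg) => //; first by rewrite t0.
have sub := maximizer_sub hlength hhyperbolic hconcave mx.
have := length_add as_ sb' mono.
rewrite len !sub// /= sa sb !rtauE -EFinD xs => -[]; lra.
Qed.

(** Equality for three consecutive nodes makes the two adjacent pieces together a maximizer, so the
    concatenation of all pieces is a geodesic, and geodesics maximize. The induction keeps track of
    the last piece [[e, b]], to be joined with the next one. *)
Lemma midpoint_chain N (p : nat -> X) :
  (forall i, (i < N)%N -> timelike (p i) (p i.+1)) ->
  (forall i, (i.+1 < N)%N ->
    rtau (p i) (p i.+2) = rtau (p i) (p i.+1) + rtau (p i.+1) (p i.+2)) ->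
  rtau (p 0%N) (p N) = \sum_(i < N) rtau (p i) (p i.+1).
Proof.
case: N => [|N] tp mid; first by rewrite big_ord0 rtauxx.
suff : forall n, (n < N.+1)%N -> exists sigma a e b, [/\ a <= e < b,
    timelike_curve Future `[a, b] sigma, geodesic Future sigma a b,
    timelike_curve Future `[e, b] sigma /\ maximizer Future sigma e b &
    [/\ sigma a = p 0%N, sigma e = p n, sigma b = p n.+1 &
    length Future sigma a b = (\sum_(i < n.+1) rtau (p i) (p i.+1))%:E]].
  move=> /(_ N (ltnSn N))[sigma [a [e [b [_ ts gs _ [sa _ sb len]]]]]].
  have [_] := geodesic_maximizer ts gs.
  by rewrite len /= sa sb rtauE => -[].
elim=> [|n IH] nN.
  have [sigma [ts mx s0 s1]] := exists_timelike_maximizer hlength hhyperbolic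
    hconcave hregular (tp 0%N nN) (@ltr01 R).
  exists sigma, 0, 0, 1; split=> //; first by rewrite lexx ltr01.
    exact: maximizer_geodesic.
  split=> //; have [_ ->] := mx.
  by rewrite /= s0 s1 rtauE big_ord_recr big_ord0 /= add0r.
have [sigma1 [a [e [b [/andP[ae eb] ts1 gs1 [tse mx1] [s1a s1e s1b len1]]]]]] :=
  IH (ltnW nN).
have bb1 : b < b + 1 by rewrite ltrDl.
have [sigma2 [ts2 mx2 s2b s2c]] := exists_timelike_maximizer hlength hhyperbolic
  hconcave hregular (tp n.+1 nN) bb1.
have ab := le_lt_trans ae eb.
have e12 : sigma1 b = sigma2 b by rewrite s1b s2b.
set sigma := paste b sigma1 sigma2.
have ts : timelike_curve Future `[a, b + 1] sigma :=
  paste_directed (fun u v w => @timelike_dir_trans _ X Future v u w)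
  (ltW ab) (ltW bb1) e12 ts1 ts2.
have sL t : t <= b -> sigma t = sigma1 t by move=> tb; rewrite /sigma pasteL.
have sR t : b <= t -> sigma t = sigma2 t by move=> bt; rewrite /sigma pasteR.
have [tsE lenE] := paste_maximizer (tp n (ltnW nN)) (tp n.+1 nN) tse ts2 mx1 mx2
  s1e s1b s2b s2c.
have mxE : maximizer Future sigma e (b + 1).
  split; first exact: timelike_curve_causal.
  by rewrite lenE /= (sL e (ltW eb)) sR ?(ltW bb1)// s1e s2c rtauE mid.
have mx2' : maximizer Future sigma b (b + 1).
  by apply: eq_maximizer mx2 => t /andP[bt _]; rewrite sR.
exists sigma, a, b, (b + 1); split.
- by rewrite (ltW ab).
- exact: ts.
- split; first exact: timelike_curve_causal.
  move=> t /itvccP/andP[at_ tb1]; have [bt|tb] := leP b t.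
    exists e, (b + 1); split=> //.
      by move=> u /itvccP/andP[eu ub]; apply/itvccP; rewrite ub (le_trans ae).
    have et := lt_le_trans eb bt.
    have : \forall u \near t, e < u by exact: lt_nbhsr.
    rewrite /within /=; apply: filterS => u eu /itvccP/andP[au ub].
    by apply/itvccP; rewrite ub ltW.
  have tI : `[a, b]%classic t by apply/itvccP; rewrite at_ ltW.
  have [_ loc] := gs1; have [c' [d' [sub nb mx]]] := loc t tI.
  exists c', d'; split.
  + move=> u /sub/itvccP/andP[au ub]; apply/itvccP.
    by rewrite au (le_trans ub)// ltW.
  + have h : \forall u \near t, u < b by exact: lt_nbhsl.
    move: nb; rewrite /within /=; apply: filterS2 h => u ub h /itvccP/andP[au _].
    by apply: h; apply/itvccP; rewrite au ltW.
  + apply: eq_maximizer mx => u ucd; rewrite sL//.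
    by have /itvccP/sub/itvccP/andP[] := ucd.
- by split=> //; apply: eq_directed_curve ts2 => t /andP[bt _]; rewrite sR.
- split; [by rewrite sL// ltW|by rewrite sL|by rewrite sR// ltW|].
  rewrite (length_add (ltW ab) (ltW bb1)); last first.
    exact: causal_curve_monotone (timelike_curve_causal ts).
  rewrite (@eq_length _ _ _ sigma sigma1 a b); last by move=> t /andP[_ ?]; rewrite sL.
  have [_ ->] := mx2'; rewrite len1 /= sL// sR ?(ltW bb1)// s1b s2c rtauE.
  by rewrite [in RHS]big_ord_recr EFinD.
Qed.

Lemma segment_uniform_continuity x y gamma : maximizing_segment x y gamma ->
  forall e : R, 0 < e -> exists2 d : R, 0 < d & forall s t, 0 <= s <= 1 ->
    0 <= t <= 1 -> `|s - t| < d -> mdist (gamma s) (gamma t) < e.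
Proof.
move=> [[_ [sigma [c [d [ts _ [_ [phi [mono cont p0 p1 gs]]]]]]]] _ _] e e0.
have [[_ lip _] _] := ts; have scont := locally_lipschitz_continuous lip.
have pI t : `[0, 1]%classic t -> `[c, d]%classic (phi t).
  move=> t01; have /itvccP/andP[t0 t1] := t01.
  have i0 : (0 : R) \in `[0, 1] by apply/itvccP; rewrite lexx ler01.
  have i1 : (1 : R) \in `[0, 1] by apply/itvccP; rewrite lexx ler01.
  by apply/itvccP; rewrite -p0 -p1 !mono.
have loc (t : R^o) : exists2 r : R, 0 < r & forall s : R^o, mdist t s < r ->
    forall u v, 0 <= u <= 1 -> 0 <= v <= 1 -> `|s - u| < r -> `|s - v| < r ->
    mdist (gamma u) (gamma v) < e.
  (* [lebesgue_number] asks for a radius at every real [t]; off the interval, a ball that misses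
     [[0, 1]] makes the condition vacuous. *)
  have [t01|nt01] := pselect (0 <= t <= 1); last first.
    have : exists2 r : R, 0 < r & forall u : R, 0 <= u <= 1 -> r <= `|t - u|.
      have [t0|t0] := ltP t 0.
        exists (- t); first by rewrite oppr_gt0.
        by move=> u /andP[u0 u1]; rewrite ler0_norm; lra.
      have [t1|t1] := ltP 1 t; last by case: nt01; rewrite t0 t1.
      exists (t - 1); first by rewrite subr_gt0.
      by move=> u /andP[u0 u1]; rewrite ger0_norm; lra.
    move=> [r r0 hr]; exists (r / 2); first by rewrite divr_gt0.
    move=> s ts' u v /hr ru _ su _; exfalso.
    have := ler_distD s t u; rewrite {1}/mdist /= in ts'.
    by rewrite (distrC t s) => h; lra.
  have tI : `[0, 1]%classic t by exact/itvccP.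
  have /subspace_continuousP/(_ _ tI) h1 := cont.
  have /subspace_continuousP/(_ _ (pI _ tI)) h2 := scont.
  have e20 : 0 < e / 2 by rewrite divr_gt0.
  have /metricType_numDomainType.cvgrPdist_lt/(_ _ e20) h2' := h2.
  rewrite near_withinE in h2'; have := h1 _ h2'; rewrite /= /within /=.
  move=> /nbhs_ballP[r /= r0 hr].
  exists (r / 2); first by rewrite divr_gt0.
  move=> s ts' u v u01 v01 su sv; rewrite {1}/mdist /= in ts'.
  have tri w : `|s - w| < r / 2 -> ball t r w.
    move=> sw; rewrite /ball /=; have := ler_distD s t w.
    by rewrite (distrC t s) => h; lra.
  have uI : `[0, 1]%classic u by exact/itvccP.
  have vI : `[0, 1]%classic v by exact/itvccP.
  have hu := hr u (tri _ su) uI (pI _ uI); have hv := hr v (tri _ sv) vI (pI _ vI).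
  rewrite !gs//; apply: le_lt_trans (metric_triangle _ (sigma (phi t)) _) _.
  rewrite metric_sym; move: hu hv; rewrite /from_subspace => hu hv; lra.
have [|r r0 hr] := @lebesgue_number R R^o `[0, 1] (fun s r =>
    forall u v, 0 <= u <= 1 -> 0 <= v <= 1 -> `|s - u| < r -> `|s - v| < r ->
    mdist (gamma u) (gamma v) < e) (@segment_compact R 0 1) _ loc.
  move=> s r r' r'r h u v u01 v01 su sv.
  by apply: h => //; exact: lt_le_trans r'r.
exists r => // s t s01 t01 st.
have sI : `[0, 1]%classic s by exact/itvccP.
by apply: (hr s sI) => //; rewrite subrr normr0.
Qed.

End UniqueGeodesics.

(** * From local to global concavity *)

Lemma near_all_ord (N : nat) (P : nat -> nat -> Prop) :
  (forall i, (i < N)%N -> \forall n \near \oo, P n i) ->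
  \forall n \near \oo, forall i, (i < N)%N -> P n i.
Proof.
elim: N => [|N IH] h; first by apply: nearW.
have h1 := h N (ltnSn N); have h2 := IH (fun i iN => h i (ltnW iN)).
apply: filterS2 h1 h2 => n h1 h2 i; rewrite ltnS leq_eqVlt => /predU1P[->//|].
exact: h2.
Qed.

(** * Inequalities for finite sequences of reals *)

Section RealSums.
Context {R : realType}.
Implicit Types (f l : nat -> R) (A T : R) (N : nat).

(** Equality case of Jensen's inequality for [x |-> (A - x)^2], which decreases
    on [x <= A]. *)
Lemma sum_sqr_rigid l A T N : T / N%:R < A ->
  \sum_(i < N) (A - l i) ^+ 2 <= N%:R * (A - T / N%:R) ^+ 2 ->
  \sum_(i < N) l i <= T -> forall i, (i < N)%N -> l i = T / N%:R.
Proof.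
set c := T / N%:R => cA hE hS i iN.
have N0 : (0 : R) < N%:R by rewrite ltr0n (leq_ltn_trans _ iN).
have cN : c * N%:R = T by rewrite divfK// gt_eqF.
have e2 j : (l j - c) ^+ 2 = (A - l j) ^+ 2 + (2 * (A - c) * l j - (A - c) ^+ 2
  - 2 * (A - c) * c) by ring.
have : \sum_(j < N) (l j - c) ^+ 2 <= 0.
  under eq_bigr do rewrite e2.
  rewrite big_split /= !sumrB -mulr_sumr !sumr_const !card_ord.
  rewrite -[_ ^+ 2 *+ N]mulr_natr -[_ * c *+ N]mulr_natr.
  have A0 : 0 <= 2 * (A - c) by rewrite mulr_ge0// subr_ge0 ltW.
  have h1 := ler_wpM2l A0 hS; rewrite -cN in h1; lra.
have pos (j : 'I_N) : true -> 0 <= (l j - c) ^+ 2 by rewrite sqr_ge0.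
rewrite le_eqVlt ltNge sumr_ge0 ?orbF// => /eqP /(psumr_eq0P pos)/(_ (Ordinal iN) isT).
by move=> /eqP; rewrite sqrf_eq0 subr_eq0 => /eqP.
Qed.

(** With [g j = f j - f 0], midpoint concavity makes [g j / j] nonincreasing; its values at [i] and
    at [N] are compared. *)
Lemma discrete_concave f N :
  (forall i, (i.+1 < N)%N -> (f i + f i.+2) / 2 <= f i.+1) ->
  forall i, (i <= N)%N ->
    (1 - i%:R / N%:R) * f 0%N + i%:R / N%:R * f N <= f i.
Proof.
move=> conc i iN; have [N0|N0] := posnP N.
  have -> : i = 0%N by move: iN; rewrite N0 leqn0 => /eqP.
  by rewrite mul0r subr0 mul1r mul0r addr0.
pose g j := f j - f 0%N.
have step j : (j < N)%N -> j%:R * g j.+1 <= j.+1%:R * g j.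
  elim: j => [|j IH] jN; first by rewrite /g mul0r subrr mulr0.
  have h1 := IH (ltnW jN).
  have h2 : g j + g j.+2 <= 2 * g j.+1 by have := conc j jN; rewrite /g; lra.
  have h3 := ler_wpM2l (ler0n R j.+1) h2.
  by move: h1 h3; rewrite -[j.+2%:R]natr1 -[j.+1%:R]natr1; lra.
have far j k : (0 < j)%N -> (j + k <= N)%N -> j%:R * g (j + k)%N <= (j + k)%:R * g j.
  move=> j0; elim: k => [|k IH]; rewrite ?addn0// addnS => jkN.
  have h1 := IH (ltnW jkN); have h2 := step _ jkN.
  have p : (0 : R) < (j + k)%:R by rewrite ltr0n addn_gt0 j0.
  rewrite -(ler_pM2l p).
  have h3 := ler_wpM2l (ler0n R (j + k).+1) h1.
  have h4 := ler_wpM2l (ler0n R j) h2; lra.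
have [->|i0] := posnP i; first by rewrite mul0r subr0 mul1r mul0r addr0.
have h := far i (N - i)%N i0; rewrite subnKC// /g in h; have {}h := h (leqnn N).
have N0' : (0 : R) < N%:R by rewrite ltr0n.
rewrite -(ler_pM2l N0'); set q := i%:R / N%:R.
have qN : N%:R * q = i%:R by rewrite mulrC divfK// gt_eqF.
by rewrite -qN in h; lra.
Qed.

Lemma sum_change_two (F G : nat -> R) N i : (i.+1 < N)%N ->
  (forall j, (j < N)%N -> j != i -> j != i.+1 -> F j = G j) ->
  \sum_(j < N) F j - \sum_(j < N) G j = F i + F i.+1 - (G i + G i.+1).
Proof.
move=> iN FG.
have h (H : nat -> R) : \sum_(j < N) H j = H i + H i.+1 +
    \sum_(j < N | (j != i :> nat) && (j != i.+1 :> nat)) H j.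
  rewrite (bigD1 (Ordinal (ltnW iN))) //= (bigD1 (Ordinal iN)) /=; last first.
    by rewrite -val_eqE /= neq_ltn ltnSn orbT.
  by rewrite addrA.
rewrite !h; rewrite (eq_bigr (fun j : 'I_N => G j)); first by ring.
by move=> j /andP[ji jSi]; exact: FG.
Qed.

End RealSums.

(** * Concavity for nearby, then for arbitrary, endpoints *)

Section Concavity.
Context {R : realType} {X : lorentzianPreLengthSpace R}.
Context (hlength : lorentzian_length_space X).
Context (hhyperbolic : globally_hyperbolic X).
Context (hconcave : locally_concave X).
Context (hregular : regular X).
Context (hunique : forall x y : X, timelike x y -> unique_timelike_geodesic x y).
Context (geo : X -> X -> R -> X).
Context (geoP : forall x y, timelike x y -> maximizing_segment x y (geo x y)).
Implicit Types (x y z m a b : X) (U : set X) (s t : R) (N i : nat).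

Let rtauxx := rtauxx hlength.
Let rtauE := rtauE hlength hhyperbolic hconcave.
Let rtau_gt0 := rtau_gt0 hlength hhyperbolic hconcave.
Let rtau_triangle := rtau_triangle hlength hhyperbolic hconcave.
Let causal_chain_le := causal_chain_le hlength hhyperbolic hconcave.
Let rtau_cvg := rtau_cvg hlength hhyperbolic hconcave.
Let causal_closed := causal_closed hlength hhyperbolic hconcave.

Lemma causal_xx x : causal x x. Proof. exact: (causal_dirxx Future). Qed.

Lemma causal_tr y x z : causal x y -> causal y z -> causal x z.
Proof. exact: (@causal_dir_trans _ X Future). Qed.

Lemma timelikeW x y : timelike x y -> causal x y.
Proof. exact: (timelike_dir_causal (o := Future)). Qed.

(** The relation under which [comparison_set] compares endpoints; a causal relation with vanishing
    [tau] between distinct points does not suffice. *)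
Definition precedes x y := timelike x y \/ x = y.

Lemma precedesW x y : precedes x y -> causal x y.
Proof. by move=> [/timelikeW//|->]; exact: causal_xx. Qed.

Lemma geo0 x y : timelike x y -> geo x y 0 = x.
Proof. by case/geoP. Qed.

Lemma geo1 x y : timelike x y -> geo x y 1 = y.
Proof. by case/geoP. Qed.

Lemma geo_line x y : timelike x y -> line Future (geo x y).
Proof.
by case/geoP => tm _ _; exact: (timelike_maximizer_line hlength hhyperbolic hconcave).
Qed.

Lemma geo_causal x y s t : timelike x y -> 0 <= s -> s <= t -> t <= 1 ->
  causal (geo x y s) (geo x y t).
Proof. by move=> xy s0 st t1; have [_ /(_ s t s0 st t1)[]] := geo_line xy. Qed.

Lemma rtau_geo x y s t : timelike x y -> 0 <= s -> s <= t -> t <= 1 ->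
  rtau (geo x y s) (geo x y t) = (t - s) * rtau x y.
Proof.
move=> xy s0 st t1; have [_ /(_ s t s0 st t1)[_]] := geo_line xy.
by rewrite /= geo0// geo1.
Qed.

Lemma geo_timelike x y s t : timelike x y -> 0 <= s -> s < t -> t <= 1 ->
  timelike (geo x y s) (geo x y t).
Proof.
move=> xy s0 st t1; apply/rtau_gt0; rewrite rtau_geo// ?ltW// mulr_gt0 ?subr_gt0//.
exact/rtau_gt0.
Qed.

Lemma geo_unique x y m t : timelike x y -> causal x m -> causal m y ->
  0 < t < 1 -> rtau x m = t * rtau x y -> rtau m y = (1 - t) * rtau x y ->
  m = geo x y t.
Proof.
move=> xy; exact: (midpoint_unique hlength hhyperbolic hconcave hregular hunique
  (geoP xy) xy).
Qed.

Lemma line_geo (alpha : R -> X) t : line Future alpha -> 0 <= t <= 1 ->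
  alpha t = geo (alpha 0) (alpha 1) t.
Proof.
move=> [xy h] /andP[]; rewrite le_eqVlt => /predU1P[<- _|t0]; first by rewrite geo0.
rewrite le_eqVlt => /predU1P[->|t1]; first by rewrite geo1.
have [c0 h0] := h 0 t (lexx _) (ltW t0) (ltW t1).
have [c1 h1] := h t 1 (ltW t0) (ltW t1) (lexx _).
by apply: geo_unique => //; [rewrite t0|move: h0 => /= ->; rewrite subr0].
Qed.

Lemma geo_sub x y s t (l : R) : timelike x y -> 0 <= s -> s < t -> t <= 1 ->
  0 <= l <= 1 ->
  geo (geo x y s) (geo x y t) l = geo x y (s + l * (t - s)).
Proof.
move=> xy s0 st t1 l01; have st' := geo_timelike xy s0 st t1.
pose alpha u := geo x y (s + u * (t - s)).
have ts : 0 < t - s by rewrite subr_gt0.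
have a0 : alpha 0 = geo x y s by rewrite /alpha mul0r addr0.
have a1 : alpha 1 = geo x y t by rewrite /alpha mul1r addrC subrK.
have la : line Future alpha.
  split; first by rewrite a0 a1.
  move=> u v u0 uv v1.
  have h1 : 0 <= s + u * (t - s) by rewrite addr_ge0// mulr_ge0// ltW.
  have h2 : s + u * (t - s) <= s + v * (t - s) by rewrite lerD2l ler_pM2r.
  have h3 : s + v * (t - s) <= 1 by nra.
  split; first exact: geo_causal.
  by rewrite /= a0 a1 /alpha !rtau_geo// ?ltW//; ring.
by rewrite -a0 -a1 -line_geo.
Qed.

Lemma local_concave U a b a' b' (l : R) : comparison_set U ->
  U a -> U b -> U a' -> U b' -> timelike a b -> timelike a' b' ->
  precedes a a' -> precedes b b' -> 0 <= l <= 1 ->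
  l * rtau b b' + (1 - l) * rtau a a' <= rtau (geo a b l) (geo a' b' l).
Proof.
move=> cU Ua Ub Ua' Ub' ab ab' aa' bb' l01.
have [_ _ conc] := cU; have [tm1 g10 g11] := geoP ab; have [tm2 g20 g21] := geoP ab'.
have inU u v : U u -> U v -> timelike u v -> geo u v @` `[0, 1] `<=` U.
  move=> Uu Uv uv _ [r /itvccP r01 <-].
  exact: (segment_in_comparison_set hlength hhyperbolic hconcave hregular hunique
    cU Uu Uv uv (geoP uv)).
have := conc Future _ _ tm1 tm2 (inU _ _ Ua Ub ab) (inU _ _ Ua' Ub' ab').
rewrite g10 g11 g20 g21 => /(_ aa' bb' l ((itvccP _ _ _).2 l01)).
by rewrite !rtauE -!EFinM -EFinD lee_fin.
Qed.

Lemma causal_sub_chain N (p : nat -> X) i :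
  (forall j, (j < N)%N -> causal (p j) (p j.+1)) -> (i <= N)%N ->
  [/\ causal (p 0%N) (p i), causal (p i) (p N),
    \sum_(j < i) rtau (p j) (p j.+1) <= rtau (p 0%N) (p i) &
    \sum_(j < N - i) rtau (p (i + j)%N) (p (i + j).+1) <= rtau (p i) (p N)].
Proof.
move=> h iN.
have [|c1 s1] := @causal_chain_le i p.
  by move=> j ji; apply: h; exact: leq_trans iN.
have [|c2 s2] := @causal_chain_le (N - i) (fun j => p (i + j)%N).
  by move=> j ji; rewrite addnS; apply: h; rewrite -ltn_subRL.
rewrite addn0 subnKC// in c2 s2; split=> //.
by apply: le_trans s2; rewrite le_eqVlt; apply/orP; left; apply/eqP/eq_bigr => j _;
  rewrite addnS.
Qed.

(** The partial sums bound the separations of [p i] from both ends from below, and these bounds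
    already add up to the total. Equality holds in both, and [geo_unique] applies. *)
Lemma equidistant_geo N (p : nat -> X) : (0 < N)%N ->
  (forall j, (j < N)%N -> causal (p j) (p j.+1)) -> timelike (p 0%N) (p N) ->
  (forall j, (j < N)%N -> rtau (p j) (p j.+1) = rtau (p 0%N) (p N) / N%:R) ->
  forall i, (i <= N)%N -> p i = geo (p 0%N) (p N) (i%:R / N%:R).
Proof.
move=> N0 h tp hl i iN; set S := rtau (p 0%N) (p N) in hl.
have NR : (0 : R) < N%:R by rewrite ltr0n.
have [->|i0] := posnP i; first by rewrite mul0r geo0.
move: (iN); rewrite leq_eqVlt => /predU1P[->|iN'].
  by rewrite divff ?geo1// gt_eqF.
have [c1 c2] := causal_sub_chain h iN.
rewrite (eq_bigr (fun=> S / N%:R)); last first.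
  by move=> j _; apply: hl; exact: leq_trans (ltn_ord j) iN.
rewrite [X in _ -> X <= _ -> _](eq_bigr (fun=> S / N%:R)); last first.
  by move=> j _; apply: hl; rewrite -ltn_subRL.
rewrite !sumr_const !card_ord -[_ *+ i]mulr_natr -[_ *+ (N - i)]mulr_natr natrB//.
have := rtau_triangle c1 c2; rewrite -/S => tri h1 h2.
have SN : S / N%:R * N%:R = S by rewrite divfK// gt_eqF.
have e1 : i%:R / N%:R * S = S / N%:R * i%:R by ring.
apply: geo_unique => //.
- by rewrite divr_gt0 ?ltr0n//= ltr_pdivrMr// mul1r ltr_nat.
- by rewrite -/S e1; lra.
- by rewrite -/S mulrBl mul1r e1; lra.
Qed.

(** [N%:R * (A - rtau x y / N%:R) ^+ 2] is the least possible sum for chains from [x] to [y]. Chains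
    whose endpoints tend to [x], [y] and whose sums tend to at most this value subconverge to a
    chain with equal steps, by [sum_sqr_rigid], and so to the nodes of the segment. *)
Lemma near_config x y N (A r : R) : timelike x y -> (0 < N)%N ->
  rtau x y / N%:R < A -> 0 < r -> exists2 d : R, 0 < d &
  forall x' y' (p : nat -> X), mdist x x' < d -> mdist y y' < d ->
    p 0%N = x' -> p N = y' -> (forall i, (i < N)%N -> causal (p i) (p i.+1)) ->
    \sum_(i < N) (A - rtau (p i) (p i.+1)) ^+ 2 <=
      N%:R * (A - rtau x y / N%:R) ^+ 2 + d ->
    (forall i, (i < N.+1)%N -> mdist (geo x y (i%:R / N%:R)) (p i) < r) /\
    (forall i, (i < N)%N -> 0 < rtau (p i) (p i.+1)).
Proof.
move=> xy N0 hA r0; apply/not_exists2P => hd; set T := rtau x y.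
have NR : (0 : R) < N%:R by rewrite ltr0n.
have T0 : 0 < T by exact/rtau_gt0.
have [K [_ [_ [[cK _ _ _] [r1 r10 JK]]]]] :=
  near_chain_scale hlength hhyperbolic hconcave x y.
pose E (p : nat -> X) : R := \sum_(i < N) (A - rtau (p i) (p i.+1)) ^+ 2.
have bad (n : nat) : exists p : nat -> X, [/\ [/\ mdist x (p 0%N) < n.+1%:R^-1,
    mdist y (p N) < n.+1%:R^-1 & forall i, (i < N.+1)%N -> K (p i)],
    forall i, (i < N)%N -> causal (p i) (p i.+1),
    E p <= N%:R * (A - T / N%:R) ^+ 2 + n.+1%:R^-1 &
    ~ ((forall i, (i < N.+1)%N -> mdist (geo x y (i%:R / N%:R)) (p i) < r) /\
      (forall i, (i < N)%N -> 0 < rtau (p i) (p i.+1)))].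
  have m0 : 0 < Num.min n.+1%:R^-1 r1 by rewrite lt_min r10 invr_gt0 ltr0n.
  have [//|] := hd (Num.min n.+1%:R^-1 r1).
  move=> /existsNP[x' /existsNP[y' /existsNP[p /not_implyP[xx' /not_implyP[yy']]]]].
  move=> /not_implyP[p0 /not_implyP[pN /not_implyP[cp /not_implyP[Ep np]]]].
  move: xx' yy'; rewrite !lt_min => /andP[xx1 xx2] /andP[yy1 yy2].
  exists p; split=> //.
    rewrite p0 pN; split=> // i iN; apply: (JK x' y') => //.
    by have [] := causal_sub_chain cp iN; rewrite p0 pN; split.
  by apply: le_trans Ep _; rewrite lerD2l ge_min lexx.
have {hd bad} [p hp] := choice bad.
have [|q [f [nf _ fq]]] := @compact_subseq_fin R X K N.+1 p cK.
  by move=> n i iN; have [[_ _ h] _ _ _] := hp n; exact: h.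
have lim0 : (fun n => p (f n) 0%N) @ \oo --> x.
  apply: (cvg_mdist_sub nf (u := fun n => p n 0%N)).
  by apply: cvg_mdist_lt_inv => n; have [[]] := hp n.
have limN : (fun n => p (f n) N) @ \oo --> y.
  apply: (cvg_mdist_sub nf (u := fun n => p n N)).
  by apply: cvg_mdist_lt_inv => n; have [[]] := hp n.
have q0 : q 0%N = x by apply: (cvg_unique (@metric_hausdorff _ X) (fq 0%N isT) lim0).
have qN : q N = y by apply: (cvg_unique (@metric_hausdorff _ X) (fq N (ltnSn N)) limN).
have cq i : (i < N)%N -> causal (q i) (q i.+1).
  move=> iN; apply: causal_closed (fq i (ltnW iN)) (fq i.+1 iN) => n.
  by have [_ h _ _] := hp (f n); exact: h.
have lc i : (i < N)%N ->
    (fun n => rtau (p (f n) i) (p (f n) i.+1)) @ \oo --> rtau (q i) (q i.+1).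
  by move=> iN; apply: rtau_cvg; [exact: fq (ltnW iN)|exact: fq].
have Elim : (fun n => E (p (f n))) @ \oo --> E q.
  apply: (@cvg_sum_ord _ _ (fun i n => (A - rtau (p (f n) i) (p (f n) i.+1)) ^+ 2)
    (fun i => (A - rtau (q i) (q i.+1)) ^+ 2)) => i iN.
  rewrite expr2; under eq_cvg do rewrite expr2.
  by apply: cvgM; apply: cvgB (lc i iN); exact: cvg_cst.
have Eq : E q <= N%:R * (A - T / N%:R) ^+ 2.
  have l2 : (fun n => N%:R * (A - T / N%:R) ^+ 2 + n.+1%:R^-1) @ \oo -->
      N%:R * (A - T / N%:R) ^+ 2.
    rewrite -[X in _ --> X]addr0; apply: cvgD; first exact: cvg_cst.
    exact: cvg_harmonic.
  apply: (ler_cvg_to Elim l2); apply: nearW => n.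
  have [_ _ h _] := hp (f n); apply: le_trans h _; rewrite lerD2l.
  by rewrite lef_pV2 ?posrE// ler_nat ltnS.
have [_ sumq] := causal_chain_le cq; rewrite q0 qN in sumq.
have lq := @sum_sqr_rigid R (fun i => rtau (q i) (q i.+1)) A T N hA Eq sumq.
have geoq i : (i <= N)%N -> q i = geo x y (i%:R / N%:R).
  by move=> iN; rewrite -{1}q0 -qN; apply: equidistant_geo; rewrite ?q0 ?qN.
have near1 : \forall n \near \oo, forall i, (i < N.+1)%N ->
    mdist (geo x y (i%:R / N%:R)) (p (f n) i) < r.
  apply: near_all_ord => i iN; rewrite -geoq//.
  by have /metricType_numDomainType.cvgrPdist_lt/(_ _ r0) := fq i iN.
have near2 : \forall n \near \oo, forall i, (i < N)%N ->
    0 < rtau (p (f n) i) (p (f n) i.+1).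
  apply: near_all_ord => i iN; have := lc i iN; rewrite lq//.
  by move=> /cvgr_gt; apply; rewrite divr_gt0.
have /filter_ex[n [h1 h2]] : \forall n \near \oo, (forall i, (i < N.+1)%N ->
    mdist (geo x y (i%:R / N%:R)) (p (f n) i) < r) /\
    (forall i, (i < N)%N -> 0 < rtau (p (f n) i) (p (f n) i.+1)).
  by apply: filterS2 near1 near2 => n h1 h2; split.
by have [_ _ _] := hp (f n); apply.
Qed.

(** The bounds [c i] make the constraint closed, whereas [timelike (a i) (p i)] is open; the latter
    follows wherever [c i > 0]. *)
Definition config N x y (a : nat -> X) (c : nat -> R) (p : nat -> X) :=
  [/\ p 0%N = x, p N = y, forall i, (i < N)%N -> causal (p i) (p i.+1) &
    forall i, (i <= N)%N -> c i <= rtau (a i) (p i)].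

Lemma exists_minimal_config N x y (a : nat -> X) (c : nat -> R) (A : R) (p0 : nat -> X) :
  config N x y a c p0 -> exists2 p, config N x y a c p & forall q,
    config N x y a c q -> \sum_(i < N) (A - rtau (p i) (p i.+1)) ^+ 2 <=
      \sum_(i < N) (A - rtau (q i) (q i.+1)) ^+ 2.
Proof.
move=> cp0; pose E (p : nat -> X) : R := \sum_(i < N) (A - rtau (p i) (p i.+1)) ^+ 2.
have Ege0 p : 0 <= E p by apply: sumr_ge0 => i _; exact: sqr_ge0.
pose S := [set E p | p in config N x y a c].
have infS : has_inf S.
  split; first by exists (E p0), p0.
  by exists 0 => _ [p _ <-].
have appr (n : nat) : exists p, config N x y a c p /\ E p < inf S + n.+1%:R^-1.
  have n0 : 0 < n.+1%:R^-1 :> R by rewrite invr_gt0.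
  by have [_ [p cp <-] h] := inf_adherent n0 infS; exists p.
have [p hp] := choice appr.
have [cJ _] := hhyperbolic.
have [|q [f [nf _ fq]]] := @compact_subseq_fin R X (causal_diamond x y) N.+1 p (cJ x y).
  move=> n i iN; have [[p0' pN cp _] _] := hp n.
  by have [] := causal_sub_chain cp iN; rewrite p0' pN.
have eqlim i (z : X) : (i < N.+1)%N -> (forall n, p n i = z) -> q i = z.
  move=> iN h; apply: (cvg_unique (@metric_hausdorff _ X) (fq i iN)).
  rewrite (_ : (fun n => p (f n) i) = fun=> z); first exact: cvg_cst.
  by apply/funext => n; exact: h.
have lc i : (i < N)%N ->
    (fun n => rtau (p (f n) i) (p (f n) i.+1)) @ \oo --> rtau (q i) (q i.+1).
  by move=> iN; apply: rtau_cvg; [exact: fq (ltnW iN)|exact: fq].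
have Elim : (fun n => E (p (f n))) @ \oo --> E q.
  apply: (@cvg_sum_ord _ _ (fun i n => (A - rtau (p (f n) i) (p (f n) i.+1)) ^+ 2)
    (fun i => (A - rtau (q i) (q i.+1)) ^+ 2)) => i iN.
  rewrite expr2; under eq_cvg do rewrite expr2.
  by apply: cvgM; apply: cvgB (lc i iN); exact: cvg_cst.
exists q; last first.
  move=> p' cp'; apply: (@le_trans _ _ (inf S)); last first.
    by apply: ge_inf; [case: infS|exists p'].
  have l2 : (fun n => inf S + n.+1%:R^-1) @ \oo --> inf S.
    rewrite -[X in _ --> X]addr0; apply: cvgD; first exact: cvg_cst.
    exact: cvg_harmonic.
  apply: (ler_cvg_to Elim l2); apply: nearW => n.
  have [_ /ltW h] := hp (f n); apply: le_trans h _; rewrite lerD2l.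
  by rewrite lef_pV2 ?posrE// ler_nat ltnS.
split.
- by apply: eqlim => // n; have [[]] := hp n.
- by apply: eqlim => // n; have [[]] := hp n.
- move=> i iN; apply: causal_closed (fq i (ltnW iN)) (fq i.+1 iN) => n.
  by have [[_ _ h _] _] := hp (f n); exact: h.
- move=> i iN.
  have l : (fun n => rtau (a i) (p (f n) i)) @ \oo --> rtau (a i) (q i).
    by apply: rtau_cvg (fq i iN); exact: cvg_cst.
  apply: (ler_cvg_to (cvg_cst (c i)) l); apply: nearW => n.
  by have [[_ _ _ h] _] := hp (f n); exact: h.
Qed.

(** A comparison set around three consecutive nodes is what comparing the midpoint of two neighbours
    requires; the radius [r] leaves room for the nodes of a nearby chain. *)
Lemma segment_subdivision x y : timelike x y -> exists N (r : R),
  [/\ (1 < N)%N, 0 < r & forall i, (i <= N)%N -> exists2 U, comparison_set U &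
    forall j q, (j <= N)%N -> (j <= i.+1)%N -> (i <= j.+1)%N ->
    mdist (geo x y (j%:R / N%:R)) q < r -> U q].
Proof.
move=> xy; have [cJ _] := hhyperbolic.
have [r r0 hr] := lebesgue_number (cJ x y) (fun p r s h => good_scale_le h)
  (near_good_scale hlength hconcave).
have r20 : 0 < r / 2 by rewrite divr_gt0.
have [d d0 hd] := segment_uniform_continuity (geoP xy) r20.
(* One successor brings the mesh below [d], the other ensures [1 < N]. *)
pose N := (Num.truncn d^-1).+2; have NR : (0 : R) < N%:R by rewrite ltr0n.
have Nd : N%:R^-1 < d.
  rewrite -[d]invrK ltf_pV2 ?posrE ?invr_gt0//.
  by apply: lt_le_trans (truncnS_gt _) _; rewrite ler_nat.
exists N, (r / 2); split=> // i iN.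
have node j : (j <= N)%N -> 0 <= (j%:R / N%:R : R) <= 1.
  by move=> jN; rewrite divr_ge0//= ler_pdivrMr// mul1r ler_nat.
have [|[U cU hU] _ _] := hr (geo x y (i%:R / N%:R)).
  have /andP[i0 i1] := node i iN.
  by split; [rewrite -{1}(geo0 xy)|rewrite -{2}(geo1 xy)]; exact: geo_causal.
exists U => // j q jN ji ij jq; apply: hU.
apply: le_lt_trans (metric_triangle _ (geo x y (j%:R / N%:R)) _) _.
rewrite [ltRHS]splitr; apply: ltrD => //; apply: hd; [exact: node|exact: node|].
apply: le_lt_trans Nd; rewrite -mulrBl normrM [X in _ * X]ger0_norm; last first.
  by rewrite invr_ge0 ltW.
rewrite ler_piMl ?invr_ge0 ?(ltW NR)//.
have h1 : (j%:R : R) <= i%:R + 1 by rewrite natr1 ler_nat.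
have h2 : (i%:R : R) <= j%:R + 1 by rewrite natr1 ler_nat.
by rewrite ler_norml; apply/andP; split; lra.
Qed.

(** The nodes of the segment are shifted forward by a small parameter, so that
    the new nodes lie strictly in the future of the old ones. *)
Lemma shifted_chain x y N (h : R) : timelike x y -> (1 < N)%N -> 0 < h ->
  exists2 e : R, 0 < e & exists2 d : R, 0 < d & forall x' y', mdist x x' < d ->
    precedes y y' -> exists p : nat -> X, [/\ p 0%N = x', p N = y',
      forall i, (0 < i < N)%N -> e <= rtau (geo x y (i%:R / N%:R)) (p i) &
      forall i, (i < N)%N -> causal (p i) (p i.+1) /\
        rtau x y / N%:R - h <= rtau (p i) (p i.+1)].
Proof.
move=> xy N1 h0; set T := rtau x y.
have T0 : 0 < T by exact/rtau_gt0.
have NR : (0 : R) < N%:R by rewrite ltr0n ltnW.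
pose w : R := N%:R^-1; have w0 : 0 < w by rewrite invr_gt0.
have Nw : N%:R * w = 1 by rewrite divff// gt_eqF.
have TN : T / N%:R = T * w by [].
have nodeE j : j%:R / N%:R = j%:R * w :> R by [].
(* Shifting by [e] shortens the last step by [e * T <= h], and [e <= w / 2] keeps the shifted inner
   nodes before [y]. *)
pose e : R := Num.min (w / 2) (h / T).
have e0 : 0 < e by rewrite lt_min !divr_gt0.
have ew : e <= w / 2 by rewrite ge_min lexx.
have eT : e * T <= h by rewrite -ler_pdivlMr// ge_min lexx orbT.
(* The second bound keeps the separation from [x'] to the node at [w] positive, so that the first
   step is causal. *)
pose h' := Num.min h (T * w / 2).
have Tw0 : 0 < T * w by rewrite mulr_gt0.
have h'0 : 0 < h' by rewrite lt_min h0 divr_gt0.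
have h'h : h' <= h by rewrite ge_min lexx.
have h'T : h' <= T * w / 2 by rewrite ge_min lexx orbT.
have [d d0 hd] := rtau_lsc hlength hhyperbolic hconcave x (geo x y w) h'0.
exists (e * T); first by rewrite mulr_gt0.
exists d => // x' y' xx' /precedesW yy'.
have jw j : (0 : R) <= j%:R * w by rewrite mulr_ge0// ltW.
have jwN j : (j < N)%N -> j%:R * w + w <= 1.
  move=> jN; have jN' : (j.+1%:R : R) <= N%:R by rewrite ler_nat.
  by have := ler_wpM2r (ltW w0) jN'; rewrite Nw -natr1; lra.
exists (fun i => if i == 0%N then x' else if (i < N)%N then
  geo x y (i%:R * w + e) else y'); split=> //.
- by rewrite ltnn gtn_eqF ?(ltnW N1).
- move=> i /andP[i0 iN]; rewrite gtn_eqF// iN nodeE.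
  have := jwN i iN; have := jw i => a1 a2.
  by rewrite rtau_geo//; [rewrite -/T; lra|lra|lra].
move=> i iN; have := jwN i iN; have := jw i => a1 a2; rewrite TN.
have [i0|i0] := posnP i.
  rewrite i0 N1 /= mul1r.
  have w1 : w + e <= 1 by have := jwN 1%N N1; rewrite mul1r; lra.
  have := hd x' (geo x y w) xx'; rewrite mdistxx => /(_ d0) hx.
  rewrite -{1}(geo0 xy) rtau_geo// ?ltW// in hx; last by lra.
  rewrite subr0 -/T in hx.
  have tx : timelike x' (geo x y w) by apply/rtau_gt0; lra.
  have cw : causal (geo x y w) (geo x y (w + e)).
    by apply: geo_causal => //; lra.
  split; first exact: causal_tr (timelikeW tx) cw.
  apply: le_trans (rtau_triangle (timelikeW tx) cw).
  have := rtau_ge0 (geo x y w) (geo x y (w + e)); lra.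
rewrite gtn_eqF// iN; have [iN'|iN'] := ltnP i.+1 N.
  have a3 := jwN i.+1 iN'; rewrite -natr1 mulrDl mul1r in a3 *.
  split; first by apply: geo_causal => //; lra.
  by rewrite rtau_geo//; [rewrite -/T; lra|lra|lra|lra].
have iE : i.+1 = N by apply/eqP; rewrite eqn_leq iN iN'.
have a3 : i%:R * w + w = 1.
  have iR : i%:R + 1 = N%:R :> R by rewrite -iE natr1.
  by rewrite -[RHS]Nw -iR mulrDl mul1r.
have cy : causal (geo x y (i%:R * w + e)) y.
  by rewrite -{2}(geo1 xy); apply: geo_causal => //; lra.
split; first exact: causal_tr cy yy'.
apply: le_trans (rtau_triangle cy yy').
rewrite -{2}(geo1 xy) rtau_geo//; [|lra|lra].
by have := rtau_ge0 y y'; rewrite -/T; nra.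
Qed.

Lemma chain_step_le N (p : nat -> X) i :
  (forall j, (j < N)%N -> causal (p j) (p j.+1)) -> (i < N)%N ->
  rtau (p i) (p i.+1) <= rtau (p 0%N) (p N).
Proof.
move=> h iN; have [c1 c2 _ _] := causal_sub_chain h (ltnW iN).
have [_ c3 _ _] := causal_sub_chain h iN.
have := rtau_triangle c1 c2; have := rtau_triangle (h i iN) c3.
have := rtau_ge0 (p 0%N) (p i); have := rtau_ge0 (p i.+1) (p N); lra.
Qed.

(** Replacing one node by the midpoint of its neighbours does not increase the
    sum of [(A - l_i)^2]; for a minimal chain this is an equality, which forces
    the node to be the midpoint already. *)
Lemma minimal_config_midpoint N x y (a : nat -> X) (c : nat -> R) (A : R)
    (p : nat -> X) i :
  config N x y a c p -> (forall q, config N x y a c q ->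
    \sum_(j < N) (A - rtau (p j) (p j.+1)) ^+ 2 <=
    \sum_(j < N) (A - rtau (q j) (q j.+1)) ^+ 2) ->
  rtau x y <= A -> (i.+1 < N)%N -> timelike (p i) (p i.+2) ->
  c i.+1 <= rtau (a i.+1) (geo (p i) (p i.+2) (1 / 2)) ->
  rtau (p i) (p i.+1) = rtau (p i) (p i.+2) / 2 /\
  rtau (p i.+1) (p i.+2) = rtau (p i) (p i.+2) / 2.
Proof.
move=> [p0 pN cp clow] pmin xyA iN tii hm.
set m := geo (p i) (p i.+2) (1 / 2) in hm; set L := rtau (p i) (p i.+2).
have half : 0 <= (1 / 2 : R) <= 1 by apply/andP; split; lra.
have /andP[half0 half1] := half.
have pim : causal (p i) m.
  by rewrite -[p i](geo0 tii); exact: geo_causal.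
have mpi : causal m (p i.+2).
  by rewrite -[p i.+2](geo1 tii); exact: geo_causal.
have rim : rtau (p i) m = L / 2.
  by rewrite -[p i](geo0 tii) rtau_geo// -/L; ring.
have rmi : rtau m (p i.+2) = L / 2.
  by rewrite -[p i.+2](geo1 tii) rtau_geo// -/L; field.
pose q j := if j == i.+1 then m else p j.
have qi : q i = p i by rewrite /q ltn_eqF.
have qm : q i.+1 = m by rewrite /q eqxx.
have qi2 : q i.+2 = p i.+2 by rewrite /q gtn_eqF.
have cq : config N x y a c q.
  split.
  - by rewrite /q.
  - by rewrite /q gtn_eqF.
  - move=> j jN; have [->|ji] := eqVneq j i; first by rewrite qi qm.
    have [->|jSi] := eqVneq j i.+1; first by rewrite qm qi2.
    by rewrite /q eqSS (negPf ji) (negPf jSi); exact: cp.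
  - by move=> j jN; rewrite /q; case: eqP => [->//|_]; exact: clow.
have := pmin q cq; rewrite -subr_ge0.
rewrite (@sum_change_two _ (fun j => (A - rtau (q j) (q j.+1)) ^+ 2)
  (fun j => (A - rtau (p j) (p j.+1)) ^+ 2) N i iN); last first.
  by move=> j jN ji jSi; rewrite /q eqSS (negPf ji) (negPf jSi).
rewrite qi qm qi2 rim rmi.
have tri := rtau_triangle (cp i (ltnW iN)) (cp i.+1 iN); rewrite -/L in tri.
(* [L / 2] is the length of a step of the chain [q] from [x] to [y], hence at most [rtau x y]. *)
have LA : L / 2 <= A.
  have cqi : forall j, (j < N)%N -> causal (q j) (q j.+1) by have [] := cq.
  have := chain_step_le cqi (ltnW iN); rewrite qi qm rim.
  by have [-> -> _ _] := cq => h; lra.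
set l1 := rtau (p i) (p i.+1) in tri *; set l2 := rtau (p i.+1) (p i.+2) in tri *.
(* The left-hand side is the sum for [p] minus the sum for [q], which minimality makes nonpositive,
   minus [2 * (A - L / 2) * (L - (l1 + l2))]. *)
move=> h; have sq : (l1 - L / 2) ^+ 2 + (l2 - L / 2) ^+ 2 <= 0.
  have : 0 <= (A - L / 2) * (L - (l1 + l2)) by rewrite mulr_ge0 ?subr_ge0.
  by move: h; rewrite !expr2; lra.
have s1 := sqr_ge0 (l1 - L / 2); have s2 := sqr_ge0 (l2 - L / 2).
have z1 : (l1 - L / 2) ^+ 2 = 0 by apply/le_anti; rewrite s1 andbT; lra.
have z2 : (l2 - L / 2) ^+ 2 = 0 by apply/le_anti; rewrite s2 andbT; lra.
by split; apply/eqP; rewrite -subr_eq0 -sqrf_eq0; apply/eqP.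
Qed.

(** The core of the argument. The segment from [x'] to [y'] is not known in advance to be close to
    that from [x] to [y]; a minimal chain is close by construction, and turns out to lie on it. *)
Lemma local_concavity x y : timelike x y -> exists2 d : R, 0 < d &
  forall x' y', mdist x x' < d -> mdist y y' < d -> timelike x' y' ->
  precedes x x' -> precedes y y' -> forall t, 0 <= t <= 1 ->
  t * rtau y y' + (1 - t) * rtau x x' <= rtau (geo x y t) (geo x' y' t).
Proof.
move=> xy; set T := rtau x y; have T0 : 0 < T by exact/rtau_gt0.
have [N [r [N1 r0 sub]]] := segment_subdivision xy.
have N0 : (0 < N)%N by exact: ltnW.
have NR : (0 : R) < N%:R by rewrite ltr0n.
have NR0 : N%:R != 0 :> R by rewrite gt_eqF.
have TN : T / N%:R <= T by rewrite ler_pdivrMr// ler_peMr ?(ltW T0)// ler1n.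
(* [A] has to exceed [rtau x' y'], which is below [T + 1] for nearby endpoints. *)
pose A := T + 2; pose u := A - T / N%:R.
have u0 : 0 < u by rewrite /u /A; lra.
have TA : T / N%:R < A by rewrite -subr_gt0.
have [d1 d10 hd1] := near_config xy N0 TA r0.
(* Chosen so that [N * (u + h)^2 <= N * u^2 + d1], using [h^2 <= h]: a loss of [h] per step stays
   within the tolerance of [near_config]. *)
pose h : R := Num.min 1 (d1 / (N%:R * (2 * u + 1))).
have u1 : 0 < 2 * u + 1 by rewrite addr_gt0// mulr_gt0.
have h0 : 0 < h by rewrite lt_min ltr01 divr_gt0// mulr_gt0.
have h1 : h <= 1 by rewrite ge_min lexx.
have hd : h * (N%:R * (2 * u + 1)) <= d1.
  by rewrite -ler_pdivlMr ?mulr_gt0// ge_min lexx orbT.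
have [e e0 [d2 d20 hd2]] := shifted_chain xy N1 h0.
have [d3 d30 hd3] := rtau_usc hlength hhyperbolic hconcave x y (@ltr01 R).
exists (Num.min d1 (Num.min d2 d3)); first by rewrite !lt_min d10 d20 d30.
move=> x' y'; rewrite !lt_min => /and3P[x1 x2 x3] /and3P[y1 y2 y3] xy' px py t t01.
set D0 := rtau x x'; set D1 := rtau y y'.
have D00 : 0 <= D0 by exact: rtau_ge0.
have D10 : 0 <= D1 by exact: rtau_ge0.
have /andP[t0 t1] := t01.
(* If both separations vanish, the claim is trivial. Otherwise the bounds [c i] below are positive
   at all inner nodes. *)
have [Dz|Dpos] := leP (D0 + D1) 0.
  have z0 : D0 = 0 by apply/le_anti/andP; split=> //; lra.
  have z1 : D1 = 0 by apply/le_anti/andP; split=> //; lra.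
  by rewrite z0 z1 !mulr0 addr0 rtau_ge0.
have T'A : rtau x' y' <= A by have := hd3 _ _ x3 y3; rewrite /A -/T; lra.
(* The cap [e] makes the shifted chain admissible; interpolating affinely lets the midpoint
   comparison return the bound for [c i.+1] from those of its neighbours. *)
pose c0 := Num.min D0 e; pose c1 := Num.min D1 e.
have [c00 c10] : 0 <= c0 /\ 0 <= c1 by rewrite !le_min D00 D10 ltW.
have [c0D c1D] : c0 <= D0 /\ c1 <= D1 by rewrite !ge_min !lexx.
have [c0e c1e] : c0 <= e /\ c1 <= e by rewrite !ge_min !lexx !orbT.
have cpos : 0 < c0 \/ 0 < c1.
  have [D0p|D0z] := ltP 0 D0; first by left; rewrite lt_min D0p.
  by right; rewrite lt_min e0 andbT; lra.
pose q (i : nat) : R := i%:R / N%:R.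
pose c i := (1 - q i) * c0 + q i * c1.
have q0 : q 0%N = 0 by rewrite /q mul0r.
have qN : q N = 1 by rewrite /q divff.
have qS i : q i.+1 = q i + N%:R^-1 by rewrite /q -natr1 mulrDl mul1r.
have w0 : (0 : R) < N%:R^-1 by rewrite invr_gt0.
have q01 i : (i <= N)%N -> 0 <= q i <= 1.
  by move=> iN; rewrite divr_ge0//= ler_pdivrMr// mul1r ler_nat.
have q01s i : (0 < i)%N -> (i < N)%N -> 0 < q i < 1.
  by move=> i0 iN; rewrite divr_gt0 ?ltr0n//= ltr_pdivrMr// mul1r ltr_nat.
have ce i : (i <= N)%N -> c i <= e.
  by move=> /q01/andP[a0 a1]; rewrite /c; nra.
have c_gt0 i : (0 < i)%N -> (i < N)%N -> 0 < c i.
  move=> i0 iN; have /andP[a0 a1] := q01s i i0 iN; rewrite /c.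
  have a1' : 0 < 1 - q i by rewrite subr_gt0.
  case: cpos => cp.
    by have := mulr_gt0 a1' cp; have := mulr_ge0 (ltW a0) c10; lra.
  by have := mulr_gt0 a0 cp; have := mulr_ge0 (ltW a1') c00; lra.
pose a i := geo x y (q i).
have a0E : a 0%N = x by rewrite /a q0 geo0.
have aNE : a N = y by rewrite /a qN geo1.
have [p0 [p00 p0N p0e p0h]] := hd2 x' y' x2 py.
have cfg0 : config N x' y' a c p0.
  split=> //; first by move=> i /p0h[].
  move=> i iN; have [->|i0] := posnP i.
    by rewrite a0E p00 /c q0 subr0 mul1r mul0r addr0.
  move: (iN); rewrite leq_eqVlt => /predU1P[->|iN'].
    by rewrite aNE p0N /c qN subrr mul0r add0r mul1r.
  by apply: le_trans (ce i iN) _; apply: p0e; rewrite i0.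
have [p cfg pmin] := exists_minimal_config A cfg0.
have [pp0 ppN cp cle] := cfg.
have Ep : \sum_(i < N) (A - rtau (p i) (p i.+1)) ^+ 2 <= N%:R * u ^+ 2 + d1.
  apply: le_trans (pmin _ cfg0) _.
  apply: (@le_trans _ _ (\sum_(i < N) (u + h) ^+ 2)).
    apply: ler_sum => i _; have [ci li] := p0h i (ltn_ord i); rewrite -/T in li.
    have ch0 j : (j < N)%N -> causal (p0 j) (p0 j.+1) by move=> /p0h[].
    have := chain_step_le ch0 (ltn_ord i); rewrite p00 p0N => le.
    rewrite ler_sqr ?nnegrE; [rewrite /u; lra|lra|exact: addr_ge0 (ltW u0) (ltW h0)].
  rewrite sumr_const card_ord -[_ *+ N]mulr_natl.
  have hh : h * h <= h by rewrite ler_piMl// ltW.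
  have hhN := ler_wpM2l (ltW NR) hh.
  by move: hd hhN; rewrite !expr2; lra.
have [pnear ppos] := hd1 x' y' p x1 y1 pp0 ppN cp Ep.
have tp i : (i < N)%N -> timelike (p i) (p i.+1) by move=> /ppos/rtau_gt0.
have pre i : (i <= N)%N -> precedes (a i) (p i).
  move=> iN; have [->|i0] := posnP i; first by rewrite a0E pp0.
  move: (iN); rewrite leq_eqVlt => /predU1P[->|iN']; first by rewrite aNE ppN.
  by left; apply/rtau_gt0; exact: lt_le_trans (c_gt0 i i0 iN') (cle i iN).
have nodes i j : (i <= N)%N -> (j <= N)%N -> (j <= i.+1)%N -> (i <= j.+1)%N ->
    forall U, (forall j z, (j <= N)%N -> (j <= i.+1)%N -> (i <= j.+1)%N ->
      mdist (a j) z < r -> U z) -> U (a j) /\ U (p j).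
  move=> iN jN ji ij U hU; split; apply: (hU j) => //; first by rewrite mdistxx.
  exact: pnear.
have half : 0 <= (1 / 2 : R) <= 1 by apply/andP; split; lra.
have tpp i : (i.+1 < N)%N -> timelike (p i) (p i.+2).
  by move=> iN; apply: (timelike_causal_trans (tp i (ltnW iN))); exact: cp.
have conc i : (i.+1 < N)%N -> (rtau (a i) (p i) + rtau (a i.+2) (p i.+2)) / 2 <=
    rtau (a i.+1) (geo (p i) (p i.+2) (1 / 2)).
  move=> iN; have [U cU hU] := sub i.+1 (ltnW iN).
  have [Ua1 Up1] := nodes i.+1 i (ltnW iN) (ltnW (ltnW iN)) (leqW (leqnSn i)) (leqnn _) U hU.
  have [Ua2 Up2] := nodes i.+1 i.+2 (ltnW iN) iN (leqnn _) (leqW (leqnSn _)) U hU.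
  have /andP[qi0 _] := q01 i (ltnW (ltnW iN)); have /andP[_ qi1] := q01 i.+2 iN.
  have qlt : q i < q i.+2 by rewrite !qS; lra.
  have aE : a i.+1 = geo (a i) (a i.+2) (1 / 2).
    by rewrite /a geo_sub//; congr geo; rewrite !qS; field.
  have taa : timelike (a i) (a i.+2) by exact: geo_timelike.
  have := local_concave cU Ua1 Ua2 Up1 Up2 taa (tpp i iN)
    (pre i (ltnW (ltnW iN))) (pre i.+2 iN) half.
  by rewrite -aE; lra.
have mid i : (i.+1 < N)%N -> rtau (p i) (p i.+1) = rtau (p i) (p i.+2) / 2 /\
    rtau (p i.+1) (p i.+2) = rtau (p i) (p i.+2) / 2.
  move=> iN; apply: (minimal_config_midpoint cfg pmin T'A iN (tpp i iN)).
  apply: le_trans (conc i iN).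
  have := cle i (ltnW (ltnW iN)); have := cle i.+2 iN; rewrite /c !qS; lra.
have lconst i : (i < N)%N -> rtau (p i) (p i.+1) = rtau (p 0%N) (p 1%N).
  by elim: i => // i IH iN; have [e1 e2] := mid i iN; rewrite e2 -e1 IH// ltnW.
have tot : rtau x' y' = N%:R * rtau (p 0%N) (p 1%N).
  rewrite -pp0 -ppN (midpoint_chain hlength hhyperbolic hconcave hregular hunique tp).
    rewrite (eq_bigr (fun=> rtau (p 0%N) (p 1%N))); last first.
      by move=> i _; exact: lconst.
    by rewrite sumr_const card_ord mulr_natl.
  by move=> i iN; have [-> ->] := mid i iN; rewrite -splitr.
have pE i : (i <= N)%N -> p i = geo x' y' (q i).
  move=> iN; rewrite -pp0 -ppN; apply: equidistant_geo => //.
    by rewrite pp0 ppN.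
  move=> j jN; have -> : rtau (p 0%N) (p N) = N%:R * rtau (p 0%N) (p 1%N).
    by rewrite -tot pp0 ppN.
  by rewrite lconst// [RHS]mulrC mulKf.
(* Now that each node is the midpoint of its neighbours, midpoint concavity holds along the whole
   chain and yields the bound with [D0], [D1] in place of the capped [c0], [c1]. *)
have nodal i : (i <= N)%N -> (1 - q i) * D0 + q i * D1 <= rtau (a i) (p i).
  have := @discrete_concave R (fun i => rtau (a i) (p i)) N.
  rewrite a0E aNE pp0 ppN; apply=> {}i iN; apply: le_trans (conc i iN) _.
  have /andP[qi0 _] := q01 i (ltnW (ltnW iN)); have /andP[_ qi1] := q01 i.+2 iN.
  have qlt : q i < q i.+2 by rewrite !qS; lra.
  have -> : geo (p i) (p i.+2) (1 / 2) = p i.+1.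
    rewrite !pE ?(ltnW iN) ?(ltnW (ltnW iN))// geo_sub//.
    by congr geo; rewrite !qS; field.
  by [].
(* With [t = 1] set apart, the integer part of [t * N%:R] is an index [i < N], and [t] is compared
   between the nodes [i] and [i.+1]. *)
have [t_lt1|t_ge1] := ltP t 1; last first.
  have -> : t = 1 by apply/le_anti; rewrite t1.
  by rewrite subrr mul0r addr0 mul1r !geo1.
have tN0 : 0 <= t * N%:R by rewrite mulr_ge0// ltW.
pose i := Num.truncn (t * N%:R).
have /andP[ilo ihi] : i%:R <= t * N%:R < i.+1%:R by exact: truncn_itv.
have iN : (i < N)%N.
  by rewrite -(ltr_nat R); apply: le_lt_trans ilo _; rewrite gtr_pMl.
pose l := t * N%:R - i%:R.
have l01 : 0 <= l <= 1 by rewrite /l; rewrite -natr1 in ihi; apply/andP; split; lra.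
have tE : q i + l * (q i.+1 - q i) = t by rewrite qS /q /l; field.
have [U cU hU] := sub i (ltnW iN).
have [Ua1 Up1] := nodes i i (ltnW iN) (ltnW iN) (leqnSn _) (leqnSn _) U hU.
have [Ua2 Up2] := nodes i i.+1 (ltnW iN) iN (leqnn _) (leqW (leqnSn _)) U hU.
have /andP[qi0 _] := q01 i (ltnW iN); have /andP[_ qi1] := q01 i.+1 iN.
have qlt : q i < q i.+1 by rewrite qS; lra.
have taa : timelike (a i) (a i.+1) by exact: geo_timelike.
have := local_concave cU Ua1 Ua2 Up1 Up2 taa (tp i iN) (pre i (ltnW iN)) (pre i.+1 iN) l01.
rewrite {3}/a {3}/a (pE i (ltnW iN)) (pE i.+1 iN) !geo_sub// tE.
rewrite -(pE i (ltnW iN)) -(pE i.+1 iN); apply: le_trans.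
have n1 := nodal i (ltnW iN); have n2 := nodal i.+1 iN.
have /andP[l0 l1] := l01; have l1' : 0 <= 1 - l by rewrite subr_ge0.
have := lerD (ler_wpM2l l0 n2) (ler_wpM2l l1' n1).
apply: le_trans; rewrite le_eqVlt; apply/orP; left; apply/eqP.
by rewrite -{1 2}tE qS; field.
Qed.

(** A common interface to the segment from [a] to [b] and to the constant path when [a = b], so that
    an endpoint that stays fixed needs no separate treatment. *)
Definition timelike_path a b (w : R -> X) := [/\ w 0 = a, w 1 = b,
  forall s t, 0 <= s -> s < t -> t <= 1 ->
    precedes (w s) (w t) /\ rtau (w s) (w t) = (t - s) * rtau a b &
  forall e : R, 0 < e -> exists2 d : R, 0 < d & forall s t : R, 0 <= s <= 1 ->
    0 <= t <= 1 -> `|s - t| < d -> mdist (w s) (w t) < e].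

Lemma exists_timelike_path a b : precedes a b -> exists w, timelike_path a b w.
Proof.
move=> [ab|->].
  exists (geo a b); split; [exact: geo0|exact: geo1| |].
    move=> s t s0 st t1; split; first by left; exact: geo_timelike.
    by rewrite rtau_geo// ltW.
  by move=> e; exact: (segment_uniform_continuity (geoP ab)).
exists (fun=> b); split=> //.
  by move=> s t _ _ _; rewrite rtauxx mulr0; split=> //; right.
by move=> e e0; exists 1 => // s t _ _ _; rewrite mdistxx.
Qed.

Lemma timelike_path_causal a b w s t : timelike_path a b w ->
  0 <= s -> s <= t -> t <= 1 -> causal (w s) (w t).
Proof.
move=> [_ _ h _] s0; rewrite le_eqVlt => /predU1P[->|st] t1; first exact: causal_xx.
by have [/precedesW] := h s t s0 st t1.
Qed.

Lemma timelike_path_cvg a b w (u : nat -> R) (s : R) : timelike_path a b w ->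
  0 <= s <= 1 -> (forall n, 0 <= u n <= 1) ->
  u @ \oo --> s -> (fun n => w (u n)) @ \oo --> w s.
Proof.
move=> [_ _ _ cont] s01 u01 us.
apply/metricType_numDomainType.cvgrPdist_lt => e /cont[d d0 hd].
have /cvgrPdist_lt/(_ _ d0) := us.
by apply: filterS => n h; exact: hd.
Qed.

(** Continuous induction on [s]: the set [S] of parameters reached with the right causal relation
    and the right bound contains its supremum by compactness, and [local_concavity] extends it
    beyond any [m < 1]. *)
Lemma timelike_path_concavity a a' b b' xs ys (t : R) :
  timelike_path a a' xs -> timelike_path b b' ys ->
  (forall s, 0 <= s <= 1 -> timelike (xs s) (ys s)) -> 0 < t < 1 ->
  causal (geo a b t) (geo a' b' t) /\
  t * rtau b b' + (1 - t) * rtau a a' <= rtau (geo a b t) (geo a' b' t).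
Proof.
move=> px py tl t01; have /andP[t0 t1] := t01.
have [xs0 xs1 xsp xsc] := px; have [ys0 ys1 ysp ysc] := py.
pose g s := geo (xs s) (ys s) t; pose C := t * rtau b b' + (1 - t) * rtau a a'.
pose S := [set s : R | [/\ 0 <= s <= 1, causal (g 0) (g s) & s * C <= rtau (g 0) (g s)]].
have S0 : S 0.
  by rewrite /S /=; split; rewrite ?lexx ?ler01 ?mul0r ?rtau_ge0//; exact: causal_xx.
have ubS : ubound S 1 by move=> s [/andP[_ s1] _ _].
have supS : has_sup S by split; [exists 0|exists 1].
pose m := sup S.
have m01 : 0 <= m <= 1.
  apply/andP; split; first by apply: ub_le_sup => //; exists 1.
  by apply: ge_sup => //; exists 0.
have /andP[m0 m1] := m01.
(* The points [g (u n)] subconverge in the diamond of [a] and [b']. The limit divides [xs m], [ys m]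
   in the ratio given by [t], so it is [g m] by uniqueness, and the conditions defining [S] pass to
   it. *)
have Sm : S m.
  have appr (n : nat) : exists s, S s /\ `|m - s| < n.+1%:R^-1.
    have n0 : 0 < n.+1%:R^-1 :> R by rewrite invr_gt0.
    have [s Ss hs] := sup_adherent n0 supS; exists s; split=> //.
    have sm : s <= m by apply: ub_le_sup => //; exists 1.
    by rewrite ger0_norm ?subr_ge0// ltrBlDr -ltrBlDl.
  have [u hu] := choice appr.
  have u01 n : 0 <= u n <= 1 by have [[]] := hu n.
  have um : u @ \oo --> m.
    apply/cvgrPdist_lt => e e0; near=> n; have [_ h] := hu n.
    apply: lt_trans h _; near: n; exact: near_infty_natSinv_lt (PosNum e0).
  have [cJ _] := hhyperbolic.
  have [|z [f [_ nf fz]]] := compact_subseq (u := g \o u) (cJ a b').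
    move=> n; have /andP[un0 un1] := u01 n; have tn := tl _ (u01 n).
    split.
      apply: (causal_tr (y := xs (u n))).
        by rewrite -xs0; exact: (timelike_path_causal px).
      by rewrite -{1}(geo0 tn); apply: geo_causal => //; exact: ltW.
    apply: (causal_tr (y := ys (u n))).
      by rewrite -[ys (u n)](geo1 tn); apply: geo_causal => //; exact: ltW.
    by rewrite -ys1; exact: (timelike_path_causal py).
  have xf : (fun n => xs (u (f n))) @ \oo --> xs m.
    exact: (cvg_mdist_sub nf (timelike_path_cvg px m01 u01 um)).
  have yf : (fun n => ys (u (f n))) @ \oo --> ys m.
    exact: (cvg_mdist_sub nf (timelike_path_cvg py m01 u01 um)).
  have tf n := tl _ (u01 (f n)).
  have cx n : causal (xs (u (f n))) (g (u (f n))).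
    by rewrite -{1}(geo0 (tf n)); apply: geo_causal => //; exact: ltW.
  have cy n : causal (g (u (f n))) (ys (u (f n))).
    by rewrite -[ys (u (f n))](geo1 (tf n)); apply: geo_causal => //; exact: ltW.
  have ex n : rtau (xs (u (f n))) (g (u (f n))) = t * rtau (xs (u (f n))) (ys (u (f n))).
    by rewrite -{1}(geo0 (tf n)) rtau_geo// ?subr0// ltW.
  have ey n : rtau (g (u (f n))) (ys (u (f n))) =
      (1 - t) * rtau (xs (u (f n))) (ys (u (f n))).
    by rewrite -{1}(geo1 (tf n)) rtau_geo// ltW.
  have lim3 := rtau_cvg _ xf yf.
  have zE : z = g m.
    apply: geo_unique => //; [exact: tl|exact: causal_closed xf fz|
      exact: causal_closed fz yf| |].
      have l1 : (fun n => t * rtau (xs (u (f n))) (ys (u (f n)))) @ \oo -->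
          t * rtau (xs m) (ys m) by apply: cvgMr; exact: lim3.
      apply: (cvg_unique _ (rtau_cvg _ xf fz)) => //.
      apply: cvg_trans l1; apply: near_eq_cvg; apply: nearW => n.
      by rewrite /= ex.
    have l1 : (fun n => (1 - t) * rtau (xs (u (f n))) (ys (u (f n)))) @ \oo -->
        (1 - t) * rtau (xs m) (ys m) by apply: cvgMr; exact: lim3.
    apply: (cvg_unique _ (rtau_cvg _ fz yf)) => //.
    apply: cvg_trans l1; apply: near_eq_cvg; apply: nearW => n.
    by rewrite /= ey.
  rewrite zE in fz; split=> //.
    by apply: causal_closed (cvg_cst (g 0)) fz => n; have [[]] := hu (f n).
  have l1 : (fun n => rtau (g 0) (g (u (f n)))) @ \oo --> rtau (g 0) (g m).
    by apply: rtau_cvg fz; exact: cvg_cst.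
  have l2 : (fun n => u (f n) * C) @ \oo --> m * C.
    apply: cvgMl; apply: (cvg_comp f u) um.
    by move=> A [n0 _ hA]; exists n0 => // n /= n0n; apply: hA => /=; exact: leq_trans (nf n).
  apply: (ler_cvg_to l2 l1); apply: nearW => n.
  by have [[]] := hu (f n).
have [_ cm hm] := Sm.
have [mlt|mge] := ltP m 1; last first.
  have mE : m = 1 by apply/le_anti; rewrite m1.
  by move: cm hm; rewrite mE mul1r /g xs0 ys0 xs1 ys1.
have [d d0 hd] := local_concavity (tl m m01).
have [dx dx0 hx] := xsc _ d0; have [dy dy0 hy] := ysc _ d0.
pose s := Num.min 1 (m + Num.min dx dy / 2).
have min0 : 0 < Num.min dx dy by rewrite lt_min dx0.
have ms : m < s by rewrite lt_min mlt ltrDl divr_gt0.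
have s1 : s <= 1 by rewrite ge_min lexx.
have s01 : 0 <= s <= 1 by rewrite s1 (le_trans m0 (ltW ms)).
have dist : `|m - s| < Num.min dx dy.
  rewrite ltr0_norm ?subr_lt0// opprB ltrBlDr.
  by apply: (@le_lt_trans _ _ (m + Num.min dx dy / 2)); [rewrite ge_min lexx orbT|lra].
move: dist; rewrite lt_min => /andP[distx disty].
have [pxs rx] := xsp m s m0 ms s1; have [pys ry] := ysp m s m0 ms s1.
have conc := hd _ _ (hx _ _ m01 s01 distx) (hy _ _ m01 s01 disty) (tl s s01) pxs pys.
have ts1 : 0 <= t <= 1 by rewrite !ltW.
have hms : (s - m) * C <= rtau (g m) (g s).
  by have := conc t ts1; rewrite rx ry /C; apply: le_trans; rewrite le_eqVlt;
    apply/orP; left; apply/eqP; ring.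
(* The bound in [hms] is positive unless both ends stay fixed, and then [g s = g m]. *)
have cms : causal (g m) (g s).
  have C0 : 0 <= C by rewrite addr_ge0// mulr_ge0 ?rtau_ge0// ?subr_ge0 ltW.
  case: pxs => [txs|exs].
    apply/timelikeW/rtau_gt0; apply: lt_le_trans hms.
    have D0 : 0 < rtau (xs m) (xs s) by exact/rtau_gt0.
    rewrite mulr_gt0 ?subr_gt0//.
    rewrite rx in D0; have aa : 0 < rtau a a'.
      by move: D0; rewrite pmulr_rgt0// subr_gt0.
    by rewrite /C ltr_wpDl// ?mulr_gt0// ?subr_gt0// mulr_ge0 ?rtau_ge0// ltW.
  case: pys => [tys|eys]; last by rewrite /g exs eys; exact: causal_xx.
  apply/timelikeW/rtau_gt0; apply: lt_le_trans hms.
  have D0 : 0 < rtau (ys m) (ys s) by exact/rtau_gt0.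
  rewrite mulr_gt0 ?subr_gt0//.
  rewrite ry in D0; have bb : 0 < rtau b b'.
    by move: D0; rewrite pmulr_rgt0// subr_gt0.
  by rewrite /C ltr_pwDl// ?mulr_gt0// mulr_ge0 ?rtau_ge0// subr_ge0 ltW.
have Ss : S s.
  split=> //; first exact: causal_tr cm cms.
  by apply: le_trans (rtau_triangle cm cms); lra.
have sm : s <= m by apply: ub_le_sup => //; exists 1.
by have := lt_le_trans ms sm; rewrite ltxx.
Unshelve. all: by end_near. Qed.

(** If both ends moved at once, it would not be evident that they remain timelike related. With one
    end moving at a time this follows from push-up, through [timelike alpha(0) alpha(1)] or
    [timelike beta(0) beta(1)]. *)
Lemma line_concavity (alpha beta : R -> X) (t : R) :
  line Future alpha -> line Future beta ->
  precedes (alpha 0) (beta 0) -> precedes (alpha 1) (beta 1) -> 0 <= t <= 1 ->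
  t * rtau (alpha 1) (beta 1) + (1 - t) * rtau (alpha 0) (beta 0) <=
    rtau (alpha t) (beta t).
Proof.
move=> la lb p0 p1 t01; have [ta _] := la; have [tb _] := lb.
have /andP[] := t01; rewrite le_eqVlt => /predU1P[<- _|t0].
  by rewrite mul0r add0r subr0 mul1r.
rewrite le_eqVlt => /predU1P[->|t1]; first by rewrite mul1r subrr mul0r addr0.
have ts : 0 < t < 1 by rewrite t0.
rewrite (line_geo la t01) (line_geo lb t01).
have [xs px] := exists_timelike_path p0; have [ys py] := exists_timelike_path p1.
have cst z : timelike_path z z (fun=> z).
  split=> //; first by move=> s u _ _ _; rewrite rtauxx mulr0; split=> //; right.
  by move=> e e0; exists 1 => // s u _ _ _; rewrite mdistxx.
have [c1 h1] : causal (geo (alpha 0) (alpha 1) t) (geo (alpha 0) (beta 1) t) /\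
    t * rtau (alpha 1) (beta 1) + (1 - t) * rtau (alpha 0) (alpha 0) <=
    rtau (geo (alpha 0) (alpha 1) t) (geo (alpha 0) (beta 1) t).
  apply: (timelike_path_concavity (cst _) py) => // s /andP[s0 s1].
  apply: (timelike_causal_trans ta); have [<- _ _ _] := py.
  exact: (timelike_path_causal py).
have [c2 h2] : causal (geo (alpha 0) (beta 1) t) (geo (beta 0) (beta 1) t) /\
    t * rtau (beta 1) (beta 1) + (1 - t) * rtau (alpha 0) (beta 0) <=
    rtau (geo (alpha 0) (beta 1) t) (geo (beta 0) (beta 1) t).
  apply: (timelike_path_concavity px (cst _)) => // s /andP[s0 s1].
  apply: (causal_timelike_trans _ tb); have [_ <- _ _] := px.
  exact: (timelike_path_causal px).
apply: le_trans (rtau_triangle c1 c2).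
by move: h1 h2; rewrite !rtauxx !mulr0 addr0 add0r => h1 h2; exact: lerD.
Qed.

End Concavity.

Lemma line_reverse (R : realType) (X : lorentzianPreLengthSpace R)
    (alpha : R -> X) : line Past alpha -> line Future (fun t => alpha (1 - t)).
Proof.
move=> [tl h]; split; first by rewrite /= subr0 subrr.
move=> s t s0 st t1.
have [||| c e] := h (1 - t) (1 - s); [lra|lra|lra|].
split=> //; move: e; rewrite /= subr0 subrr => ->; congr (_ * _); ring.
Qed.

Theorem proposition4p7 (R : realType) (X : lorentzianPreLengthSpace R)
  (hlength : lorentzian_length_space X)
  (hhyperbolic : globally_hyperbolic X)
  (hregular : regular X)
  (hconcave : locally_concave X)
  (hunique : forall x y : X, timelike x y -> unique_timelike_geodesic x y) :
  (forall x y : X, timelike x y ->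
     forall (gamma : R -> X) (a b : R),
       timelike_geodesic_from_to x y gamma a b ->
       length Future gamma a b = tau x y) /\
  globally_concave X.
Proof.
have tauE := rtauE hlength hhyperbolic hconcave.
split.
  move=> x y xy gamma a b.
  exact: (geodesic_length hlength hhyperbolic hconcave hregular hunique xy).
have [geo geoP] := exists_segments hlength hhyperbolic hconcave hregular.
have lineP := timelike_maximizer_line hlength hhyperbolic hconcave.
have conc := line_concavity hlength hhyperbolic hconcave hregular hunique geoP.
split.
- rewrite setXTT; apply: continuous_subspaceT => -[x y].
  have -> : (fun p : X * X => tau p.1 p.2) = EFin \o (fun p => rtau p.1 p.2).
    by apply/funext => p /=.
  apply: continuous_comp; last by [].
  by apply: (rtau_cvg hlength hhyperbolic hconcave); [exact: cvg_fst|exact: cvg_snd].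
- move=> x y _ _ xy.
  have [gamma [a [b [[cc len] ga gb]]]] := exists_maximizer hlength hhyperbolic hconcave xy.
  by exists gamma, a, b; split=> //; rewrite len /= ga gb.
move=> o alpha beta /lineP la /lineP lb _ _ p0 p1 t /itvccP t01.
rewrite !tauE -!EFinM -EFinD lee_fin.
case: o la lb => la lb; first exact: conc.
(* Past-directed lines are reversed in time, which exchanges the two endpoint conditions and
   replaces [t] by [1 - t]. *)
have t01' : 0 <= 1 - t <= 1 by apply/andP; split; have /andP[] := t01; lra.
have := conc _ _ (1 - t) (line_reverse la) (line_reverse lb).
rewrite /= !subr0 !subrr !subKr => /(_ p1 p0 t01').
by rewrite addrC.
Qed.
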